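(* (i) There exists a marked curve $(X;P)$ over $\mathbb{C}$ with $X$ projective whose field of moduli for the extension $\mathbb{C} \mid \mathbb{R}$ is equal to $\mathbb{R}$ but such that $(X;P)$ does not descend to $\mathbb{R}$. (ii) Similarly, there exists a marked map $(X, f : X \to \mathbb{P}^1; P; 0,1,\infty)$ over $\mathbb{C}$ with $X$ projective and $f$ unramified outside $\{0,1,\infty\}$ whose field of moduli for the extension $\mathbb{C} \mid \mathbb{R}$ is equal to $\mathbb{R}$ but that does not descend to $\mathbb{R}$.
   Context: A curve over a field $k$ is a geometrically integral, separated scheme of finite type over $k$ of dimension $1$ (possibly singular). A marked curve $(X;P)$ over $k$ is a curve $X$ over $k$ with a point $P \in X(k)$; an isomorphism $(X;P)\to(X';P')$ is an isomorphism of curves over $k$ sending $P$ to $P'$. A marked map $(X,f:X\to\mathbb{P}^1;P;0,1,\infty)$ over $k$ is a nonconstant (generically separable) morphism $f$ over $k$ from a curve $X$ with a marked point $P\in X(k)$ and with the points $0,1,\infty$ marked on the target; an isomorphism $(X,f;P;0,1,\infty)\to(X',f';P';0,1,\infty)$ is a pair $(\psi,\varphi)$ of isomorphisms $\psi : X \to X'$, $\varphi:\mathbb{P}^1\to\mathbb{P}^1$ over $k$ with $\varphi f = f'\psi$, $\psi(P)=P'$ and $\varphi$ fixing each of $0,1,\infty$ (so $\varphi$ is the identity). The field of moduli of such an object over $\mathbb{C}$ with respect to $\mathbb{C}\mid\mathbb{R}$ is the subfield of $\mathbb{C}$ fixed by those $\sigma\in\mathrm{Gal}(\mathbb{C}\mid\mathbb{R})$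 for which the conjugate of the object by $\sigma$ is isomorphic to the object over $\mathbb{C}$. The object descends to $\mathbb{R}$ if there is an object of the same kind over $\mathbb{R}$ whose base extension to $\mathbb{C}$ is isomorphic to it. *)

(* Defs.v *)
From HB Require Import structures.
From mathcomp Require Import all_boot all_order all_algebra.
From mathcomp Require Import boolp classical_sets reals topology.
From mathcomp Require Import complex.

(** Schemes as locally ringed spaces, curves, marked curves, marked maps, their
    base extensions, and the field of moduli for [C | R].
    Rings are [comPzRingType]s, so that the zero ring is allowed. *)

Set Implicit Arguments.
Unset Strict Implicit.
Unset Printing Implicit Defensive.

Import Order.TTheory GRing.Theory Num.Theory.

Local Open Scope classical_set_scope.
Local Open Scope ring_scope.

(** * Ringed spaces *)

Identity Coercion fun_of_set : set >-> Funclass.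

Record opens (T : topologicalType) := Opens {
  oset :> set T;
  oset_open : open oset
}.

Definition whole (T : topologicalType) : opens T := Opens openT.

Record ringed_space := RingedSpace {
  pts :> topologicalType;
  sec : opens pts -> comPzRingType;
  res : forall U V : opens pts, V `<=` U -> {rmorphism sec U -> sec V};
  res_id : forall (U : opens pts) (h : U `<=` U) (s : sec U), res h s = s;
  res_comp : forall (U V W : opens pts) (hUV : V `<=` U) (hVW : W `<=` V)
    (hUW : W `<=` U) (s : sec U), res hVW (res hUV s) = res hUW s;
  sheaf_separated : forall (U : opens pts) (I : Type) (V : I -> opens pts)
    (hV : forall i, V i `<=` U), U `<=` \bigcup_i V i ->
    forall s t : sec U, (forall i, res (hV i) s = res (hV i) t) -> s = t;
  sheaf_glue : forall (U : opens pts) (I : Type) (V : I -> opens pts)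
    (hV : forall i, V i `<=` U), U `<=` \bigcup_i V i ->
    forall s : forall i, sec (V i),
      (forall i j (W : opens pts) (hi : W `<=` V i) (hj : W `<=` V j),
         res hi (s i) = res hj (s j)) ->
      exists t : sec U, forall i, res (hV i) t = s i
}.

Definition is_invertible (A : comPzRingType) (a : A) : Prop :=
  exists b : A, a * b = 1.

Definition is_prime_ideal (A : comPzRingType) (p : set A) : Prop :=
  [/\ p 0, (forall a b, p a -> p b -> p (a + b)),
      (forall a b, p b -> p (a * b)), ~ p 1 &
      (forall a b, p (a * b) -> p a \/ p b)].

Section RingedSpaceTheory.
Variable X : ringed_space.

(** The germ of [s] at [x] is a unit of the stalk at [x]. *)
Definition inv_at (U : opens X) (s : sec U) (x : X) : Prop :=
  exists (V : opens X) (h : V `<=` U), V x /\ is_invertible (res h s).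

(** The germ of [s] at [x] is not a unit; when the stalk at [x] is local, this
    says that the germ lies in the maximal ideal. *)
Definition vanishes_at (U : opens X) (s : sec U) (x : X) : Prop :=
  U x /\ ~ inv_at s x.

(** All stalks are local rings: nonzero, and [s] or [1 - s] is always a unit. *)
Definition locally_ringed : Prop :=
  forall (x : X) (U : opens X), U x ->
    ~ inv_at (0 : sec U) x /\ forall s : sec U, inv_at s x \/ inv_at (1 - s) x.

(** For [X] locally ringed: the canonical morphism from [U], with the restricted
    sheaf, to [Spec (sec U)] is an isomorphism. That is, it is a bijection on
    points, a homeomorphism (the sets [D(s)] form a basis of the topology), and
    the sections over [D(s)] are the localization of [sec U] at [s]. *)
Definition affine_open (U : opens X) : Prop :=
  [/\ (forall p : set (sec U), is_prime_ideal p ->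
         exists! x : X, U x /\ p = [set s | vanishes_at s x]),
      (forall (x : X) (V : opens X), U x -> V x ->
         exists s : sec U, inv_at s x /\
           forall y, U y -> inv_at s y -> V y) &
      (forall (s : sec U) (W : opens X) (h : W `<=` U),
         (forall x, W x <-> inv_at s x) ->
         (forall t : sec W, exists (n : nat) (a : sec U),
            t * res h s ^+ n = res h a) /\
         (forall a : sec U, res h a = 0 -> exists n : nat, s ^+ n * a = 0))].

End RingedSpaceTheory.

Record scheme := Scheme {
  space :> ringed_space;
  space_local : locally_ringed space;
  space_affine : forall x : space, exists U : opens space, U x /\ affine_open U
}.

(** * Morphisms of schemes *)

Lemma preim_open (S T : topologicalType) (f : S -> T) (V : opens T) :
  continuous f -> open (f @^-1` V).
Proof. by move=> /continuousP; apply; exact: oset_open. Qed.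

Definition preim (S T : topologicalType) (f : S -> T) (cf : continuous f)
  (V : opens T) : opens S := Opens (preim_open V cf).

Record hom (X Y : scheme) := Hom {
  hfun :> X -> Y;
  hcont : continuous hfun;
  hsec : forall V : opens Y, {rmorphism sec V -> sec (preim hcont V)};
  hsec_res : forall (U V : opens Y) (h : V `<=` U)
    (h' : preim hcont V `<=` preim hcont U) (s : sec U),
    res h' (hsec U s) = hsec V (res h s);
  hsec_local : forall (V : opens Y) (s : sec V) (x : X),
    V (hfun x) -> inv_at (hsec V s) x -> inv_at s (hfun x)
}.

Definition hpre (X Y : scheme) (f : hom X Y) (V : opens Y) : opens X :=
  preim (@hcont _ _ f) V.

Definition pull (X Y : scheme) (f : hom X Y) (V : opens Y) :
  {rmorphism sec V -> sec (hpre f V)} := hsec f V.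

Definition hom_eq (X Y : scheme) (f g : hom X Y) : Prop :=
  (forall x, f x = g x) /\
  forall (V : opens Y) (s : sec V) (W : opens X)
    (hf : W `<=` hpre f V) (hg : W `<=` hpre g V),
    res hf (pull f V s) = res hg (pull g V s).

Section Composition.
Variables (X Y Z : scheme) (g : hom Y Z) (f : hom X Y).

Let gf : X -> Z := g \o f.

Lemma hcomp_cont : continuous gf.
Proof.
move=> x; apply: continuous_comp; [exact: (@hcont _ _ f)|].
exact: (@hcont _ _ g).
Qed.

Lemma hcomp_sub (V : opens Z) : preim hcomp_cont V `<=` hpre f (hpre g V).
Proof. by []. Qed.

Definition hcomp_sec (V : opens Z) :
    {rmorphism sec V -> sec (preim hcomp_cont V)} :=
  res (@hcomp_sub V) \o (pull f (hpre g V) \o pull g V).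

Lemma hcomp_res (U V : opens Z) (h : V `<=` U)
    (h' : preim hcomp_cont V `<=` preim hcomp_cont U) (s : sec U) :
  res h' (hcomp_sec U s) = hcomp_sec V (res h s).
Proof.
have hg : hpre g V `<=` hpre g U by move=> y; exact: h.
have hf : hpre f (hpre g V) `<=` hpre f (hpre g U) by move=> x; exact: h.
rewrite /hcomp_sec /= -(hsec_res h hg) -(hsec_res hg hf).
have k : preim hcomp_cont V `<=` hpre f (hpre g U) by move=> x; exact: h.
by rewrite (res_comp _ _ k) (res_comp _ _ k).
Qed.

Lemma hcomp_local (V : opens Z) (s : sec V) (x : X) :
  V (gf x) -> inv_at (hcomp_sec V s) x -> inv_at s (gf x).
Proof.
move=> Vx [W [h [Wx iW]]]; apply: (@hsec_local _ _ g) => //.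
apply: (@hsec_local _ _ f) => //.
have k : W `<=` hpre f (hpre g V) by move=> y /h.
by exists W, k; split=> //; rewrite -(res_comp (@hcomp_sub V) h).
Qed.

Definition hcomp : hom X Z := Hom hcomp_res hcomp_local.

End Composition.

Section Identity.
Variable X : scheme.

Lemma hid_cont : continuous (@id X).
Proof. by move=> x. Qed.

Lemma hid_sub (V : opens X) : preim hid_cont V `<=` V.
Proof. by []. Qed.

Lemma hid_res (U V : opens X) (h : V `<=` U)
    (h' : preim hid_cont V `<=` preim hid_cont U) (s : sec U) :
  res h' (res (@hid_sub U) s) = res (@hid_sub V) (res h s).
Proof.
have k : preim hid_cont V `<=` U by move=> x; exact: h.
by rewrite !(res_comp _ _ k).
Qed.

Lemma hid_local (V : opens X) (s : sec V) (x : X) :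
  V x -> inv_at (res (@hid_sub V) s) x -> inv_at s x.
Proof.
move=> Vx [W [h [Wx iW]]].
have k : W `<=` V by move=> y /h.
by exists W, k; split=> //; rewrite -(res_comp (@hid_sub V) h).
Qed.

Definition hid : hom X X := Hom hid_res hid_local.

End Identity.

(** [f] is a homeomorphism onto a closed subset and the map of sheaves
    [O_Y -> f_* O_X] is surjective. *)
Definition closed_immersion (X Y : scheme) (f : hom X Y) : Prop :=
  [/\ injective f,
      (forall A : set X, closed A -> closed (f @` A)) &
      (forall (V : opens Y) (s : sec (hpre f V)) (x : X), V (f x) ->
         exists (W : opens Y) (h : W `<=` V) (h' : hpre f W `<=` hpre f V)
           (t : sec W), W (f x) /\ pull f W t = res h' s)].

(** Unramified at [x], in residue characteristic zero: the maximal ideal of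
    [f x] generates that of [x], and the residue field extension is finite
    (hence finite separable). *)
Definition unramified_at (X Y : scheme) (f : hom X Y) (x : X) : Prop :=
  (forall (U : opens X) (s : sec U), vanishes_at s x ->
     exists (V : opens X) (W : opens Y) (hU : V `<=` U) (hW : V `<=` hpre f W)
       (n : nat) (a : 'I_n -> sec V) (t : 'I_n -> sec W),
       [/\ V x, (forall i, vanishes_at (t i) (f x)) &
           res hU s = \sum_i a i * res hW (pull f W (t i))]) /\
  (exists (U0 : opens X) (n : nat) (e : 'I_n -> sec U0), U0 x /\
     forall (U : opens X) (s : sec U), U x ->
     exists (V : opens X) (W : opens Y) (h0 : V `<=` U0) (hU : V `<=` U)
       (hW : V `<=` hpre f W) (t : 'I_n -> sec W),
       vanishes_at
         (res hU s - \sum_i res hW (pull f W (t i)) * res h0 (e i)) x).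

(** * Schemes over a field *)

(** A morphism from [X] to [Spec k] is a ring morphism from [k] to the ring of
    global sections. *)
Record kscheme (k : fieldType) := KScheme {
  ksch :> scheme;
  kstr : {rmorphism k -> sec (whole ksch)}
}.

Definition const (k : fieldType) (X : kscheme k) (U : opens X) :
    {rmorphism k -> sec U} :=
  res (@subsetT _ U : U `<=` whole X) \o kstr X.

(** The morphism [f] lies over [Spec l -> Spec k] given by [iota]. *)
Definition lies_over (k l : fieldType) (iota : k -> l) (Y : kscheme l)
    (X : kscheme k) (f : hom Y X) : Prop :=
  forall (V : opens X) (a : k),
    pull f V (const V a) = const (hpre f V) (iota a).

Definition over_base (k : fieldType) (X Y : kscheme k) (f : hom X Y) : Prop :=
  lies_over id f.

(** [pi] exhibits [Y] as the fibre product of [X] and [Spec l] over [Spec k];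
    a test scheme with a map to [Spec l] is a scheme over [l]. *)
Definition base_extension (k l : fieldType) (iota : {rmorphism k -> l})
    (X : kscheme k) (Y : kscheme l) (pi : hom Y X) : Prop :=
  lies_over iota pi /\
  forall (T : kscheme l) (g : hom T X), lies_over iota g ->
    (exists h : hom T Y, over_base h /\ hom_eq (hcomp pi h) g) /\
    (forall h h' : hom T Y, over_base h -> over_base h' ->
       hom_eq (hcomp pi h) g -> hom_eq (hcomp pi h') g -> hom_eq h h').

Definition fibre_product (k : fieldType) (X Z : kscheme k)
    (p q : hom Z X) : Prop :=
  [/\ over_base p, over_base q &
      forall (T : kscheme k) (g g' : hom T X), over_base g -> over_base g' ->
        (exists h : hom T Z, [/\ over_base h,
           hom_eq (hcomp p h) g & hom_eq (hcomp q h) g']) /\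
        (forall h h' : hom T Z, over_base h -> over_base h' ->
           hom_eq (hcomp p h) g -> hom_eq (hcomp q h) g' ->
           hom_eq (hcomp p h') g -> hom_eq (hcomp q h') g' -> hom_eq h h')].

Definition separated (k : fieldType) (X : kscheme k) : Prop :=
  forall (Z : kscheme k) (p q : hom Z X), fibre_product p q ->
  forall delta : hom X Z, over_base delta ->
    hom_eq (hcomp p delta) (hid X) -> hom_eq (hcomp q delta) (hid X) ->
    closed_immersion delta.

Definition finitely_generated (k : fieldType) (X : kscheme k)
    (U : opens X) : Prop :=
  exists (n : nat) (g : 'I_n -> sec U), forall S : set (sec U),
    (forall a, S (const U a)) -> (forall s t, S s -> S t -> S (s + t)) ->
    (forall s t, S s -> S t -> S (s * t)) -> (forall i, S (g i)) ->
    forall s, S s.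

Definition finite_type (k : fieldType) (X : kscheme k) : Prop :=
  exists (n : nat) (U : 'I_n -> opens X),
    (forall x, exists i, U i x) /\
    forall i, affine_open (U i) /\ finitely_generated (U i).

Definition integral_scheme (X : scheme) : Prop :=
  (exists x : X, True) /\
  forall U : opens X, (exists x, U x) ->
    forall s t : sec U, s * t = 0 -> s = 0 \/ t = 0.

(** The base extension to an algebraic closure [L] is integral. *)
Definition geometrically_integral (k : fieldType) (X : kscheme k) : Prop :=
  forall (L : closedFieldType) (j : {rmorphism k -> L}),
    (forall z : L, algebraicOver j z) ->
    forall (Y : kscheme L) (pi : hom Y X), base_extension j pi ->
      integral_scheme Y.

Definition irreducible_closed (T : topologicalType) (Z : set T) : Prop :=
  [/\ closed Z, Z !=set0 &
      forall A B : set T, closed A -> closed B -> Z `<=` A `|` B ->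
        Z `<=` A \/ Z `<=` B].

Definition irreducible_chain (T : topologicalType) (d : nat)
    (Z : nat -> set T) : Prop :=
  (forall i, (i <= d)%N -> irreducible_closed (Z i)) /\
  (forall i, (i < d)%N -> Z i `<` Z i.+1).

Definition has_dimension (T : topologicalType) (d : nat) : Prop :=
  (exists Z : nat -> set T, irreducible_chain d Z) /\
  (forall e (Z : nat -> set T), irreducible_chain e Z -> (e <= d)%N).

Definition curve (k : fieldType) (X : kscheme k) : Prop :=
  [/\ geometrically_integral X, separated X, finite_type X &
      has_dimension X 1].

(** Points with residue field [k], i.e. elements of [X(k)]: every germ is
    congruent to a constant modulo the maximal ideal. *)
Definition rational_point (k : fieldType) (X : kscheme k) (x : X) : Prop :=
  forall (U : opens X) (s : sec U), U x ->
    exists a : k, vanishes_at (s - const U a) x.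

(** [X] is projective [n]-space with homogeneous coordinates [x_0, ..., x_n]:
    it is glued from the affine spaces [U i] on which [x_i] is invertible, with
    [y i j] the coordinate [x_j / x_i] on [U i]. The second item says that
    [sec (U i)] is the polynomial ring over [k] in the [y i j], [j != i]. *)
Definition projective_space (k : fieldType) (n : nat) (X : kscheme k)
    (U : 'I_n.+1 -> opens X) (y : forall i, 'I_n.+1 -> sec (U i)) : Prop :=
  [/\ (forall x, exists i, U i x) /\ (forall i, affine_open (U i)),
      (forall i, y i i = 1 /\
         forall (B : comPzRingType) (c : {rmorphism k -> B})
           (b : 'I_n.+1 -> B), b i = 1 ->
         (exists phi : {rmorphism sec (U i) -> B},
            (forall a, phi (const (U i) a) = c a) /\
            (forall j, phi (y i j) = b j)) /\
         (forall phi psi : {rmorphism sec (U i) -> B},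
            (forall a, phi (const (U i) a) = psi (const (U i) a)) ->
            (forall j, phi (y i j) = psi (y i j)) -> phi =1 psi)),
      (forall i j x, U i x -> (U j x <-> inv_at (y i j) x)) &
      (forall i j l (W : opens X) (hi : W `<=` U i) (hj : W `<=` U j),
         res hi (y i l) = res hj (y j l) * res hi (y i j))].

Definition has_coords (k : fieldType) (n : nat) (X : kscheme k)
    (U : 'I_n.+1 -> opens X) (y : forall i, 'I_n.+1 -> sec (U i))
    (x : X) (a : 'I_n.+1 -> k) : Prop :=
  (exists i, a i != 0) /\
  forall i, a i != 0 ->
    forall j, vanishes_at (y i j - const (U i) (a j / a i)) x.

Definition projective (k : fieldType) (X : kscheme k) : Prop :=
  exists (n : nat) (Q : kscheme k) (U : 'I_n.+1 -> opens Q)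
    (y : forall i, 'I_n.+1 -> sec (U i)) (f : hom X Q),
    [/\ projective_space y, over_base f & closed_immersion f].

(** [T] is the projective line, with [p0], [p1], [poo] the points
    [[0 : 1]], [[1 : 1]], [[1 : 0]]. *)
Definition marked_line (k : fieldType) (T : kscheme k) (p0 p1 poo : T) : Prop :=
  exists (U : 'I_2 -> opens T) (y : forall i, 'I_2 -> sec (U i)),
    [/\ projective_space y,
        has_coords y p0 (fun i => if i == ord0 then 0 else 1),
        has_coords y p1 (fun=> 1) &
        has_coords y poo (fun i => if i == ord0 then 1 else 0)].

(** * Marked curves *)

Record pointed_scheme (k : fieldType) := PointedScheme {
  mc_curve :> kscheme k;
  mc_pt : mc_curve
}.

Definition marked_curve (k : fieldType) (X : pointed_scheme k) : Prop :=
  curve X /\ rational_point (mc_pt X).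

Definition inverse_homs (X Y : scheme) (f : hom X Y) (g : hom Y X) : Prop :=
  hom_eq (hcomp g f) (hid X) /\ hom_eq (hcomp f g) (hid Y).

Definition isomorphism (k : fieldType) (X Y : kscheme k) (f : hom X Y) : Prop :=
  over_base f /\ exists g : hom Y X, over_base g /\ inverse_homs f g.

Definition marked_curve_iso (k : fieldType) (X Y : pointed_scheme k) : Prop :=
  exists psi : hom X Y, isomorphism psi /\ psi (mc_pt X) = mc_pt Y.

Definition marked_curve_base_ext (k l : fieldType) (iota : {rmorphism k -> l})
    (X : pointed_scheme k) (Y : pointed_scheme l) : Prop :=
  exists pi : hom Y X, base_extension iota pi /\ pi (mc_pt Y) = mc_pt X.

(** * Marked maps *)

Record pointed_map (k : fieldType) := PointedMap {
  mm_src : kscheme k;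
  mm_tgt : kscheme k;
  mm_map : hom mm_src mm_tgt;
  mm_pt : mm_src;
  mm_0 : mm_tgt;
  mm_1 : mm_tgt;
  mm_oo : mm_tgt
}.

(** Generic separability is automatic in characteristic zero. *)
Definition marked_map (k : fieldType) (F : pointed_map k) : Prop :=
  [/\ curve (mm_src F) /\ rational_point (mm_pt F),
      marked_line (mm_0 F) (mm_1 F) (mm_oo F),
      over_base (mm_map F) &
      ~ exists y, forall x, mm_map F x = y].

Definition unramified_outside_01oo (k : fieldType) (F : pointed_map k) : Prop :=
  forall x : mm_src F, mm_map F x <> mm_0 F -> mm_map F x <> mm_1 F ->
    mm_map F x <> mm_oo F -> unramified_at (mm_map F) x.

Definition marked_map_iso (k : fieldType) (F G : pointed_map k) : Prop :=
  exists (psi : hom (mm_src F) (mm_src G)) (phi : hom (mm_tgt F) (mm_tgt G)),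
    [/\ isomorphism psi /\ isomorphism phi,
        hom_eq (hcomp phi (mm_map F)) (hcomp (mm_map G) psi),
        psi (mm_pt F) = mm_pt G &
        [/\ phi (mm_0 F) = mm_0 G, phi (mm_1 F) = mm_1 G &
            phi (mm_oo F) = mm_oo G]].

Definition marked_map_base_ext (k l : fieldType) (iota : {rmorphism k -> l})
    (F : pointed_map k) (G : pointed_map l) : Prop :=
  exists (pi : hom (mm_src G) (mm_src F)) (rho : hom (mm_tgt G) (mm_tgt F)),
    [/\ base_extension iota pi /\ base_extension iota rho,
        over_base (mm_map G) /\
        hom_eq (hcomp rho (mm_map G)) (hcomp (mm_map F) pi),
        pi (mm_pt G) = mm_pt F &
        [/\ rho (mm_0 G) = mm_0 F, rho (mm_1 G) = mm_1 F &
            rho (mm_oo G) = mm_oo F]].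

(** * Field of moduli and descent for [C | R] *)

Section FieldOfModuli.
Variable R : realType.
Local Notation C := (R[i] : fieldType).

Definition in_Gal (sigma : {rmorphism C -> C}) : Prop :=
  bijective sigma /\ forall x : R, sigma (real_complex R x) = real_complex R x.

Definition fixed_subfield (G : set {rmorphism C -> C}) : set C :=
  [set z | forall sigma, G sigma -> sigma z = z].

(** The conjugate of [X] by [sigma] is its base extension along [sigma]. *)
Definition field_of_moduli_curve (X : pointed_scheme C) : set C :=
  fixed_subfield [set sigma | in_Gal sigma /\
    exists Y, marked_curve_base_ext sigma X Y /\ marked_curve_iso Y X].

Definition field_of_moduli_map (F : pointed_map C) : set C :=
  fixed_subfield [set sigma | in_Gal sigma /\
    exists G, marked_map_base_ext sigma F G /\ marked_map_iso G F].

Definition marked_curve_descends (X : pointed_scheme C) : Prop :=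
  exists X0 : pointed_scheme R, marked_curve X0 /\
    exists Y, marked_curve_base_ext (real_complex R) X0 Y /\
      marked_curve_iso Y X.

Definition marked_map_descends (F : pointed_map C) : Prop :=
  exists F0 : pointed_map R, marked_map F0 /\
    exists G, marked_map_base_ext (real_complex R) F0 G /\
      marked_map_iso G F.

End FieldOfModuli.

(* Main.v *)
Require Import Defs.
From HB Require Import structures.
From mathcomp Require Import all_boot all_order all_algebra generic_quotient.
From mathcomp Require Import boolp classical_sets reals topology.
From mathcomp Require Import complex mpoly ring zify.
(* Imported again, so that [hom] denotes the morphisms of schemes. *)
Require Import Defs.

(** The counterexample. Let [X] be the projective closure of the image of the torus
    under [z |-> (g : 1 : z : z^-1 : F)], where

      [g = - (z^12 + z^-12 - 2) / 4],
      [F = (1 + i) z^4 + (1 - i) z^-4 + z^2 - z^-2].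

    Where the coordinate [1] does not vanish, [X] is the torus; the points 0 and
    infinity of the projective line, which are missing from the torus, are glued into a
    single point [P] ([off_torus]), very singular, and [P] is the marked point.

    Field of moduli. Complex conjugation combined with [z -> i / z] is a semilinear
    automorphism of [X]: it fixes [g], [F] and [P], and exchanges [z] and [z^-1] up to
    constants. Hence [(X;P)] is isomorphic to its conjugate ([XP_conj_iso]), and the
    field of moduli is the field of real numbers. The square of this automorphism is
    [z -> - z], so it is not a descent datum.

    Descent. A real form would provide a semilinear automorphism of [X] which is an
    involution and fixes [P] ([descent_involution]). It preserves the torus, so it maps [z] to [c z], or to [c / z] with
    [c] real ([theta_z]). The decisive point is that the local ring at [P] remembers
    [F] up to a scalar. Indeed [1 / g] vanishes to order 12 on both branches at [P],
    whereas the poles of [1], [z], [z^-1], [F] have order at most 4. So in a function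
    regular at [P] only the linear terms are visible modulo order 13: it is
    [c + (x F + y + u z + t / z) / g] with the same coefficients on both branches
    ([bijet_glue]). For the images of [1 / g] and [F / g] this forces the image of [F]
    to be a multiple of [F] ([rigid_F]), and the coefficients of [F] are chosen so that
    no involution of the above form does this ([no_involution]).

    The map. The function [g] extends to a morphism from [X] to the projective line
    sending [P] to infinity. Its derivative vanishes only if [z^24 = 1], where [g] is 0
    or 1; so it is unramified outside 0, 1 and infinity ([belyi_unramified]). As the
    semilinear automorphism fixes [g], the marked map is isomorphic to its conjugate
    too ([belyi_conj_iso]), and it does not descend because its source does not.

    Schemes. All schemes at hand are integral, and are described inside a function
    field [K]: an affine cover is a family of subrings of [K] ([atlas]), points are
    local subrings of [K], and sections are elements of [K]. Charts are affine
    ([affine_chart]), such schemes are separated ([atlas_separated]), morphisms between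
    them come from partial homomorphisms of function fields ([phom_hom]), and closures
    of images of rational maps to projective space are projective
    ([proj_model_projective]). Forms over the real numbers are arbitrary schemes; they
    enter only through the universal property of the base extension and through
    morphisms from spectra of subrings of [K] ([spec_hom]). *)

Set Implicit Arguments.
Unset Strict Implicit.
Unset Printing Implicit Defensive.

Import GRing.Theory.

Local Open Scope classical_set_scope.
Local Open Scope ring_scope.

(** * Local subrings of a field *)

Record is_subring (K : fieldType) (A : set K) : Prop := IsSubring {
  subring1 : A 1;
  subringB : forall a b, A a -> A b -> A (a - b);
  subringM : forall a b, A a -> A b -> A (a * b)
}.

Section Subring.
Variables (K : fieldType) (A : set K).
Hypothesis hA : is_subring A.

Lemma subring0 : A 0.
Proof. by rewrite -(subrr 1); apply: (subringB hA); apply: (subring1 hA). Qed.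

Lemma subringN a : A a -> A (- a).
Proof. by rewrite -sub0r; apply: (subringB hA); exact: subring0. Qed.

Lemma subringD a b : A a -> A b -> A (a + b).
Proof. by move=> ha hb; rewrite -(opprK b); apply: (subringB hA) => //; exact: subringN. Qed.

Lemma subringX a n : A a -> A (a ^+ n).
Proof.
move=> ha; elim: n => [|n IH]; first by rewrite expr0; exact: (subring1 hA).
by rewrite exprS; apply: (subringM hA).
Qed.

Lemma subring_nat n : A n%:R.
Proof.
elim: n => [|n IH]; first exact: subring0.
by rewrite -natr1; apply: subringD => //; exact: (subring1 hA).
Qed.

Lemma subring_sum (I : Type) (r : seq I) (F : I -> K) :
  (forall i, A (F i)) -> A (\sum_(i <- r) F i).
Proof. by move=> h; apply: big_ind => //; [exact: subring0 | exact: subringD]. Qed.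

End Subring.

Definition unit_in (K : fieldType) (O : set K) (s : K) : Prop :=
  [/\ s != 0, O s & O s^-1].

Section UnitIn.
Variables (K : fieldType) (O : set K).
Hypothesis hO : is_subring O.

Lemma unit_in1 : unit_in O 1.
Proof. by split; rewrite ?oner_neq0 ?invr1 //; exact: (subring1 hO). Qed.

Lemma unit_inM a b : unit_in O a -> unit_in O b -> unit_in O (a * b).
Proof.
move=> [a0 Oa Oa'] [b0 Ob Ob']; split; first exact: mulf_neq0.
  exact: (subringM hO).
by rewrite invfM; exact: (subringM hO).
Qed.

Lemma unit_inX a n : unit_in O a -> unit_in O (a ^+ n).
Proof.
move=> ha; elim: n => [|n IH]; first by rewrite expr0; exact: unit_in1.
by rewrite exprS; apply: unit_inM.
Qed.

Lemma unit_in_mull a b : O a -> O b -> unit_in O (a * b) -> unit_in O a.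
Proof.
move=> Oa Ob [ab0 _ Oi]; have := ab0; rewrite mulf_eq0 negb_or => /andP[a0 b0].
split=> //; have -> : a^-1 = b * (a * b)^-1 by rewrite invfM mulrCA divff ?mulr1.
exact: (subringM hO).
Qed.

Lemma unit_in_inv a : unit_in O a -> unit_in O a^-1.
Proof. by move=> [a0 Oa Oi]; split; rewrite ?invr_eq0 ?invrK. Qed.

Lemma unit_in_of_mul1 a b : O a -> O b -> a * b = 1 -> unit_in O a.
Proof.
move=> Oa Ob ab; apply: (@unit_in_mull _ b) => //; rewrite ab; exact: unit_in1.
Qed.

Lemma unit_inN a : unit_in O a -> unit_in O (- a).
Proof.
move=> [a0 Oa Oi]; split; rewrite ?oppr_eq0 ?invrN //; exact: (subringN hO).
Qed.

End UnitIn.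

(** Locality in terms of units, the form in which the stalks of a scheme are
    required to be local. *)
Definition is_local (K : fieldType) (O : set K) : Prop :=
  is_subring O /\ forall s, O s -> unit_in O s \/ unit_in O (1 - s).

Section Local.
Variables (K : fieldType) (O : set K).
Hypothesis hO : is_local O.
Let sO := hO.1.

Lemma nonunitD a b : O a -> O b -> ~ unit_in O a -> ~ unit_in O b ->
  ~ unit_in O (a + b).
Proof.
move=> Oa Ob na nb [ab0 _ Oi].
have Oai : O (a * (a + b)^-1) by apply: (subringM sO).
have Obi : O (b * (a + b)^-1) by apply: (subringM sO).
case: (hO.2 _ Oai) => u.
  by apply: na; apply: (unit_in_mull sO Oa Oi).
apply: nb; apply: (unit_in_mull sO Ob Oi).
have <- // : 1 - a / (a + b) = b / (a + b).
by rewrite -[X in X - _](divff ab0) -mulrBl addrC addrA addNr add0r.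
Qed.

Lemma nonunitM a b : O a -> O b -> ~ unit_in O b -> ~ unit_in O (a * b).
Proof. by move=> Oa Ob nb; rewrite mulrC => /(unit_in_mull sO Ob Oa). Qed.

Lemma unit_inD a b : unit_in O a -> O b -> ~ unit_in O b -> unit_in O (a + b).
Proof.
move=> ua Ob nb; have [_ Oa _] := ua.
apply: contrapT => nab; apply: (@nonunitD (a + b) (- b)) => //.
- exact: subringD.
- exact: (subringN sO Ob).
- by move/(unit_inN sO); rewrite opprK.
- by rewrite addrK.
Qed.

End Local.

(** [O] is the localization of [A] at a prime ideal, namely at the set of
    elements of [A] which are not units of [O]. *)
Record is_localization (K : fieldType) (A O : set K) : Prop := IsLocalization {
  localization_local : is_local O;
  localization_sub : A `<=` O;
  localization_frac : forall h, O h ->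
    exists a b, [/\ A a, A b, unit_in O b & h = a / b]
}.

Lemma localization_eq (K : fieldType) (A O O' : set K) :
  is_localization A O -> is_localization A O' ->
  (forall a, A a -> unit_in O a <-> unit_in O' a) -> O = O'.
Proof.
move=> l l' e; apply/seteqP; split=> h.
- move=> /(localization_frac l)[a [b [Aa Ab ub ->]]].
  have [_ _ Ob] := (e _ Ab).1 ub.
  by apply: (subringM (localization_local l').1) => //; apply: (localization_sub l').
- move=> /(localization_frac l')[a [b [Aa Ab ub ->]]].
  have [_ _ Ob] := (e _ Ab).2 ub.
  by apply: (subringM (localization_local l).1) => //; apply: (localization_sub l).
Qed.

Record is_prime (K : fieldType) (A p : set K) : Prop := IsPrime {
  prime_sub : p `<=` A;
  prime0 : p 0;
  primeD : forall a b, p a -> p b -> p (a + b);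
  primeM : forall a b, A a -> p b -> p (a * b);
  prime1 : ~ p 1;
  prime_or : forall a b, A a -> A b -> p (a * b) -> p a \/ p b
}.

Definition loc (K : fieldType) (A p : set K) : set K :=
  [set h | exists a b, [/\ A a, A b, ~ p b & h = a / b]].

Section Loc.
Variables (K : fieldType) (A p : set K).
Hypotheses (hA : is_subring A) (hp : is_prime A p).

Let nz b : ~ p b -> b != 0.
Proof. by move=> nb; apply/eqP => b0; apply: nb; rewrite b0; exact: (prime0 hp). Qed.

Let np a b : A a -> A b -> ~ p a -> ~ p b -> ~ p (a * b).
Proof. by move=> Aa Ab na nb /(prime_or hp Aa Ab)[]. Qed.

Lemma loc_sub : A `<=` loc A p.
Proof.
move=> a Aa; exists a, 1; split=> //; rewrite ?divr1 //; first exact: (subring1 hA).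
exact: (prime1 hp).
Qed.

Lemma loc_subring : is_subring (loc A p).
Proof.
split=> [|_ _ [a [b [Aa Ab nb ->]]] [c [d [Ac Ad nd ->]]]
         |_ _ [a [b [Aa Ab nb ->]]] [c [d [Ac Ad nd ->]]]].
- exact/loc_sub/(subring1 hA).
- exists (a * d - c * b), (b * d); split.
  + by apply: (subringB hA); apply: (subringM hA).
  + exact: (subringM hA).
  + exact: np.
  + by field; rewrite !nz.
- exists (a * c), (b * d); split.
  + exact: (subringM hA).
  + exact: (subringM hA).
  + exact: np.
  + by field; rewrite !nz.
Qed.

Lemma loc_unit a : A a -> unit_in (loc A p) a <-> ~ p a.
Proof.
move=> Aa; split=> [[a0 _ [c [d [Ac Ad nd e]]]] pa|na].
  have d0 := nz nd; apply: nd; have -> : d = c * a.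
    apply: (mulIf (invr_neq0 a0)); rewrite mulfK // e.
    by rewrite mulrC divfK.
  exact: (primeM hp).
split; [exact: nz | exact: loc_sub |].
by exists 1, a; split=> //; rewrite ?div1r //; exact: (subring1 hA).
Qed.

Lemma loc_local : is_local (loc A p).
Proof.
split=> [|_ [a [b [Aa Ab nb ->]]]]; first exact: loc_subring.
have ub : unit_in (loc A p) b by apply/loc_unit.
have [pa|na] := pselect (p a); last first.
  left; apply: (unit_inM loc_subring); first exact/loc_unit.
  exact: unit_in_inv.
right; have -> : 1 - a / b = (b - a) / b by field; exact: nz.
apply: (unit_inM loc_subring); last exact: unit_in_inv.
have Aba := subringB hA Ab Aa.
by apply/loc_unit => // pba; apply: nb; rewrite -(subrK a b); apply: (primeD hp).
Qed.

Lemma loc_localization : is_localization A (loc A p).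
Proof.
split; [exact: loc_local | exact: loc_sub |].
move=> h [a [b [Aa Ab nb ->]]]; exists a, b; split=> //; exact/loc_unit.
Qed.

End Loc.

(** * Integral schemes glued from subrings of a field *)

(** An integral scheme presented inside its function field by the rings of an
    affine cover. Seen from chart [i], the part lying in chart [j] is the set
    where [trans i j] is invertible. *)
Record atlas := Atlas {
  fld : fieldType;
  idx : Type;
  idx0 : idx;
  chart : idx -> set fld;
  chart_subring : forall i, is_subring (chart i);
  trans : idx -> idx -> fld;
  trans_in : forall i j, chart i (trans i j);
  transK : forall i j, trans i j * trans j i = 1;
  trans_loc : forall i j a, chart j a -> exists n, chart i (a * trans i j ^+ n)
}.

(** A point is its local ring, as a subring of the function field. This
    identifies the points of different charts without gluing; it is faithful
    for a separated scheme, where no two points have the same local ring. *)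
Record point (M : atlas) := Point {
  lring : set (fld M);
  lring_loc : exists i, is_localization (chart i) lring
}.

HB.instance Definition _ (M : atlas) := gen_eqMixin (point M).
HB.instance Definition _ (M : atlas) := gen_choiceMixin (point M).

Section AtlasTheory.
Variable M : atlas.
Implicit Types (x y : point M) (i j : idx M).

Lemma point_eq x y : lring x = lring y -> x = y.
Proof.
case: x y => [O h] [O' h'] /= e; move: e h h' => -> h h'.
by rewrite (Prop_irrelevance h h').
Qed.

Definition in_chart i x : Prop := chart i `<=` lring x.

Lemma lring_local x : is_local (lring x).
Proof. by have [i l] := lring_loc x; exact: (localization_local l). Qed.

Lemma lring_subring x : is_subring (lring x).
Proof. exact: (lring_local x).1. Qed.

Lemma trans_unit i j x : in_chart i x -> in_chart j x ->
  unit_in (lring x) (trans i j).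
Proof.
move=> hi hj; apply: (unit_in_of_mul1 (lring_subring x) _ _ (transK i j)).
  exact/hi/trans_in.
exact/hj/trans_in.
Qed.

Lemma in_chart_of_unit i j x : in_chart i x -> unit_in (lring x) (trans i j) ->
  in_chart j x.
Proof.
move=> hi [t0 Ot Oi] a ha; have [n hn] := trans_loc i ha.
rewrite -(mulfK (expf_neq0 n t0) a) -exprVn.
apply: (subringM (lring_subring x)); first exact: hi.
exact: (subringX (lring_subring x)).
Qed.

(** A point lies in every chart ring contained in its local ring as a prime of
    that ring: fractions over one chart become fractions over another one after
    multiplication by a power of the transition function. *)
Lemma in_chart_loc i x : in_chart i x -> is_localization (chart i) (lring x).
Proof.
move=> hi; have [j l] := lring_loc x; have hj : in_chart j x.
  exact: (localization_sub l).
split=> //; first exact: lring_local.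
move=> h /(localization_frac l)[a [b [Aa Ab ub ->]]].
have [n hn] := trans_loc i Aa; have [m hm] := trans_loc i Ab.
have ut := trans_unit hi hj; have [t0 _ _] := ut.
have Xt k : chart i (trans i j ^+ k).
  exact/(subringX (chart_subring i))/trans_in.
exists (a * trans i j ^+ n * trans i j ^+ m).
exists (b * trans i j ^+ m * trans i j ^+ n); split.
- exact: (subringM (chart_subring i)).
- exact: (subringM (chart_subring i)).
- apply: (unit_inM (lring_subring x)).
    apply: (unit_inM (lring_subring x)) => //.
    exact: (unit_inX (lring_subring x)).
  exact: (unit_inX (lring_subring x)).
- by case: ub => b0 _ _; field; rewrite b0 !expf_neq0.
Qed.

Lemma point_chart x : exists i, in_chart i x.
Proof. by have [i l] := lring_loc x; exists i; exact: (localization_sub l). Qed.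

Lemma point_eq_chart i x y : in_chart i x -> in_chart i y ->
  (forall a, chart i a -> unit_in (lring x) a <-> unit_in (lring y) a) -> x = y.
Proof.
move=> hx hy e; apply: point_eq.
exact: (localization_eq (in_chart_loc hx) (in_chart_loc hy)).
Qed.

Definition bopen i (s : fld M) : set (point M) :=
  [set x | in_chart i x /\ unit_in (lring x) s].

Definition atlas_open (U : set (point M)) : Prop :=
  forall x, U x -> exists i s, [/\ chart i s, bopen i s x & bopen i s `<=` U].

Lemma atlas_openT : atlas_open setT.
Proof.
move=> x _; have [i hi] := point_chart x; exists i, 1.
by split=> //; [exact: (subring1 (chart_subring i)) | split=> //;
  exact: (unit_in1 (lring_subring x))].
Qed.

(** Over a common point the two charts differ by powers of the transition
    function, which may be moved into the function defining the basic open set.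
    *)
Lemma bopen_chart i j t x : in_chart i x -> chart j t -> bopen j t x ->
  exists s, [/\ chart i s, unit_in (lring x) s & bopen i s `<=` bopen j t].
Proof.
move=> hi ht [hj ut]; have [n hn] := trans_loc i ht.
have uij := trans_unit hi hj.
exists (trans i j * (t * trans i j ^+ n)); split.
- by apply: (subringM (chart_subring i)) => //; exact: trans_in.
- apply: (unit_inM (lring_subring x)) => //.
  apply: (unit_inM (lring_subring x)) => //.
  exact: (unit_inX (lring_subring x)).
- move=> y [hy uy]; have sy := lring_subring y.
  have uy1 : unit_in (lring y) (trans i j).
    by apply: (unit_in_mull sy _ _ uy); apply: hy => //; exact: trans_in.
  have jy := in_chart_of_unit hy uy1; split=> //.
  have [_ Ot _] := uy1; move: uy; rewrite mulrC => /(unit_in_mull sy (hy _ hn) Ot).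
  by apply: (unit_in_mull sy (jy _ ht)); exact: (subringX sy).
Qed.

Lemma atlas_open_basis i x (U : set (point M)) : atlas_open U -> U x ->
  in_chart i x ->
  exists s, [/\ chart i s, unit_in (lring x) s & bopen i s `<=` U].
Proof.
move=> oU Ux hi; have [j [t [ht bx sub]]] := oU _ Ux.
have [s [hs us sub']] := bopen_chart hi ht bx.
by exists s; split=> //; exact: (subset_trans sub' sub).
Qed.

Lemma atlas_openI : setI_closed atlas_open.
Proof.
move=> U V oU oV x [Ux Vx]; have [i hi] := point_chart x.
have [s [hs us subs]] := atlas_open_basis oU Ux hi.
have [t [ht ut subt]] := atlas_open_basis oV Vx hi.
exists i, (s * t); split.
- exact: (subringM (chart_subring i)).
- by split=> //; exact: (unit_inM (lring_subring x)).
- move=> y [hy uy]; have sy := lring_subring y; split.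
    by apply: subs; split=> //; apply: (unit_in_mull sy _ _ uy); apply: hy.
  apply: subt; split=> //; move: uy; rewrite mulrC => uy.
  by apply: (unit_in_mull sy _ _ uy); apply: hy.
Qed.

Lemma atlas_open_bigU (I : Type) (f : I -> set (point M)) :
  (forall k, atlas_open (f k)) -> atlas_open (\bigcup_k f k).
Proof.
move=> of_ x [k _ fx]; have [i [s [hs bx sub]]] := of_ k _ fx.
by exists i, s; split=> // y /sub; exists k.
Qed.

End AtlasTheory.

HB.instance Definition _ (M : atlas) := isOpenTopological.Build (point M)
  (@atlas_openT M) (@atlas_openI M) (@atlas_open_bigU M).

Section Sections.
Variable M : atlas.
Implicit Types (x y : point M) (i j : idx M) (U V W : opens (point M)).

Lemma atlas_openE (U : set (point M)) : open U = atlas_open U.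
Proof. by []. Qed.

Lemma opens_basis i x U : U x -> in_chart i x ->
  exists s, [/\ chart i s, unit_in (lring x) s & bopen i s `<=` U].
Proof. by apply: atlas_open_basis; rewrite -atlas_openE; exact: oset_open. Qed.

(** A denominator which is invertible at a point is invertible near it. *)
Lemma open_regular s : open [set x : point M | lring x s].
Proof.
rewrite atlas_openE => x /= xs; have [i hi] := point_chart x.
have [a [b [Aa Ab ub ->]]] := localization_frac (in_chart_loc hi) xs.
exists i, b; split=> // y [hy [b0 _ bi]].
by apply: (subringM (lring_subring y)) => //; exact: hy.
Qed.

Lemma open_unit s : open [set x : point M | unit_in (lring x) s].
Proof.
have [->|s0] := eqVneq s 0.
  rewrite (_ : [set x | _] = set0); first exact: open0.
  by apply/seteqP; split=> // x []; rewrite eqxx.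
rewrite (_ : [set x | _] = [set x | lring x s] `&` [set x | lring x s^-1]).
  by apply: openI; exact: open_regular.
by apply/seteqP; split=> x /= []; rewrite /unit_in.
Qed.

Lemma open_chart i : open [set x : point M | in_chart i x].
Proof.
rewrite atlas_openE => x hx; exists i, 1; split=> [||y []//].
  exact: (subring1 (chart_subring i)).
by split=> //; exact: (unit_in1 (lring_subring x)).
Qed.

(** The generic point: its local ring is the field of fractions of any chart. *)
Lemma zero_prime i : is_prime (chart i) [set (0 : fld M)].
Proof.
split=> //=.
- by move=> _ ->; exact: (subring0 (chart_subring i)).
- by move=> _ _ -> ->; rewrite addr0.
- by move=> a _ _ ->; rewrite mulr0.
- by apply/eqP; rewrite oner_neq0.
- by move=> a b _ _ /eqP; rewrite mulf_eq0 => /orP[]/eqP; [left|right].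
Qed.

Definition generic : point M :=
  Point (ex_intro _ (idx0 M)
    (loc_localization (chart_subring (idx0 M)) (zero_prime (idx0 M)))).

Lemma generic_unit s : unit_in (lring generic) s <-> s != 0 /\ lring generic s.
Proof.
split=> [[]//|[s0 [a [b [Aa Ab nb e]]]]]; split=> //; first by exists a, b.
exists b, a; split=> //; last by rewrite e invf_div.
by move=> a0; move: s0; rewrite e (_ : a = 0) // mul0r eqxx.
Qed.

Lemma generic_chart i : in_chart i generic.
Proof.
have h0 : in_chart (idx0 M) generic.
  exact: (loc_sub (chart_subring _) (zero_prime _)).
apply: (in_chart_of_unit h0); apply/generic_unit.
split; last exact/h0/trans_in.
by apply: contra_eq_neq (transK (idx0 M) i) => ->; rewrite mul0r eq_sym oner_neq0.
Qed.

Lemma generic_open U x : U x -> U generic.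
Proof.
move=> Ux; have [i hi] := point_chart x.
have [s [hs [s0 _ _] sub]] := opens_basis Ux hi.
apply: sub; split; first exact: generic_chart.
by apply/generic_unit; split=> //; exact: (generic_chart hs).
Qed.

(** A section is the element of [K] that it is; over the empty set only [0] is
    allowed, and plays the part of [1]. *)
Definition regular U (s : fld M) : Prop :=
  (forall x, U x -> lring x s) /\ (~ U generic -> s = 0).

Record section U := Section_ { value : fld M; valueP : regular U value }.

Lemma value_inj U : injective (@value U).
Proof.
move=> [s h] [t h'] /= e; move: e h h' => -> h h'.
by rewrite (Prop_irrelevance h h').
Qed.

End Sections.

HB.instance Definition _ (M : atlas) (U : opens (point M)) := gen_eqMixin (section U).
HB.instance Definition _ (M : atlas) (U : opens (point M)) := gen_choiceMixin (section U).

Section SectionRing.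
Variables (M : atlas) (U : opens (point M)).

Definition one_on : fld M := if `[< U (generic M) >] then 1 else 0.

Lemma regular0 : regular U 0.
Proof. by split=> // x _; exact: (subring0 (lring_subring x)). Qed.

Lemma regularN s : regular U s -> regular U (- s).
Proof.
move=> [h h0]; split=> [x Ux|/h0 ->]; last by rewrite oppr0.
by apply: (subringN (lring_subring x)); exact: h.
Qed.

Lemma regularD s t : regular U s -> regular U t -> regular U (s + t).
Proof.
move=> [h h0] [k k0]; split=> [x Ux|Un]; last by rewrite h0 // k0 // addr0.
by apply: (subringD (lring_subring x)); [exact: h | exact: k].
Qed.

Lemma regularM s t : regular U s -> regular U t -> regular U (s * t).
Proof.
move=> [h h0] [k k0]; split=> [x Ux|Un]; last by rewrite h0 // mul0r.
by apply: (subringM (lring_subring x)); [exact: h | exact: k].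
Qed.

Lemma regular1 : regular U one_on.
Proof.
rewrite /one_on; split=> [x Ux|Un]; last by rewrite asboolF.
by rewrite asboolT; [exact: (subring1 (lring_subring x)) | exact: (generic_open Ux)].
Qed.

Definition sec0 : section U := Section_ regular0.
Definition secN (s : section U) : section U := Section_ (regularN (valueP s)).
Definition secD (s t : section U) : section U :=
  Section_ (regularD (valueP s) (valueP t)).
Definition secM (s t : section U) : section U :=
  Section_ (regularM (valueP s) (valueP t)).
Definition sec1 : section U := Section_ regular1.

Lemma secDA : associative secD.
Proof. by move=> a b c; apply: value_inj; rewrite /= addrA. Qed.
Lemma secDC : commutative secD.
Proof. by move=> a b; apply: value_inj; rewrite /= addrC. Qed.
Lemma sec0D : left_id sec0 secD.
Proof. by move=> a; apply: value_inj; rewrite /= add0r. Qed.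
Lemma secND : left_inverse sec0 secN secD.
Proof. by move=> a; apply: value_inj; rewrite /= addNr. Qed.

HB.instance Definition _ := GRing.isZmodule.Build (section U) secDA secDC sec0D secND.

Lemma secMA : associative secM.
Proof. by move=> a b c; apply: value_inj; rewrite /= mulrA. Qed.
Lemma secMC : commutative secM.
Proof. by move=> a b; apply: value_inj; rewrite /= mulrC. Qed.
Lemma sec1M : left_id sec1 secM.
Proof.
move=> a; apply: value_inj; rewrite /= /one_on; case: asboolP => [_|n].
  by rewrite mul1r.
by rewrite mul0r (valueP a).2.
Qed.
Lemma secMDl : left_distributive secM secD.
Proof. by move=> a b c; apply: value_inj; rewrite /= mulrDl. Qed.

HB.instance Definition _ := GRing.Zmodule_isComPzRing.Build (section U)
  secMA secMC sec1M secMDl.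

Lemma value0 : value (0 : section U) = 0. Proof. by []. Qed.
Lemma valueD (s t : section U) : value (s + t) = value s + value t. Proof. by []. Qed.
Lemma valueB (s t : section U) : value (s - t) = value s - value t. Proof. by []. Qed.
Lemma valueM (s t : section U) : value (s * t) = value s * value t. Proof. by []. Qed.
Lemma value1 x : U x -> value (1 : section U) = 1.
Proof. by move=> Ux; rewrite /= /one_on asboolT //; exact: (generic_open Ux). Qed.
Lemma valueX x (s : section U) n : U x -> value (s ^+ n) = value s ^+ n.
Proof.
move=> Ux; elim: n => [|n IH]; first by rewrite !expr0 (value1 Ux).
by rewrite !exprS valueM IH.
Qed.

Lemma section_eq0 (s : section U) : ~ U (generic M) -> s = 0.
Proof. by move=> n; apply: value_inj; rewrite (valueP s).2. Qed.

Lemma value_eq (s t : section U) : (U (generic M) -> value s = value t) -> s = t.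
Proof.
move=> h; have [u|n] := pselect (U (generic M)); first by apply: value_inj; exact: h.
by rewrite (section_eq0 s n) (section_eq0 t n).
Qed.

Lemma value_in (s : section U) x : U x -> lring x (value s).
Proof. exact: (valueP s).1. Qed.

Definition to_sec (a : fld M) (h : forall x, U x -> lring x a) : section U.
Proof.
exists (if `[< U (generic M) >] then a else 0).
by case: asboolP => [u|n]; [split=> // /(_ u) | exact: regular0].
Defined.

Lemma value_to_sec a h x : U x -> value (@to_sec a h) = a.
Proof. by move=> Ux /=; rewrite asboolT //; exact: (generic_open Ux). Qed.

End SectionRing.

Definition mk_rmorphism (R S : pzRingType) (f : R -> S) (f1 : f 1 = 1)
    (fB : {morph f : a b / a - b}) (fM : {morph f : a b / a * b}) :
    {rmorphism R -> S} :=
  HB.pack f (GRing.isZmodMorphism.Build R S f fB)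
    (GRing.isMonoidMorphism.Build R S f (conj f1 fM)).

Section AtlasScheme.
Variable M : atlas.
Implicit Types (x y : point M) (U V W : opens (point M)).

Definition rres_fun U V (h : V `<=` U) (s : section U) : section V :=
  @to_sec M V (value s) (fun x Vx => value_in s (h x Vx)).

Lemma rres_1 U V (h : V `<=` U) : rres_fun h 1 = 1.
Proof.
apply: value_eq => Vg; rewrite (value_to_sec _ Vg) (value1 Vg).
exact: (value1 (h _ Vg)).
Qed.

Lemma rres_B U V (h : V `<=` U) : {morph rres_fun h : a b / a - b}.
Proof. by move=> a b; apply: value_eq => Vg; rewrite valueB !(value_to_sec _ Vg). Qed.

Lemma rres_M U V (h : V `<=` U) : {morph rres_fun h : a b / a * b}.
Proof. by move=> a b; apply: value_eq => Vg; rewrite valueM !(value_to_sec _ Vg). Qed.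

Definition rres U V (h : V `<=` U) : {rmorphism section U -> section V} :=
  mk_rmorphism (rres_1 h) (rres_B h) (rres_M h).

Lemma value_rres U V (h : V `<=` U) s x : V x -> value (rres h s) = value s.
Proof. by move=> Vx; rewrite (value_to_sec _ Vx). Qed.

Lemma rres_id U (h : U `<=` U) (s : section U) : rres h s = s.
Proof. by apply: value_eq => Ug; rewrite (value_rres _ _ Ug). Qed.

Lemma rres_comp U V W (hUV : V `<=` U) (hVW : W `<=` V) (hUW : W `<=` U)
  (s : section U) : rres hVW (rres hUV s) = rres hUW s.
Proof.
by apply: value_eq => Wg; rewrite !(value_rres _ _ Wg) (value_rres _ _ (hVW _ Wg)).
Qed.

Lemma rsep U (I : Type) (V : I -> opens (point M)) (hV : forall i, V i `<=` U) :
  U `<=` \bigcup_i V i ->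
  forall s t : section U, (forall i, rres (hV i) s = rres (hV i) t) -> s = t.
Proof.
move=> cov s t e; apply: value_eq => /cov[k _ Vg].
by rewrite -(value_rres (hV k) s Vg) -(value_rres (hV k) t Vg) e.
Qed.

(** All nonempty open sets contain the generic point, so compatible sections
    are one and the same element of [K]. *)
Lemma rglue U (I : Type) (V : I -> opens (point M)) (hV : forall i, V i `<=` U) :
  U `<=` \bigcup_i V i ->
  forall s : forall i, section (V i),
      (forall i j (W : opens (point M)) (hi : W `<=` V i) (hj : W `<=` V j),
         rres hi (s i) = rres hj (s j)) ->
      exists t : section U, forall i, rres (hV i) t = s i.
Proof.
move=> cov s e; have [Ug|nUg] := pselect (U (generic M)); last first.
  exists 0 => k; apply: value_eq => Vg; case: nUg; exact: (hV _ _ Vg).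
have [k _ Vkg] := cov _ Ug.
have same l : V l (generic M) -> value (s l) = value (s k).
  move=> Vlg; pose W := Opens (openI (oset_open (V k)) (oset_open (V l))).
  have hk : W `<=` V k by move=> ? [].
  have hl : W `<=` V l by move=> ? [].
  have Wg : W (generic M) by [].
  by rewrite -(value_rres hk _ Wg) -(value_rres hl _ Wg) (e k l W hk hl).
have reg x : U x -> lring x (value (s k)).
  move=> /cov[l _ Vlx]; rewrite -(same l); first exact: value_in.
  exact: (generic_open Vlx).
exists (to_sec reg) => l; apply: value_eq => Vlg.
by rewrite (value_rres _ _ Vlg) (value_to_sec _ Ug) same.
Qed.

Definition atlas_space : ringed_space :=
  @RingedSpace (point M : topologicalType)
    (fun U => section U : comPzRingType) rres rres_id rres_comp rsep rglue.

Lemma inv_atP U (s : @sec atlas_space U) x : U x ->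
  @inv_at atlas_space U s x <-> unit_in (lring x) (value s).
Proof.
move=> Ux; split=> [[V [h [Vx [b e]]]]|u].
  have e' : value s * value b = 1.
    by rewrite -(value_rres h s Vx) -valueM -(value1 Vx); congr value.
  exact: (unit_in_of_mul1 (lring_subring x) (value_in s Ux) (value_in b Vx) e').
pose V : opens (point M) := Opens (openI (oset_open U) (@open_unit M (value s))).
have h : V `<=` U by move=> ? [].
have r : forall y, V y -> lring y (value s)^-1 by move=> y [_ []].
have Vx : V x by [].
exists V, h; split=> //; exists (to_sec r); apply: value_eq => Vg.
rewrite valueM (value_to_sec _ Vg) (value1 Vg) (value_rres _ _ Vg) mulfV //.
by case: u.
Qed.

Lemma vanishes_atP U (s : @sec atlas_space U) x : U x ->
  @vanishes_at atlas_space U s x <-> ~ unit_in (lring x) (value s).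
Proof.
move=> Ux; rewrite /vanishes_at; split=> [[_]|n]; first by move=> + /(inv_atP _ Ux).
by split=> // /(inv_atP _ Ux).
Qed.

Lemma atlas_local : locally_ringed atlas_space.
Proof.
move=> x U Ux; split=> [/(inv_atP _ Ux)[]|s]; first by rewrite eqxx.
have [u|u] := (lring_local x).2 _ (value_in s Ux); [left|right].
  exact/inv_atP.
by apply/(inv_atP _ Ux); rewrite valueB (value1 Ux).
Qed.

End AtlasScheme.

(** * Charts are affine *)

Record is_ideal (K : fieldType) (A J : set K) : Prop := IsIdeal {
  ideal_sub : J `<=` A;
  ideal0 : J 0;
  idealD : forall a b, J a -> J b -> J (a + b);
  idealM : forall a b, A a -> J b -> J (a * b)
}.

Section PrimeAvoidance.
Variables (K : fieldType) (A J : set K) (s : K).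
Hypotheses (hA : is_subring A) (hJ : is_ideal A J).
Hypothesis avoid : forall n, ~ J (s ^+ n).

(** An ideal maximal among those avoiding the powers of [s] is prime. *)
Lemma prime_avoiding : exists p, [/\ is_prime A p, J `<=` p & ~ p s].
Proof.
(* The empty set is admitted below because [Zorn_bigcup] also asks for the union of
   the empty chain. *)
pose good (X : set K) := [/\ is_ideal A X, J `<=` X & forall n, ~ X (s ^+ n)].
have goodJ : good J by split.
have [p [p0 pmax]] : exists p, (p = set0 \/ good p) /\
    forall X, p `<` X -> ~ (X = set0 \/ good X).
  apply: (@Zorn_bigcup _ [set X | X = set0 \/ good X]) => F FP Ftot.
  have [[X [FX gX]]|nF] := pselect (exists X, F X /\ good X); last first.
    left; apply/seteqP; split=> // x [X FX Xx].
    case: (FP X FX) => [X0|gX]; first by rewrite X0 in Xx.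
    by case: nF; exists X.
  right; have el a : (\bigcup_(Y in F) Y) a -> exists Y, [/\ F Y, good Y & Y a].
    move=> [Y FY Ya]; exists Y; split=> //.
    by case: (FP Y FY) => // Y0; rewrite Y0 in Ya.
  split=> [|a Ja|n [Y FY]].
  - split.
    + by move=> a /el[Y [_ [iY _ _] Ya]]; exact: (ideal_sub iY).
    + by exists X => //; case: gX => iX _ _; exact: (ideal0 iX).
    + move=> a b /el[Y [FY [iY _ _] Ya]] /el[Z [FZ [iZ _ _] Zb]].
      case: (Ftot _ _ FY FZ) => sub.
        by exists Z => //; apply: (idealD iZ) => //; exact: sub.
      by exists Y => //; apply: (idealD iY) => //; exact: sub.
    + move=> a b Aa /el[Y [FY [iY _ _] Yb]].
      by exists Y => //; exact: (idealM iY).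
  - by exists X => //; case: gX => _ + _; apply.
  - by move=> Ys; case: (FP Y FY) => [Y0|[_ _ /(_ n)]//]; rewrite Y0 in Ys.
have gp : good p.
  case: p0 => // p0; have := pmax J; rewrite p0 => h.
  case: h; last by right.
  by split=> //; move=> /(_ _ (ideal0 hJ)).
case: gp => ip Jp np; exists p; split=> //; last by have := np 1%N; rewrite expr1.
have ext a : A a -> ~ p a -> exists n x c, [/\ p x, A c & s ^+ n = x + c * a].
  move=> Aa na; pose q := [set y | exists x c, [/\ p x, A c & y = x + c * a]].
  have pq : p `<=` q.
    by move=> x px; exists x, 0; split=> //; [exact: subring0 | rewrite mul0r addr0].
  have qa : q a.
    exists 0, 1; split; [exact: (ideal0 ip) | exact: (subring1 hA) |].
    by rewrite mul1r add0r.
  have iq : is_ideal A q.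
    split.
    - move=> _ [x [c [px Ac ->]]]; apply: (subringD hA).
        exact: (ideal_sub ip).
      exact: (subringM hA).
    - exact/pq/(ideal0 ip).
    - move=> _ _ [x [c [px Ac ->]]] [y [d [py Ad ->]]].
      exists (x + y), (c + d); split; [exact: (idealD ip) | exact: subringD |].
      by ring.
    - move=> e _ Ae [x [c [px Ac ->]]]; exists (e * x), (e * c); split.
      + exact: (idealM ip).
      + exact: (subringM hA).
      + by ring.
  have : ~ (q = set0 \/ good q).
    by apply: pmax; split=> // /(_ _ qa).
  move=> nq; apply: contrapT => nex; apply: nq; right; split=> //.
    exact: (subset_trans Jp).
  by move=> n [x [c [px Ac e]]]; apply: nex; exists n, x, c.
split.
- exact: (ideal_sub ip).
- exact: (ideal0 ip).
- exact: (idealD ip).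
- exact: (idealM ip).
- by have := np 0%N; rewrite expr0.
- move=> a b Aa Ab pab; apply: contrapT => /not_orP[na nb].
  have [n [x [c [px Ac en]]]] := ext _ Aa na.
  have [m [y [d [py Ad em]]]] := ext _ Ab nb.
  apply: (np (n + m)%N); rewrite exprD en em.
  have -> : (x + c * a) * (y + d * b) =
      (y + d * b) * x + (c * a * y + c * d * (a * b)) by ring.
  have Ay := ideal_sub ip py.
  apply: (idealD ip); last apply: (idealD ip).
  - by apply: (idealM ip) => //; apply: (subringD hA) => //; exact: (subringM hA).
  - by apply: (idealM ip) => //; exact: (subringM hA).
  - by apply: (idealM ip) => //; exact: (subringM hA).
Qed.

End PrimeAvoidance.

Section Affine.
Variable M : atlas.
Implicit Types (x y : point M) (i j : idx M) (U V W : opens (point M)).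

Definition chart_open i : opens (point M) := Opens (@open_chart M i).

Definition prime_point i (p : set (fld M)) (hp : is_prime (chart i) p) : point M :=
  Point (ex_intro _ i (loc_localization (chart_subring i) hp)).

Lemma prime_point_chart i p (hp : is_prime (chart i) p) :
  in_chart i (prime_point hp).
Proof. exact: (loc_sub (chart_subring i) hp). Qed.

Lemma prime_point_unit i p (hp : is_prime (chart i) p) a : chart i a ->
  unit_in (lring (prime_point hp)) a <-> ~ p a.
Proof. exact: (loc_unit (chart_subring i) hp). Qed.

(** An element of [K] regular wherever [s] is invertible has its denominators
    contained in no prime avoiding [s], hence a power of [s] is a denominator. *)
Lemma regular_on_bopen i s t : chart i s ->
  (forall x, bopen i s x -> lring x t) -> exists n, chart i (t * s ^+ n).
Proof.
move=> As reg; have sA := chart_subring i.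
pose J := [set b | chart i b /\ chart i (b * t)].
have hJ : is_ideal (chart i) J.
  split.
  - by move=> b [].
  - by split; rewrite ?mul0r; exact: (subring0 sA).
  - by move=> a b [Aa at_] [Ab bt]; split; rewrite ?mulrDl; exact: (subringD sA).
  - by move=> a b Aa [Ab bt]; split; rewrite -?mulrA; exact: (subringM sA).
apply: contrapT => nex.
have [|p [hp Jp ns]] := @prime_avoiding _ _ _ s sA hJ.
  by move=> n [_ h]; apply: nex; exists n; rewrite mulrC.
have bx : bopen i s (prime_point hp).
  by split; [exact: prime_point_chart | exact/prime_point_unit].
have [a [b [Aa Ab nb e]]] := reg _ bx.
have b0 : b != 0 by apply: contra_notP (nb); move=> /negP/negPn/eqP ->; exact: (prime0 hp).
by apply: nb; apply: Jp; split=> //; rewrite e mulrC divfK.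
Qed.

Lemma section_chart i (s : section (chart_open i)) : chart i (value s).
Proof.
have [|n] := @regular_on_bopen i 1 (value s) (subring1 (chart_subring i)).
  by move=> x [hx _]; exact: value_in.
by rewrite expr1n mulr1.
Qed.

Lemma chart_regular i a : chart i a -> forall x, chart_open i x -> lring x a.
Proof. by move=> Aa x; exact. Qed.

Definition chart_sec i a (Aa : chart i a) : section (chart_open i) :=
  to_sec (chart_regular Aa).

Lemma chart_openg i : chart_open i (generic M).
Proof. exact: generic_chart. Qed.

Lemma value_chart_sec i a (Aa : chart i a) : value (chart_sec Aa) = a.
Proof. by rewrite (value_to_sec _ (@chart_openg i)). Qed.

(** The points of a chart are the localizations of its ring at its primes, its
    sections are the elements of its ring by [section_chart], and the sections
    over [D(s)] have powers of [s] for denominators by [regular_on_bopen]. *)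
Lemma affine_chart i : @affine_open (atlas_space M) (chart_open i).
Proof.
have v1 : value (1 : section (chart_open i)) = 1 by exact: (value1 (@chart_openg i)).
split.
- move=> p [p0 pD pM p1 por].
  pose q := [set a | exists s, p s /\ value s = a].
  have pq s : q (value s) <-> p s.
    by split=> [[t [pt /value_inj <-]]//|ps]; exists s.
  have vc a (Aa : chart i a) : q a <-> p (chart_sec Aa).
    by rewrite -{1}(value_chart_sec Aa).
  have hq : is_prime (chart i) q.
    split.
    - by move=> _ [s [_ <-]]; exact: section_chart.
    - by exists 0; split.
    - by move=> _ _ [s [ps <-]] [t [pt <-]]; exists (s + t); split; [exact: pD|].
    - move=> a _ Aa [s [ps <-]]; exists (chart_sec Aa * s); split; first exact: pM.
      by rewrite valueM value_chart_sec.
    - by rewrite -v1 pq.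
    - move=> a b Aa Ab; rewrite -(value_chart_sec Aa) -(value_chart_sec Ab) -valueM.
      by rewrite !pq; exact: por.
  have pp s : p s <-> ~ unit_in (lring (prime_point hq)) (value s).
    by rewrite -pq prime_point_unit ?notK //; exact: section_chart.
  exists (prime_point hq); split.
    split; first exact: prime_point_chart.
    apply/seteqP; split=> s /=.
      move/pp => n; apply/(vanishes_atP s) => //; exact: prime_point_chart.
    by move/(vanishes_atP s (prime_point_chart hq))/pp.
  move=> y [hy py]; apply: (@point_eq_chart _ i) => //; first exact: prime_point_chart.
  move=> a Aa; rewrite prime_point_unit // -(value_chart_sec Aa) pq py /=.
  rewrite vanishes_atP //; split; [exact: contrapT | by move=> ? ?].
- move=> x V hx Vx; have [s [As us sub]] := opens_basis Vx hx.
  exists (chart_sec As : @sec (atlas_space M) _); split.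
    by apply/inv_atP => //; rewrite value_chart_sec.
  move=> y hy /(inv_atP _ hy); rewrite value_chart_sec => uy.
  by apply: sub.
- move=> s W h hW; have hWu x : chart_open i x -> W x <-> unit_in (lring x) (value s).
    by move=> hx; rewrite hW inv_atP.
  split=> [t|a /(congr1 (@value _ _))].
    have [Wg|nWg] := pselect (W (generic M)); last first.
      by exists 0%N, 0; rewrite rmorph0 (section_eq0 t nWg) mul0r.
    have [|n hn] := @regular_on_bopen i (value s) (value t) (section_chart s).
      by move=> x [hx ux]; apply: value_in; apply/hWu.
    exists n, (chart_sec hn); apply: value_inj.
    rewrite valueM (value_rres _ _ Wg) value_chart_sec (valueX _ _ Wg).
    by rewrite (value_rres _ _ Wg).
  have [Wg|nWg] := pselect (W (generic M)).
    rewrite (value_rres _ _ Wg) => a0; exists 0%N.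
    by apply: value_inj; rewrite valueM a0 mulr0.
  exists 1%N; rewrite expr1; suff -> : s = 0 by rewrite mul0r.
  apply: value_inj; apply: contrapT => s0; apply: nWg; apply/hWu.
    exact: chart_openg.
  apply/generic_unit; split; first exact/eqP.
  by apply: value_in; exact: chart_openg.
Qed.

Lemma atlas_affine (x : atlas_space M) :
  exists U : opens (atlas_space M), U x /\ affine_open U.
Proof.
by have [i hi] := point_chart x; exists (chart_open i); split=> //;
  exact: affine_chart.
Qed.

Definition atlas_scheme : scheme := Scheme (@atlas_local M) atlas_affine.

End Affine.

(** * Equality of morphisms *)

Section HomEq.
Implicit Types X Y Z : scheme.

Lemma pull_res X Y (f : hom X Y) (U V : opens Y) (h : V `<=` U)
  (h' : hpre f V `<=` hpre f U) (s : sec U) :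
  pull f V (res h s) = res h' (pull f U s).
Proof. by rewrite /pull hsec_res. Qed.

Lemma pull_hcomp X Y Z (g : hom Y Z) (f : hom X Y) (V : opens Z) (s : sec V)
  (W : opens X) (h : W `<=` hpre (hcomp g f) V) (h' : W `<=` hpre f (hpre g V)) :
  res h (pull (hcomp g f) V s) = res h' (pull f (hpre g V) (pull g V s)).
Proof. by rewrite /pull /= (res_comp _ _ h'). Qed.

Lemma hom_eq_refl X Y (f : hom X Y) : hom_eq f f.
Proof. by split=> // V s W h h'; rewrite (Prop_irrelevance h h'). Qed.

Lemma hom_eq_sym X Y (f g : hom X Y) : hom_eq f g -> hom_eq g f.
Proof. by move=> [e e']; split=> [x|V s W h h']; rewrite ?e // (e' _ _ _ h' h). Qed.

Lemma hom_eq_trans X Y (f g h : hom X Y) :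
  hom_eq f g -> hom_eq g h -> hom_eq f h.
Proof.
move=> [e e'] [k k']; split=> [x|V s W hf hh]; first by rewrite e k.
have hg : W `<=` hpre g V by move=> x /hf; rewrite /hpre /preim /= e.
by rewrite (e' _ _ _ hf hg) (k' _ _ _ hg hh).
Qed.

Lemma hcomp_eq X Y Z (g g' : hom Y Z) (f f' : hom X Y) :
  hom_eq g g' -> hom_eq f f' -> hom_eq (hcomp g f) (hcomp g' f').
Proof.
move=> [e e'] [k k']; split=> [x /=|V s W h h']; first by rewrite k e.
have h1 : W `<=` hpre f (hpre g V) by move=> x /h.
have h2 : W `<=` hpre f' (hpre g V) by move=> x /h; rewrite /hpre /preim /= k.
have h3 : W `<=` hpre f' (hpre g' V) by move=> x /h'.
rewrite (pull_hcomp _ h h1) (pull_hcomp _ h' h3) (k' _ _ _ h1 h2).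
have s1 : hpre g V `<=` hpre g' V by move=> y; rewrite /hpre /preim /= e.
have s2 : hpre f' (hpre g V) `<=` hpre f' (hpre g' V) by move=> x; exact: s1.
have e1 : pull g V s = res s1 (pull g' V s).
  by rewrite -(e' V s _ (@subset_refl _ (hpre g V)) s1) res_id.
by rewrite e1 (pull_res s1 s2) (res_comp _ _ h3).
Qed.

Lemma hcompA X Y Z T (h : hom Z T) (g : hom Y Z) (f : hom X Y) :
  hom_eq (hcomp h (hcomp g f)) (hcomp (hcomp h g) f).
Proof.
split=> // V s W k k'.
have h1 : W `<=` hpre (hcomp g f) (hpre h V) by [].
have h2 : W `<=` hpre f (hpre (hcomp h g) V) by [].
have h3 : W `<=` hpre f (hpre g (hpre h V)) by [].
have sub : hpre (hcomp h g) V `<=` hpre g (hpre h V) by [].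
have sub' : hpre f (hpre (hcomp h g) V) `<=` hpre f (hpre g (hpre h V)) by [].
rewrite (pull_hcomp _ k h1) (pull_hcomp _ k' h2) (pull_hcomp _ h1 h3).
have e1 : pull (hcomp h g) V s = res sub (pull g (hpre h V) (pull h V s)).
  by rewrite -(pull_hcomp s (@subset_refl _ (hpre (hcomp h g) V)) sub) res_id.
by rewrite e1 (pull_res sub sub') (res_comp _ _ h3).
Qed.

Lemma pull_hid X (V : opens X) (s : sec V) (W : opens X)
  (h : W `<=` hpre (hid X) V) (h' : W `<=` V) :
  res h (pull (hid X) V s) = res h' s.
Proof. by rewrite /pull /= (res_comp _ _ h'). Qed.

Lemma hcomp_idl X Y (f : hom X Y) : hom_eq (hcomp (hid Y) f) f.
Proof.
split=> // V s W h h'; have h1 : W `<=` hpre f (hpre (hid Y) V) by [].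
have sub : hpre (hid Y) V `<=` V by [].
have sub' : hpre f (hpre (hid Y) V) `<=` hpre f V by [].
have e1 : pull (hid Y) V s = res sub s.
  by rewrite -(pull_hid s (@subset_refl _ (hpre (hid Y) V)) sub) res_id.
by rewrite (pull_hcomp _ h h1) e1 (pull_res sub sub') (res_comp _ _ h').
Qed.

Lemma hcomp_idr X Y (f : hom X Y) : hom_eq (hcomp f (hid X)) f.
Proof.
split=> // V s W h h'; have h1 : W `<=` hpre (hid X) (hpre f V) by [].
by rewrite (pull_hcomp _ h h1) (pull_hid _ _ h').
Qed.

Lemma res_const (k : fieldType) (X : kscheme k) (U V : opens X) (h : V `<=` U) a :
  res h (const U a) = const V a.
Proof. exact: res_comp. Qed.

Lemma lies_over_comp (k l m : fieldType) (iota : k -> l) (kappa : l -> m)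
  (X : kscheme k) (Y : kscheme l) (Z : kscheme m) (f : hom Y X) (g : hom Z Y) :
  lies_over iota f -> lies_over kappa g -> lies_over (kappa \o iota) (hcomp f g).
Proof.
move=> hf hg V a; have h : hpre (hcomp f g) V `<=` hpre g (hpre f V) by [].
rewrite -[LHS](res_id (@subset_refl _ (hpre (hcomp f g) V))).
by rewrite (pull_hcomp _ _ h) hf hg res_const.
Qed.

Lemma lies_over_id (k : fieldType) (X : kscheme k) : over_base (hid X).
Proof.
move=> V a; rewrite -[LHS](res_id (@subset_refl _ (hpre (hid X) V))).
have h : hpre (hid X) V `<=` V by [].
by rewrite (pull_hid (const V a) _ h) res_const.
Qed.

End HomEq.

(** * Morphisms given by homomorphisms of function fields *)

(** A place-like partial homomorphism of fields: defined on a local ring, with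
    the kernel as maximal ideal. *)
Record phom (K L : fieldType) := PHom {
  dom : set K;
  app :> K -> L;
  dom_subring : is_subring dom;
  app1 : app 1 = 1;
  appB : forall a b, dom a -> dom b -> app (a - b) = app a - app b;
  appM : forall a b, dom a -> dom b -> app (a * b) = app a * app b;
  dom_inv : forall a, dom a -> app a != 0 -> dom a^-1
}.

Section Phom.
Variables (K L : fieldType) (f : phom K L).

Lemma app0 : f 0 = 0.
Proof.
have := appB (p := f) (subring1 (dom_subring f)) (subring1 (dom_subring f)).
by rewrite !subrr.
Qed.

Lemma app_inv a : dom f a -> f a != 0 -> f a^-1 = (f a)^-1.
Proof.
move=> da fa; have a0 : a != 0 by apply: contra_neq fa => ->; exact: app0.
apply: (mulfI fa); rewrite divff // -(appM da (dom_inv da fa)) divff //.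
exact: app1.
Qed.

End Phom.

Section Follows.
Variables (M N : atlas) (T : phom (fld N) (fld M)).
Implicit Types (x : point M) (y : point N).

(** The condition for a morphism inducing [T] on function fields to send [x] to
    [y]: a local homomorphism between the local rings. *)
Record dominates x y : Prop := Dominates {
  dominates_dom : lring y `<=` dom T;
  dominates_in : forall s, lring y s -> lring x (T s);
  dominates_unit : forall s, lring y s -> unit_in (lring x) (T s) ->
    unit_in (lring y) s
}.

Lemma dominates_unitE x y s : dominates x y -> lring y s ->
  unit_in (lring x) (T s) <-> unit_in (lring y) s.
Proof.
move=> d ys; split=> [|[s0 _ yi]]; first exact: dominates_unit.
have e : T s * T s^-1 = 1.
  rewrite -appM ?divff ?app1 //; exact: (dominates_dom d).
by apply: (unit_in_of_mul1 (lring_subring x) _ _ e); exact: (dominates_in d).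
Qed.

(** A local ring dominated by [x] inverts the transition functions whose images
    are units. This plays the part of the valuative criterion of separatedness,
    and yields the uniqueness of dominated points. *)
Lemma dominates_chart x y j : dominates x y ->
  (forall a, chart j a -> dom T a /\ lring x (T a)) -> in_chart j y.
Proof.
move=> d h; have [l hl] := point_chart y.
have yt : lring y (trans l j) by apply: hl; exact: trans_in.
have [dt xt] := h _ (trans_in j l).
apply: (in_chart_of_unit hl); apply: (dominates_unit d yt).
have e : T (trans l j) * T (trans j l) = 1.
  rewrite -appM ?transK ?app1 //; exact: (dominates_dom d).
apply: (unit_in_of_mul1 (lring_subring x) _ _ e) => //; exact: (dominates_in d).
Qed.

Lemma dominates_uniq x y y' : dominates x y -> dominates x y' -> y = y'.
Proof.
move=> d d'; have [j hj] := point_chart y.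
have hj' : in_chart j y'.
  apply: (dominates_chart d') => a /hj ya.
  by split; [exact: (dominates_dom d) | exact: (dominates_in d)].
apply: (point_eq_chart hj hj') => a Aa.
by rewrite -(dominates_unitE d (hj _ Aa)) -(dominates_unitE d' (hj' _ Aa)).
Qed.

(** A morphism to the scheme of an atlas is determined by its effect on
    functions, see [follows_eq]; so morphisms are constructed and compared
    through [T]. *)
Definition follows (f : hom (atlas_scheme M) (atlas_scheme N)) : Prop :=
  (forall x, lring (f x) `<=` dom T) /\
  forall (V : opens (point N)) (s : section V) x, V (f x) ->
    value (pull f V s : section (hpre f V)) = T (value s).

Lemma follows_dominates f x : follows f -> dominates x (f x).
Proof.
move=> [fd fv].
have key s : lring (f x) s -> lring x (T s) /\
    (unit_in (lring x) (T s) -> unit_in (lring (f x)) s).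
  move=> ys; pose V : opens (atlas_scheme N) := Opens (@open_regular N s).
  have Vx : V (f x) by [].
  pose t : @sec (atlas_scheme N) V := to_sec (fun y (h : V y) => h : lring y s).
  have vt : value (t : section V) = s by rewrite (value_to_sec _ Vx).
  have Ux : hpre f V x by [].
  have e := fv V t x Vx; rewrite vt in e; rewrite -e; split.
    exact: (@value_in _ _ _ x Ux).
  move/(inv_atP _ Ux) => i; rewrite -vt; apply/(@inv_atP _ V) => //.
  exact: (hsec_local Vx i).
split=> [|s /key[]//|s /key[]//]; exact: fd.
Qed.

Lemma follows_eq f f' : follows f -> follows f' -> hom_eq f f'.
Proof.
move=> hf hf'.
have e x : f x = f' x.
  exact: (dominates_uniq (follows_dominates x hf) (follows_dominates x hf')).
split=> // V s W h h'; apply: value_eq => Wg.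
have Vg : V (f (generic M)) := h _ Wg.
have Vg' : V (f' (generic M)) := h' _ Wg.
by rewrite !(value_rres _ _ Wg) (hf.2 _ _ _ Vg) (hf'.2 _ _ _ Vg').
Qed.

Section Builder.
Hypothesis ex_dom : forall x, exists y, dominates x y.
(* Regularity at [x] must propagate to a neighbourhood, for continuity. *)
Hypothesis spread : forall x y j, dominates x y -> in_chart j y ->
  exists W : opens (point M), W x /\
    forall x' a, W x' -> chart j a -> lring x' (T a).

Definition pfun x : point N := projT1 (cid (ex_dom x)).

Lemma pfunP x : dominates x (pfun x).
Proof. exact: (projT2 (cid (ex_dom x))). Qed.

Lemma pfun_cont : continuous (pfun : atlas_scheme M -> atlas_scheme N).
Proof.
apply/continuousP => V oV; rewrite atlas_openE => x /= Vx.
have d := pfunP x; have [j [t [Aj [hj ut] sub]]] : exists j s,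
    [/\ chart j s, bopen j s (pfun x) & bopen j s `<=` V] by exact: oV.
have [W [Wx hW]] := spread d hj.
have : open [set z : point M | W z /\ unit_in (lring z) (T t)].
  by apply: openI; [exact: oset_open | exact: open_unit].
rewrite atlas_openE => /(_ x)[|i [s [As bx sub']]].
  by split=> //; apply/(dominates_unitE d (hj _ Aj)).
exists i, s; split=> // z /sub'[Wz uz].
apply: sub; have dz := pfunP z; have hz : in_chart j (pfun z).
  apply: (dominates_chart dz) => a Aa; split; last exact: hW.
  by apply: (dominates_dom d); exact: hj.
by split=> //; apply/(dominates_unitE dz (hz _ Aj)).
Qed.

Let pre (V : opens (point N)) : opens (point M) := preim pfun_cont V.

Lemma pfun_reg V (s : section V) x : pre V x -> lring x (T (value s)).
Proof. by move=> Vx; apply: (dominates_in (pfunP x)); exact: value_in. Qed.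

Definition ppull_fun V (s : section V) : section (pre V) :=
  to_sec (@pfun_reg V s).

Lemma ppull_dom V (s : section V) x : pre V x -> dom T (value s).
Proof. by move=> Vx; apply: (dominates_dom (pfunP x)); exact: value_in. Qed.

Lemma ppull_1 V : ppull_fun (1 : section V) = 1.
Proof.
apply: value_eq => Vg; rewrite (value_to_sec _ Vg) (value1 Vg).
by rewrite (value1 (Vg : V (pfun _))) app1.
Qed.

Lemma ppull_B V : {morph @ppull_fun V : a b / a - b}.
Proof.
move=> a b; apply: value_eq => Vg; rewrite valueB !(value_to_sec _ Vg) valueB.
by rewrite appB //; exact: (ppull_dom _ Vg).
Qed.

Lemma ppull_M V : {morph @ppull_fun V : a b / a * b}.
Proof.
move=> a b; apply: value_eq => Vg; rewrite valueM !(value_to_sec _ Vg) valueM.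
by rewrite appM //; exact: (ppull_dom _ Vg).
Qed.

Definition ppull V : {rmorphism section V -> section (pre V)} :=
  mk_rmorphism (@ppull_1 V) (@ppull_B V) (@ppull_M V).

Lemma value_ppull V (s : section V) x : pre V x -> value (ppull V s) = T (value s).
Proof. by move=> Vx; rewrite (value_to_sec _ Vx). Qed.

Lemma ppull_res (U V : opens (atlas_scheme N)) (h : V `<=` U)
    (h' : preim pfun_cont V `<=` preim pfun_cont U) (s : sec U) :
  @res (atlas_scheme M) _ _ h' (ppull U s) = ppull V (res h s).
Proof.
apply: value_eq => Vg; rewrite (value_rres _ _ Vg) (value_ppull _ Vg).
by rewrite (value_ppull _ (h' _ Vg)) (value_rres _ _ (Vg : V (pfun _))).
Qed.

Lemma ppull_local (V : opens (atlas_scheme N)) (s : sec V) (x : atlas_scheme M) :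
  V (pfun x) -> @inv_at (atlas_scheme M) _ (ppull V s) x -> inv_at s (pfun x).
Proof.
move=> Vx /(@inv_atP _ (pre V) _ _ Vx); rewrite (value_ppull _ (Vx : pre V x)) => u.
by apply/inv_atP => //; apply: (dominates_unit (pfunP x)) => //; exact: value_in.
Qed.

Definition phom_hom : hom (atlas_scheme M) (atlas_scheme N) :=
  Hom ppull_res ppull_local.

Lemma phom_hom_follows : follows phom_hom.
Proof.
split=> [x|V s x Vx]; first exact: (dominates_dom (pfunP x)).
exact: (value_ppull _ (Vx : pre V x)).
Qed.

End Builder.
End Follows.

(** * Schemes over a field *)

Record katlas (k : fieldType) := KAtlas {
  katl :> atlas;
  kin : {rmorphism k -> fld katl};
  kin_chart : forall i a, chart i (kin a)
}.

Section KAtlas.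
Variables (k : fieldType) (M : katlas k).

Lemma kin_lring (x : point M) a : lring x (kin M a).
Proof. by have [i hi] := point_chart x; apply: hi; exact: kin_chart. Qed.

Definition kstr_fun (a : k) : section (whole (point M)) :=
  to_sec (fun x (_ : whole (point M) x) => kin_lring x a).

Let wg : whole (point M) (generic M) := I.

Lemma kstr_1 : kstr_fun 1 = 1.
Proof. by apply: value_inj; rewrite (value_to_sec _ wg) rmorph1 (value1 wg). Qed.

Lemma kstr_B : {morph kstr_fun : a b / a - b}.
Proof.
by move=> a b; apply: value_inj; rewrite valueB !(value_to_sec _ wg) rmorphB.
Qed.

Lemma kstr_M : {morph kstr_fun : a b / a * b}.
Proof.
by move=> a b; apply: value_inj; rewrite valueM !(value_to_sec _ wg) rmorphM.
Qed.

Definition atlas_kscheme : kscheme k :=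
  @KScheme k (atlas_scheme M) (mk_rmorphism kstr_1 kstr_B kstr_M).

Lemma value_const (U : opens (point M)) a x : U x ->
  value (@const k atlas_kscheme U a : section U) = kin M a.
Proof. by move=> Ux; rewrite (value_rres _ _ Ux) (value_to_sec _ wg). Qed.

End KAtlas.

Lemma follows_lies_over (k l : fieldType) (N : katlas k) (M : katlas l)
  (iota : k -> l) (T : phom (fld N) (fld M))
  (f : hom (atlas_scheme M) (atlas_scheme N)) : follows T f ->
  (forall a, T (kin N a) = kin M (iota a)) ->
  @lies_over k l iota (atlas_kscheme M) (atlas_kscheme N) f.
Proof.
move=> [_ hv] e V a; apply: value_eq => Vg.
rewrite (hv _ _ _ (Vg : V (f (generic M)))).
by rewrite (value_const _ (Vg : V (f (generic M)))) (value_const _ Vg) e.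
Qed.

Lemma atlas_integral (M : atlas) : integral_scheme (atlas_scheme M).
Proof.
split=> [|U [x Ux] s t /(congr1 (@value _ _))]; first by exists (generic M).
by rewrite valueM => /eqP; rewrite mulf_eq0 => /orP[]/eqP e; [left|right];
  exact: value_inj.
Qed.

(** An algebraic extension of an algebraically closed field is trivial, so a
    base extension to it is the scheme itself. *)
Lemma geometrically_integral_closed (C : closedFieldType) (X : kscheme C) :
  integral_scheme X -> geometrically_integral X.
Proof.
move=> [[x0 _] iX] L j alg Y pi [lpi univ].
have jsurj z : exists a, j a = z.
  have [p p0 rp] := alg z.
  have [r e] := closed_field_poly_normal p.
  move: rp; rewrite e map_polyZ rmorph_prod /= /root hornerZ mulf_eq0.
  rewrite fmorph_eq0 lead_coef_eq0 (negbTE p0) /= horner_prod prodf_seq_eq0.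
  case/hasP => a _ /=; rewrite rmorphB /= map_polyX map_polyC /=.
  by rewrite hornerXsubC subr_eq0 => /eqP ->; exists a.
pose inv z := projT1 (cid (jsurj z)).
have jinv z : j (inv z) = z by exact: (projT2 (cid (jsurj z))).
have jinj := fmorph_inj j.
have inv1 : inv 1 = 1 by apply: jinj; rewrite jinv rmorph1.
have invB : {morph inv : a b / a - b}.
  by move=> a b; apply: jinj; rewrite rmorphB !jinv.
have invM : {morph inv : a b / a * b}.
  by move=> a b; apply: jinj; rewrite rmorphM !jinv.
pose T : kscheme L := @KScheme L X (kstr X \o mk_rmorphism inv1 invB invM).
have cT (U : opens X) a : @const L T U (j a) = @const C X U a.
  rewrite /const /=; congr (res _ (kstr X _)); apply: jinj; exact: jinv.
have lid : @lies_over _ _ j T X (hid X).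
  move=> V a; rewrite lies_over_id; exact/esym/cT.
have [[h [oh eh]] _] := univ T (hid X) lid.
have opi : @over_base L Y T pi.
  by move=> V a; rewrite -(jinv a) cT lpi jinv.
have hpi : hom_eq (hcomp h pi) (hid Y).
  have o1 : over_base (hcomp h pi : hom Y Y) by exact: (lies_over_comp oh opi).
  have [_ uniq] := univ Y pi lpi.
  apply: uniq => //; first exact: lies_over_id.
    apply: (hom_eq_trans (hcompA _ _ _)).
    apply: (hom_eq_trans (hcomp_eq eh (hom_eq_refl pi))).
    exact: hcomp_idl.
  exact: hcomp_idr.
split; first by exists (h x0).
move=> U [y Uy] s t st.
have Uh : hpre h U (pi y) by rewrite /hpre /preim /= (hpi.1 y : h (pi y) = y).
have back u : pull h U u = 0 -> u = 0.
  move=> u0; have sub : U `<=` hpre (hcomp h pi) U.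
    by move=> z Uz; rewrite /hpre /preim /= (hpi.1 z : h (pi z) = z).
  have sub' : U `<=` hpre (hid Y) U by [].
  have := hpi.2 _ u _ sub sub'; rewrite (pull_hid _ _ (@subset_refl _ U)) res_id => <-.
  by rewrite (pull_hcomp _ _ (sub : U `<=` hpre pi (hpre h U))) u0 !rmorph0.
have [||] := iX (hpre h U) (ex_intro _ (pi y) Uh) (pull h U s) (pull h U t).
- by rewrite -rmorphM st rmorph0.
- by move/back; left.
- by move/back; right.
Qed.

(** * Spectra of subrings of fields *)

Section Spec.
Variables (K : fieldType) (B : set K).
Hypothesis sB : is_subring B.

Lemma spec_trans_loc (i j : unit) a : B a -> exists n, B (a * 1 ^+ n).
Proof. by move=> Ba; exists 0%N; rewrite mulr1. Qed.

Definition spec_atlas : atlas :=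
  @Atlas K unit tt (fun=> B) (fun=> sB) (fun _ _ => 1) (fun _ _ => subring1 sB)
    (fun _ _ => mulr1 1) spec_trans_loc.

Lemma spec_chart (x : point spec_atlas) : B `<=` lring x.
Proof. by have [[] hx] := point_chart x. Qed.

(** A ring homomorphism [rho] from the sections of an affine open set [V] of an
    arbitrary scheme gives a morphism from [Spec B]. A section [s] over another
    open set is, near each point, a fraction of sections of [V]; its pullback
    is the corresponding fraction in [K]. *)
Section ToScheme.
Variables (Z : scheme) (V : opens Z) (rho : {rmorphism sec V -> K}).
Hypotheses (aV : affine_open V) (rhoB : forall s, B (rho s)).
Implicit Types x : point spec_atlas.

Let affine_point := let: And3 h _ _ := aV in h.
Let affine_basis := let: And3 _ h _ := aV in h.
Let affine_frac := let: And3 _ _ h := aV in h.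

Lemma inv_atMP (U : opens Z) (s t : sec U) (z : Z) :
  inv_at (s * t) z <-> inv_at s z /\ inv_at t z.
Proof.
split=> [[W [h [Wz [b e]]]]|[[W [h [Wz [b e]]]] [W' [h' [Wz' [b' e']]]]]].
  move: e; rewrite rmorphM => e; split; exists W, h; split=> //.
    by exists (res h t * b); rewrite mulrA.
  by exists (res h s * b); rewrite mulrA [res h t * _]mulrC.
pose D : opens Z := Opens (openI (oset_open W) (oset_open W')).
have d : D `<=` W by move=> ? [].
have d' : D `<=` W' by move=> ? [].
have dU : D `<=` U by move=> y /d /h.
exists D, dU; split=> //; exists (res d b * res d' b').
rewrite rmorphM -(res_comp h d dU s) -(res_comp h' d' dU t) mulrACA.
by rewrite -!rmorphM e e' !rmorph1 mulr1.
Qed.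

Lemma spec_prime x : is_prime_ideal [set s : sec V | ~ unit_in (lring x) (rho s)].
Proof.
have lx := lring_local x; have sx := lx.1.
have rx s : lring x (rho s) by exact/spec_chart/rhoB.
split=> /=.
- by rewrite rmorph0 => -[]; rewrite eqxx.
- by move=> a b na nb; rewrite rmorphD; exact: nonunitD.
- by move=> a b nb; rewrite rmorphM; exact: nonunitM.
- by rewrite rmorph1; apply; exact: unit_in1.
- move=> a b; rewrite rmorphM => nab; apply: contrapT => /not_orP[na nb].
  by apply: nab; apply: unit_inM => //; exact: contrapT.
Qed.

Lemma spec_pt_ex x : exists z : Z, V z /\
  forall s : sec V, inv_at s z <-> unit_in (lring x) (rho s).
Proof.
have [z [[Vz e] _]] := affine_point (spec_prime x) : exists! z, _.
exists z; split=> // s; have := congr1 (fun X => X s) e; rewrite /= => es.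
split=> [i|u]; apply: contrapT => n.
  by have [] : vanishes_at s z by rewrite -es.
have : vanishes_at s z by split.
by rewrite -es.
Qed.

Definition spec_pt x : Z := projT1 (cid (spec_pt_ex x)).

Lemma spec_pt_in x : V (spec_pt x).
Proof. by case: (projT2 (cid (spec_pt_ex x))). Qed.

Lemma spec_pt_inv x (s : sec V) :
  inv_at s (spec_pt x) <-> unit_in (lring x) (rho s).
Proof. by case: (projT2 (cid (spec_pt_ex x))) => _; apply. Qed.

Lemma inv_at_open (U : opens Z) (s : sec U) : open [set z | inv_at s z].
Proof.
rewrite openE => z [W [h [Wz i]]].
rewrite /interior /= nbhsE; exists W; first by split=> //; exact: oset_open.
by move=> y Wy; exists W, h.
Qed.

Lemma spec_cont : continuous (spec_pt : atlas_scheme spec_atlas -> Z).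
Proof.
apply/continuousP => W oW; rewrite atlas_openE => x /= Wx.
have [s [is_ hs]] := @affine_basis (spec_pt x) (Opens oW) (spec_pt_in x) Wx
  : exists s, _ /\ _.
exists tt, (rho s); split; first exact: rhoB.
  by split; [exact: spec_chart | exact/spec_pt_inv].
move=> y [_ /spec_pt_inv iy]; apply: hs => //; exact: spec_pt_in.
Qed.

Record frac_on (W : opens Z) (s : sec W) (g a : sec V) (D : opens Z) : Prop :=
  FracOn {
    frac_sub : D `<=` V;
    frac_subW : D `<=` W;
    frac_D : forall z, D z <-> inv_at g z;
    frac_eq : forall (h : D `<=` W) (h' : D `<=` V), res h s * res h' g = res h' a
  }.

Lemma frac_ex x (W : opens Z) (s : sec W) : W (spec_pt x) ->
  exists g a D, frac_on s g a D /\ D (spec_pt x).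
Proof.
move=> Wx; have [g [ig hg]] := @affine_basis (spec_pt x) W (spec_pt_in x) Wx.
pose D : opens Z := Opens (inv_at_open g).
have dV : D `<=` V by move=> z [W' [h [W'z _]]]; exact: h.
have dW : D `<=` W by move=> z Dz; apply: hg => //; exact: dV.
have [hc _] := @affine_frac g D dV (fun z => conj id id).
have [n [a e]] := hc (res dW s).
exists (g ^+ n.+1), (a * g), D; split=> //; split=> // [z|h h'].
  split=> [|i].
    elim: n {e} => [|n IH] i; rewrite ?expr1 // exprS; apply/inv_atMP; split=> //.
    exact: IH.
  by move: i; rewrite exprS => /inv_atMP[].
rewrite (Prop_irrelevance h dW) (Prop_irrelevance h' dV).
by rewrite rmorphXn exprSr mulrA e rmorphM.
Qed.

Lemma frac_uniq (W : opens Z) (s : sec W) g a D g' a' D' :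
  frac_on s g a D -> frac_on s g' a' D' -> rho g != 0 -> rho g' != 0 ->
  rho a / rho g = rho a' / rho g'.
Proof.
move=> [dV dW Dg e] [dV' dW' Dg' e'] g0 g0'.
pose E : opens Z := Opens (openI (oset_open D) (oset_open D')).
have ed : E `<=` D by move=> ? [].
have ed' : E `<=` D' by move=> ? [].
have eV : E `<=` V by move=> y /ed /dV.
have eW : E `<=` W by move=> y /ed /dW.
have hE z : E z <-> inv_at (g * g') z by rewrite inv_atMP -Dg -Dg'.
have [_ h0] := @affine_frac (g * g') E eV hE.
have e1 : res eW s * res eV g = res eV a.
  by rewrite -(res_comp dW ed eW) -!(res_comp dV ed eV) -rmorphM e.
have e2 : res eW s * res eV g' = res eV a'.
  by rewrite -(res_comp dW' ed' eW) -!(res_comp dV' ed' eV) -rmorphM e'.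
have [|n /(congr1 rho)] := h0 (a * g' - a' * g).
  by rewrite rmorphB !rmorphM -e1 -e2; ring.
rewrite rmorphM rmorphXn rmorphB !rmorphM rmorph0 => /eqP.
rewrite mulf_eq0 expf_eq0 !mulf_eq0 (negbTE g0) (negbTE g0') andbF /=.
by rewrite subr_eq0 => /eqP e3; apply/eqP; rewrite eqr_div // e3.
Qed.

Let pre (W : opens Z) : opens (point spec_atlas) := preim spec_cont W.

Definition is_value (W : opens Z) (s : sec W) (v : K) : Prop :=
  exists g a D, [/\ frac_on s g a D, rho g != 0 & v = rho a / rho g].

Lemma is_value_uniq W (s : sec W) v v' : is_value s v -> is_value s v' -> v = v'.
Proof.
by move=> [g [a [D [f g0 ->]]]] [g' [a' [D' [f' g0' ->]]]]; exact: (frac_uniq f f').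
Qed.

Lemma is_value_ex x W (s : sec W) : W (spec_pt x) ->
  exists g a v D, [/\ frac_on s g a D, D (spec_pt x), unit_in (lring x) (rho g) &
    is_value s v /\ v = rho a / rho g].
Proof.
move=> /(frac_ex s)[g [a [D [f Dx]]]].
have ug : unit_in (lring x) (rho g) by apply/spec_pt_inv/(frac_D f).
have g0 : rho g != 0 by case: ug.
by exists g, a, (rho a / rho g), D; split=> //; split=> //; exists g, a, D.
Qed.

Definition spec_val W (s : sec W) : K := xget 0 [set v | is_value s v].

Lemma spec_val_eq W (s : sec W) v : is_value s v -> spec_val s = v.
Proof.
move=> h; apply: (is_value_uniq _ h); rewrite /spec_val.
by case: xgetP => // /(_ v).
Qed.

Lemma spec_valP x W (s : sec W) : W (spec_pt x) ->
  exists g a D, [/\ frac_on s g a D, D (spec_pt x), unit_in (lring x) (rho g) &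
    spec_val s = rho a / rho g].
Proof.
move=> /(is_value_ex s)[g [a [v [D [f Dx ug [iv e]]]]]].
by exists g, a, D; split=> //; rewrite (spec_val_eq iv).
Qed.

Lemma spec_val_reg W (s : sec W) x : pre W x -> lring x (spec_val s).
Proof.
move=> /(spec_valP s)[g [a [D [_ _ [_ _ gi] ->]]]].
apply: (subringM (lring_subring x)) => //; exact/spec_chart/rhoB.
Qed.

Definition spec_pull W (s : sec W) : section (pre W) := to_sec (@spec_val_reg W s).

Lemma spec_val_op (W : opens Z) (s t : sec W) x : W (spec_pt x) ->
  spec_val (s - t) = spec_val s - spec_val t /\
  spec_val (s * t) = spec_val s * spec_val t.
Proof.
move=> Wx; have [g [a [D [[dV dW Dg e] Dx ug ->]]]] := spec_valP s Wx.
have [g' [a' [D' [[dV' dW' Dg' e'] Dx' ug' ->]]]] := spec_valP t Wx.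
have g0 : rho g != 0 by case: ug.
have g0' : rho g' != 0 by case: ug'.
pose E : opens Z := Opens (openI (oset_open D) (oset_open D')).
have ed : E `<=` D by move=> ? [].
have ed' : E `<=` D' by move=> ? [].
have eV : E `<=` V by move=> y /ed /dV.
have eW : E `<=` W by move=> y /ed /dW.
have hE z : E z <-> inv_at (g * g') z by rewrite inv_atMP -Dg -Dg'.
have gg0 : rho (g * g') != 0 by rewrite rmorphM mulf_neq0.
have e1 : res eW s * res eV g = res eV a.
  by rewrite -(res_comp dW ed eW) -!(res_comp dV ed eV) -rmorphM e.
have e2 : res eW t * res eV g' = res eV a'.
  by rewrite -(res_comp dW' ed' eW) -!(res_comp dV' ed' eV) -rmorphM e'.
split; apply: spec_val_eq.
  exists (g * g'), (a * g' - a' * g), E; split=> //; last first.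
    by rewrite rmorphB !rmorphM; field; rewrite g0 g0'.
  split=> // h h'; rewrite (Prop_irrelevance h eW) (Prop_irrelevance h' eV).
  by rewrite !rmorphB !rmorphM -e1 -e2; ring.
exists (g * g'), (a * a'), E; split=> //; last first.
  by rewrite !rmorphM; field; rewrite g0 g0'.
split=> // h h'; rewrite (Prop_irrelevance h eW) (Prop_irrelevance h' eV).
by rewrite !rmorphM -e1 -e2; ring.
Qed.

Lemma spec_pull_1 W : spec_pull (1 : sec W) = 1.
Proof.
apply: value_eq => Wg; rewrite (value_to_sec _ Wg) (value1 Wg).
apply: spec_val_eq.
have [g [a [D [[dV dW Dg _] _ [g0 _ _] _]]]] := spec_valP (1 : sec W) Wg.
exists g, g, D; split=> //; last by rewrite divff.
by split=> // h h'; rewrite rmorph1 mul1r.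
Qed.

Lemma spec_pull_B W : {morph @spec_pull W : a b / a - b}.
Proof.
move=> a b; apply: value_eq => Wg; rewrite valueB !(value_to_sec _ Wg).
exact: (spec_val_op _ _ Wg).1.
Qed.

Lemma spec_pull_M W : {morph @spec_pull W : a b / a * b}.
Proof.
move=> a b; apply: value_eq => Wg; rewrite valueM !(value_to_sec _ Wg).
exact: (spec_val_op _ _ Wg).2.
Qed.

Definition spec_sec W : {rmorphism sec W -> section (pre W)} :=
  mk_rmorphism (@spec_pull_1 W) (@spec_pull_B W) (@spec_pull_M W).

Lemma spec_res (U W : opens Z) (h : W `<=` U)
    (h' : preim spec_cont W `<=` preim spec_cont U) (s : sec U) :
  @res (atlas_scheme spec_atlas) _ _ h' (spec_sec U s) = spec_sec W (res h s).
Proof.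
apply: value_eq => Wg; rewrite (value_rres _ _ Wg).
rewrite (value_to_sec _ Wg) (value_to_sec _ (h' _ Wg)); apply: spec_val_eq.
have [g [a [D [[dV dW Dg e] _ [g0 _ _] ->]]]] := spec_valP (res h s) Wg.
have dU : D `<=` U by move=> y /dW /h.
exists g, a, D; split=> //; split=> // k k'.
by rewrite -(e dW k') (res_comp h dW k).
Qed.

Lemma spec_local (W : opens Z) (s : sec W) (x : atlas_scheme spec_atlas) :
  W (spec_pt x) -> @inv_at (atlas_scheme spec_atlas) _ (spec_sec W s) x ->
  inv_at s (spec_pt x).
Proof.
move=> Wx /(@inv_atP _ (pre W) _ _ Wx); rewrite (value_to_sec _ (Wx : pre W x)).
have [g [a [D [[dV dW Dg e] Dx ug ->]]]] := spec_valP s Wx.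
have [g0 _ _] := ug.
move/(unit_inM (lring_subring x) ug); rewrite mulrC divfK //.
move/spec_pt_inv => [E [hE [Ex iE]]].
pose F : opens Z := Opens (openI (oset_open D) (oset_open E)).
have fD : F `<=` D by move=> ? [].
have fE : F `<=` E by move=> ? [].
have fV : F `<=` V by move=> y /fD /dV.
have fW : F `<=` W by move=> y /fD /dW.
exists F, fW; split; first by split.
case: iE => b eb; exists (res fV g * res fE b).
have e1 : res fW s * res fV g = res fV a.
  by rewrite -(res_comp dW fD fW) -!(res_comp dV fD fV) -rmorphM e.
by rewrite mulrA e1 -(res_comp hE fE fV) -rmorphM eb rmorph1.
Qed.

Definition spec_hom : hom (atlas_scheme spec_atlas) Z := Hom spec_res spec_local.

Lemma spec_hom_value W (s : sec W) x : W (spec_hom x) ->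
  exists g a D, [/\ frac_on s g a D, rho g != 0 &
    value (pull spec_hom W s : section (pre W)) = rho a / rho g].
Proof.
move=> Wx; have [g [a [D [f _ [g0 _ _] e]]]] := spec_valP s Wx.
by exists g, a, D; split=> //; rewrite (value_to_sec _ (Wx : pre W x)).
Qed.

End ToScheme.
End Spec.

(** * Separatedness *)

Section SchemePoints.
Variable X : scheme.

Lemma inv_at_res (U V : opens X) (h : V `<=` U) (s : sec U) (x : X) : V x ->
  inv_at (res h s) x <-> inv_at s x.
Proof.
move=> Vx; split=> [[W [k [Wx i]]]|[W [k [Wx [b i]]]]].
  have kU : W `<=` U by move=> y /k /h.
  by exists W, kU; split=> //; rewrite -(res_comp h k kU).
pose D : opens X := Opens (openI (oset_open W) (oset_open V)).
have dW : D `<=` W by move=> ? [].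
have dV : D `<=` V by move=> ? [].
have dU : D `<=` U by move=> y /dV /h.
exists D, dV; split=> //; exists (res dW b).
by rewrite (res_comp h dV dU) -(res_comp k dW dU) -rmorphM i rmorph1.
Qed.

Lemma not_inv_atD (U : opens X) (s t : sec U) (x : X) : U x ->
  ~ inv_at s x -> ~ inv_at t x -> ~ inv_at (s + t) x.
Proof.
move=> Ux ns nt [V [h [Vx [b e]]]].
have [_ l] := @space_local X x V Vx.
have e1 : 1 - res h s * b = res h t * b.
  by rewrite -e rmorphD mulrDl addrC addKr.
case: (l (res h s * b)) => [/inv_atMP[/(inv_at_res h s Vx)//]|].
by rewrite e1 => /inv_atMP[/(inv_at_res h t Vx)].
Qed.

Lemma not_inv_at0 (U : opens X) (x : X) : U x -> ~ inv_at (0 : sec U) x.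
Proof. by move=> Ux; have [] := @space_local X x U Ux. Qed.

Lemma inv_at1 (U : opens X) (x : X) : U x -> inv_at (1 : sec U) x.
Proof.
by move=> Ux; exists U, (@subset_refl _ U); split=> //; exists 1; rewrite mulr1 rmorph1.
Qed.

Lemma inv_atN (U : opens X) (s : sec U) x : inv_at (- s) x <-> inv_at s x.
Proof.
have half (t : sec U) : inv_at t x -> inv_at (- t) x.
  move=> [W [h [Wx [b e]]]]; exists W, h; split=> //; exists (- b).
  by rewrite rmorphN mulrNN.
by split=> /half; rewrite ?opprK.
Qed.

Lemma inv_at_congr (U : opens X) (s t : sec U) x : U x -> ~ inv_at (s - t) x ->
  inv_at s x -> inv_at t x.
Proof.
move=> Ux n i; apply: contrapT => nt.
by apply: (not_inv_atD Ux n nt); rewrite subrK.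
Qed.

Lemma vanish_prime (U : opens X) (x : X) : U x ->
  is_prime_ideal [set s : sec U | vanishes_at s x].
Proof.
move=> Ux; split=> /=.
- by split=> //; exact: not_inv_at0.
- by move=> a b [_ na] [_ nb]; split=> //; exact: not_inv_atD.
- by move=> a b [_ nb]; split=> // /inv_atMP[].
- by move=> [_]; apply; exact: inv_at1.
- move=> a b [_ nab]; apply: contrapT => /not_orP[na nb]; apply: nab.
  apply/inv_atMP; split; apply: contrapT => n; [apply: na | apply: nb]; by split.
Qed.

Lemma affine_point_eq (V : opens X) (x y : X) : affine_open V -> V x -> V y ->
  (forall s : sec V, inv_at s x <-> inv_at s y) -> x = y.
Proof.
move=> [h _ _] Vx Vy e; have [z [_ uz]] := h _ (vanish_prime Vx).
rewrite -(uz x) //; apply: uz; split=> //.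
by apply/seteqP; split=> s [_ n]; split=> // i; apply: n; apply/e.
Qed.

End SchemePoints.

Lemma inv_at_pull (X Y : scheme) (f : hom X Y) (V : opens Y) (s : sec V) x :
  V (f x) -> inv_at (pull f V s) x <-> inv_at s (f x).
Proof.
move=> Vx; split; first exact: hsec_local.
move=> [W [h [Wx [b e]]]].
have h' : hpre f W `<=` hpre f V by move=> y; exact: h.
exists (hpre f W), h'; split=> //; exists (pull f W b).
by rewrite -pull_res -rmorphM e rmorph1.
Qed.

Definition id_phom (K : fieldType) : phom K K.
Proof. by apply: (@PHom K K setT id). Defined.

(** Let [Z] be the product of [X] with itself and [z] a point in the closure of
    the diagonal. Take an affine neighbourhood [V] of [z], and for [B] the
    image of its sections in the function field, by restriction to the
    diagonal. The two projections of the resulting map [tau] from [Spec B] to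
    [Z] have the same effect on functions, so they agree; hence [tau] has its
    image in the diagonal. Finally [z] lies in the image of [tau], because
    sections invertible at [z] are nonzero at the generic point. *)
Section Separated.
Variables (k : fieldType) (M : katlas k).
Notation X := (atlas_kscheme M).
Variables (Z : kscheme k) (p q : hom Z X) (delta : hom X Z).
Hypotheses (fp : fibre_product p q) (od : over_base delta).
Hypotheses (ep : hom_eq (hcomp p delta) (hid X)) (eq : hom_eq (hcomp q delta) (hid X)).

Let eta : X := generic M.

Section Limit.
Variables (z : Z) (V : opens Z).
Hypotheses (lim : forall W : opens Z, W z -> W (delta eta)).
Hypotheses (Vz : V z) (aV : affine_open V).

Let Veta : V (delta eta) := lim Vz.

Definition dval (W : opens Z) (s : sec W) : fld M :=
  value (pull delta W s : section (hpre delta W)).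

Lemma dval1 : @dval V 1 = 1.
Proof. by rewrite /dval rmorph1 (value1 (Veta : hpre delta V eta)). Qed.

Lemma dvalB (W : opens Z) : {morph @dval W : a b / a - b}.
Proof. by move=> a b; rewrite /dval rmorphB. Qed.

Lemma dvalM (W : opens Z) : {morph @dval W : a b / a * b}.
Proof. by move=> a b; rewrite /dval rmorphM. Qed.

Definition rho : {rmorphism sec V -> fld M} := mk_rmorphism dval1 (@dvalB V) (@dvalM V).

Definition rim : set (fld M) := range rho.

Lemma rim_subring : is_subring rim.
Proof.
split; first by exists 1; rewrite ?rmorph1.
- by move=> _ _ [a _ <-] [b _ <-]; exists (a - b); rewrite ?rmorphB.
- by move=> _ _ [a _ <-] [b _ <-]; exists (a * b); rewrite ?rmorphM.
Qed.

Lemma rim_in s : rim (rho s). Proof. by exists s. Qed.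

Lemma dval_const (W : opens Z) a : W (delta eta) -> dval (const W a) = kin M a.
Proof. by move=> We; rewrite /dval od (value_const _ (We : hpre delta W eta)). Qed.

Definition rim_atlas : katlas k.
Proof.
apply: (@KAtlas k (spec_atlas rim_subring) (kin M)) => i a.
by rewrite -(dval_const a Veta); exact: rim_in.
Defined.

Definition tau : hom (atlas_scheme rim_atlas) Z :=
  spec_hom rim_subring aV rim_in.

Lemma rho_unit (s : sec V) : rho s != 0 <-> inv_at s (delta eta).
Proof.
rewrite -(inv_at_pull (f := delta) s (Veta : V (delta eta))).
rewrite (inv_atP _ (Veta : hpre delta V eta)) generic_unit.
split=> [h|[]//]; split=> //.
exact: (value_in _ (Veta : hpre delta V eta)).
Qed.

Lemma dval_res (U W : opens Z) (h : W `<=` U) (s : sec U) : W (delta eta) ->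
  dval (res h s) = dval s.
Proof.
move=> We; have h' : hpre delta W `<=` hpre delta U by move=> y; exact: h.
by rewrite /dval (pull_res _ h') (value_rres _ _ (We : hpre delta W eta)).
Qed.

Lemma tau_value (W : opens Z) (s : sec W) x : W (tau x) ->
  W (delta eta) /\
  value (pull tau W s : section (hpre tau W : opens (point rim_atlas))) = dval s.
Proof.
move=> Wx; have [g [a [D [[dV dW Dg e] g0 ->]]]] := spec_hom_value s Wx.
have De : D (delta eta) by apply/Dg/rho_unit.
split; first exact: dW.
have := congr1 (@dval D) (e dW dV); rewrite dvalM !dval_res // => e1.
by apply: (mulIf g0); rewrite divfK.
Qed.

Lemma tau_over : @over_base k (atlas_kscheme rim_atlas) Z tau.
Proof.
move=> W a; apply: value_eq => Wg.
have [We ->] := tau_value (const W a) (Wg : W (tau _)).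
by rewrite dval_const // (value_const _ Wg).
Qed.

Lemma tau_follows (r : hom Z X) : hom_eq (hcomp r delta) (hid X) ->
  @follows rim_atlas M (id_phom (fld M)) (hcomp r tau).
Proof.
move=> er; split=> // U s x Ux.
have h : hpre (hcomp r tau) U `<=` hpre tau (hpre r U) by [].
have -> : pull (hcomp r tau) U s = res h (pull tau (hpre r U) (pull r U s)).
  by rewrite -(@pull_hcomp _ _ X r tau U s _ (@subset_refl _ (hpre (hcomp r tau) U)) h) res_id.
rewrite (value_rres _ _ (Ux : hpre (hcomp r tau) U x)).
have [We ->] := tau_value (pull r U s) (Ux : hpre r U (tau x)).
have Ue : U eta by rewrite -[eta](er.1 eta).
have h1 : hpre delta (hpre r U) `<=` hpre (hcomp r delta) U by [].
have h2 : hpre delta (hpre r U) `<=` hpre (hid X) U.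
  by move=> y; rewrite /hpre /preim /= (er.1 y : r (delta y) = y).
have h3 : hpre delta (hpre r U) `<=` U := h2.
have := er.2 U s _ h1 h2; rewrite (@pull_hcomp _ _ X r delta U s _ h1 (@subset_refl _ _)).
rewrite (pull_hid _ _ h3) res_id => e.
by rewrite /dval e (value_rres _ _ (We : hpre delta (hpre r U) eta)).
Qed.

Lemma tau_diag x : tau x = delta (p (tau x)).
Proof.
have [op oq univ] := fp.
have og : @over_base k (atlas_kscheme rim_atlas) X (hcomp p tau).
  exact: (lies_over_comp op tau_over).
have pq : hom_eq (hcomp p tau) (hcomp q tau).
  by apply: (follows_eq (tau_follows ep)); exact: tau_follows.
have [_ uniq] := univ _ _ _ og og.
have back (r : hom Z X) : hom_eq (hcomp r delta) (hid X) ->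
    hom_eq (hcomp r (hcomp delta (hcomp p tau))) (hcomp p tau).
  move=> er; apply: (hom_eq_trans (hcompA _ _ _)).
  by apply: (hom_eq_trans (hcomp_eq er (hom_eq_refl _))); exact: hcomp_idl.
have := uniq tau (hcomp delta (hcomp p tau)) tau_over (lies_over_comp od og).
move=> /(_ (hom_eq_refl _) (hom_eq_sym pq) (back _ ep) (back _ eq))[h _].
exact: h.
Qed.

Let vz : set (fld M) := [set b | exists s : sec V, ~ inv_at s z /\ rho s = b].

Lemma vzE (s : sec V) : vz (rho s) <-> ~ inv_at s z.
Proof.
split=> [[t [nt e]] i|n]; last by exists s.
apply: nt; apply: (inv_at_congr Vz _ i) => -[W [h [Wz [b eb]]]].
have We := lim Wz; have := congr1 (@dval W) eb.
rewrite dvalM dval_res // dvalB (e : dval t = dval s) subrr mul0r.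
rewrite /dval rmorph1 (value1 (We : hpre delta W eta)) => /esym/eqP.
by rewrite oner_eq0.
Qed.

Lemma vz_prime : is_prime rim vz.
Proof.
split.
- by move=> _ [s [_ <-]]; exact: rim_in.
- by exists 0; split; [exact: not_inv_at0 | rewrite rmorph0].
- move=> _ _ [s [ns <-]] [t [nt <-]]; exists (s + t); rewrite rmorphD.
  by split=> //; exact: not_inv_atD.
- move=> _ _ [a _ <-] [s [ns <-]]; exists (a * s); rewrite rmorphM.
  by split=> // /inv_atMP[].
- by rewrite -(rmorph1 rho) vzE; apply; exact: inv_at1.
- move=> _ _ [a _ <-] [b _ <-]; rewrite -rmorphM !vzE => n.
  apply: contrapT => /not_orP[/contrapT na /contrapT nb].
  by apply: n; apply/inv_atMP.
Qed.

Lemma limit_diag : z = delta (p z).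
Proof.
pose x : point (spec_atlas rim_subring) :=
  @prime_point (spec_atlas rim_subring) tt _ vz_prime.
suff -> : z = tau x by exact: tau_diag.
apply: (affine_point_eq aV Vz); first exact: spec_pt_in.
move=> s; have -> : inv_at s (tau x) <-> unit_in (lring x) (rho s) by exact: spec_pt_inv.
rewrite prime_point_unit ?vzE; last exact: rim_in.
by split=> [i n|/contrapT].
Qed.

End Limit.

Lemma delta_closed_immersion : closed_immersion delta.
Proof.
have pd x : p (delta x) = x by exact: (ep.1 x).
split.
- by move=> x y e; rewrite -(pd x) e pd.
- move=> A cA z cz.
  have lim (W : opens Z) : W z -> W (delta eta).
    move=> Wz; have [_ [[a Aa <-] Wa]] := cz W (open_nbhs_nbhs (conj (oset_open W) Wz)).
    exact: (@generic_open M (hpre delta W) a Wa).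
  have [V [Vz aV]] := @space_affine Z z.
  have e := limit_diag lim Vz aV; exists (p z) => //.
  apply: contrapT => nA; pose U : opens X := Opens (closed_openC cA).
  have Uz : hpre p U z by exact: nA.
  have := cz _ (open_nbhs_nbhs (conj (oset_open (hpre p U)) Uz)).
  by move=> [_ [[a Aa <-]]]; rewrite /hpre /preim /= pd.
- move=> V s x Vx; pose W : opens Z :=
    Opens (openI (oset_open V) (oset_open (hpre p (hpre delta V)))).
  have h : W `<=` V by move=> ? [].
  have h' : hpre delta W `<=` hpre delta V by move=> y; exact: h.
  have k' : W `<=` hpre p (hpre delta V) by move=> ? [].
  exists W, h, h', (res k' (pull p (hpre delta V) s)); split.
    by split=> //; rewrite /hpre /preim /= pd.
  have k1 : hpre delta W `<=` hpre delta (hpre p (hpre delta V)).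
    by move=> y; exact: k'.
  have k2 : hpre delta W `<=` hpre (hid X) (hpre delta V) by [].
  have k3 : hpre delta W `<=` hpre (hcomp p delta) (hpre delta V) by move=> y /k1.
  by rewrite (pull_res k' k1) -(pull_hcomp s k3 k1) (ep.2 _ _ _ k3 k2) (pull_hid _ _ h').
Qed.

End Separated.

Lemma atlas_separated (k : fieldType) (M : katlas k) : separated (atlas_kscheme M).
Proof. move=> Z p q fp delta od ep eq; exact: (delta_closed_immersion fp od ep eq). Qed.

(** * Rational points as morphisms *)

(** A rational point is the image of a morphism from the spectrum of [k], which
    evaluates the sections of an affine neighbourhood. *)
Section RationalPoint.
Variable k : fieldType.

Lemma setT_subring : is_subring (setT : set k).
Proof. by []. Qed.

Definition field_atlas : katlas k :=
  @KAtlas k (spec_atlas setT_subring) idfun (fun _ _ => I).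

Notation Tk := (atlas_kscheme field_atlas).

Lemma field_atlas_unit (x : point field_atlas) (a : k) :
  unit_in (lring x) a <-> a != 0.
Proof.
split=> [[]//|a0]; have h := spec_chart x.
by split=> //; apply: h.
Qed.

Variables (Y : kscheme k) (y : Y).
Hypothesis ry : rational_point y.

Lemma const_vanish (U : opens Y) (a : k) : U y ->
  ~ inv_at (const U a) y -> a = 0.
Proof.
move=> Uy n; apply: contrapT => /eqP a0; apply: n.
exists U, (@subset_refl _ U); split=> //; exists (const U a^-1).
by rewrite res_id -rmorphM divff // rmorph1.
Qed.

Section Value.
Variables (V : opens Y).
Hypotheses (Vy : V y) (aV : affine_open V).

Definition rval (s : sec V) : k := projT1 (cid (ry s Vy)).

Lemma rvalP s : ~ inv_at (s - const V (rval s)) y.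
Proof. by case: (projT2 (cid (ry s Vy))). Qed.

Lemma rval_eq s c : ~ inv_at (s - const V c) y -> rval s = c.
Proof.
move=> n; apply/eqP; rewrite -subr_eq0; apply/eqP/(const_vanish (U := V) Vy).
have -> : const V (rval s - c) = (s - const V c) + - (s - const V (rval s)).
  by rewrite rmorphB; ring.
by apply: not_inv_atD => //; rewrite inv_atN; exact: rvalP.
Qed.

Lemma rval1 : rval 1 = 1.
Proof. by apply: rval_eq; rewrite rmorph1 subrr; exact: not_inv_at0. Qed.

Lemma rvalB : {morph rval : s t / s - t}.
Proof.
move=> s t; apply: rval_eq; rewrite rmorphB.
have -> : s - t - (const V (rval s) - const V (rval t)) =
  (s - const V (rval s)) + - (t - const V (rval t)) by ring.
by apply: not_inv_atD => //; rewrite ?inv_atN; exact: rvalP.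
Qed.

Lemma rvalM : {morph rval : s t / s * t}.
Proof.
move=> s t; apply: rval_eq; rewrite rmorphM.
have -> : s * t - const V (rval s) * const V (rval t) =
  t * (s - const V (rval s)) + const V (rval s) * (t - const V (rval t)) by ring.
by apply: not_inv_atD => //; move=> /inv_atMP[_]; exact: rvalP.
Qed.

Definition rval_morph : {rmorphism sec V -> k} := mk_rmorphism rval1 rvalB rvalM.

Lemma rval_unit s : inv_at s y <-> rval s != 0.
Proof.
split=> [i|/eqP r0].
  apply/eqP => r0; have := rvalP (s := s).
  by rewrite r0 rmorph0 subr0.
apply: contrapT => n; apply: r0; apply: rval_eq.
by rewrite rmorph0 subr0.
Qed.

Definition rational_hom : hom Tk Y :=
  spec_hom setT_subring aV (rho := rval_morph) (fun _ => I).

Lemma rational_hom_pt x : rational_hom x = y.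
Proof.
apply: (affine_point_eq aV) => //; first exact: spec_pt_in.
move=> s; rewrite rval_unit.
have -> : inv_at s (rational_hom x) <-> unit_in (lring x) (rval s).
  exact: (@spec_pt_inv k setT setT_subring Y V rval_morph aV (fun _ => I)).
exact: field_atlas_unit.
Qed.

Lemma rational_hom_over : over_base rational_hom.
Proof.
move=> W a; apply: value_eq => Wg.
have [g [a' [D [[dV dW Dg e] g0 ->]]]] :=
  spec_hom_value (const W a) (Wg : W (rational_hom _)).
rewrite (value_const _ Wg).
have Dy : D y by apply/Dg/rval_unit.
have : ~ inv_at (const V a * g - a') y.
  rewrite -(inv_at_res dV _ Dy) rmorphB rmorphM res_const -e res_const subrr.
  exact: not_inv_at0.
rewrite rval_unit rvalB rvalM => /negP/negPn.
have -> : rval (const V a) = a.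
  by apply: rval_eq; rewrite subrr; exact: not_inv_at0.
rewrite subr_eq0 => /eqP e'; rewrite -[rval_morph a']e' mulfK //.
Qed.

End Value.

Lemma rational_hom_ex : exists i : hom Tk Y, over_base i /\ forall x, i x = y.
Proof.
have [V [Vy aV]] := @space_affine Y y.
exists (rational_hom Vy aV); split; first exact: rational_hom_over.
exact: rational_hom_pt.
Qed.

Lemma value_at_rational (i : hom Tk Y) (W : opens Y) (s : sec W) c x :
  over_base i -> i x = y -> W y -> ~ inv_at (s - const W c) y ->
  value (pull i W s : section (hpre i W : opens (point field_atlas))) = c.
Proof.
move=> oi ix Wy n; apply/eqP; rewrite -subr_eq0; apply/negPn/negP => v0.
have Wx : W (i x) by rewrite ix.
apply: n; rewrite -ix; apply/(inv_at_pull (f := i)) => //.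
apply/(@inv_atP field_atlas (hpre i W)) => //.
apply/field_atlas_unit; rewrite rmorphB oi valueB.
by rewrite (value_const _ (Wx : hpre i W x)).
Qed.

End RationalPoint.

(** Both points are morphisms from the spectrum of [l] over [l] with the same
    composite to [X], and the fibre product admits only one. *)
Lemma rational_fibre (k l : fieldType) (iota : {rmorphism k -> l})
  (X : kscheme k) (Y : kscheme l) (pi : hom Y X) (y y' : Y) :
  base_extension iota pi -> rational_point (pi y) -> pi y = pi y' ->
  rational_point y -> rational_point y' -> y = y'.
Proof.
move=> [lpi univ] rx e ry ry'.
have [i [oi iy]] := rational_hom_ex ry.
have [i' [oi' iy']] := rational_hom_ex ry'.
have val (z : Y) (j : hom (atlas_kscheme (field_atlas l)) Y) : over_base j ->
    (forall x, j x = z) -> pi z = pi y -> forall (U : opens X) (s : sec U) c,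
    U (pi y) -> ~ inv_at (s - const U c) (pi y) ->
    forall (W : opens (atlas_kscheme (field_atlas l)))
      (h : W `<=` hpre (hcomp pi j) U) x,
    W x -> value (res h (pull (hcomp pi j) U s) : section W) = iota c.
  move=> oj jz ez U s c Uy n W h x Wx.
  have h' : W `<=` hpre j (hpre pi U) by [].
  rewrite (pull_hcomp s h h') (value_rres _ _ Wx).
  have Uz : hpre pi U z by rewrite /hpre /preim /= ez.
  apply: (value_at_rational oj (jz x) Uz).
  rewrite -lpi -rmorphB => /(inv_at_pull _ (Uz : U (pi z))).
  by rewrite ez.
have o (j : hom (atlas_kscheme (field_atlas l)) Y) : over_base j ->
    lies_over iota (hcomp pi j) by move=> oj; exact: (lies_over_comp lpi oj).
have ei : hom_eq (hcomp pi i) (hcomp pi i').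
  split=> [x /=|U s W h h']; first by rewrite iy iy'.
  apply: value_eq => Wg.
  have Uy : U (pi y).
    have : U (pi (i (generic (field_atlas l)))) := h _ Wg.
    by rewrite iy.
  have [c [_ n]] := rx U s Uy.
  rewrite (val _ _ oi iy erefl _ _ _ Uy n _ h _ Wg).
  by rewrite (val _ _ oi' iy' (esym e) _ _ _ Uy n _ h' _ Wg).
have [_ uniq] := univ _ _ (o i oi).
have [he _] := uniq i i' oi oi' (hom_eq_refl _) (hom_eq_sym ei).
by rewrite -(iy (generic (field_atlas l))) he iy'.
Qed.

(** * Descent data *)

(** The value of [s] at [h x] is the conjugate of the value at [x] of its
    pullback. *)
Lemma rational_semilinear (k : fieldType) (sigma : k -> k) (X Y : kscheme k)
  (h : hom X Y) (x : X) : cancel sigma sigma -> lies_over sigma h ->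
  rational_point x -> rational_point (h x).
Proof.
move=> s2 lh rx U s Ux; have [c [_ n]] := rx (hpre h U) (pull h U s) Ux.
exists (sigma c); split=> //.
by rewrite -(inv_at_pull (f := h)) // rmorphB lh s2.
Qed.

Definition twist (k : fieldType) (sigma : {rmorphism k -> k}) (X : kscheme k) :
  kscheme k := @KScheme k X (kstr X \o sigma).

Lemma const_twist (k : fieldType) (sigma : {rmorphism k -> k}) (X : kscheme k)
  (U : opens X) a : @const k (twist sigma X) U a = @const k X U (sigma a).
Proof. by []. Qed.

Lemma twist_base_extension (k : fieldType) (sigma : {rmorphism k -> k})
  (X : kscheme k) : cancel sigma sigma ->
  @base_extension k k sigma X (twist sigma X) (hid X).
Proof.
move=> s2.
have lid : @lies_over k k sigma (twist sigma X) X (hid X).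
  by move=> V a; rewrite lies_over_id const_twist s2.
split=> // T g lg; split.
  exists g; split; last exact: hcomp_idl.
  by move=> V a; rewrite const_twist lg s2.
move=> h h' _ _ e e'; apply: (hom_eq_trans (hom_eq_sym (hcomp_idl h))).
apply: (hom_eq_trans e); apply: (hom_eq_trans (hom_eq_sym e')); exact: hcomp_idl.
Qed.

(** By the universal property [sigma] acts on the base extension of [X0]. This
    action fixes [y], because no other rational point has the same image in
    [X0]; transport it by [psi]. *)
Lemma descent_involution (k0 k : fieldType) (iota : {rmorphism k0 -> k})
  (sigma : {rmorphism k -> k}) (X0 : kscheme k0) (Y X : kscheme k)
  (pi : hom Y X0) (psi : hom Y X) (y : Y) :
  cancel sigma sigma -> (forall a, sigma (iota a) = iota a) ->
  base_extension iota pi -> isomorphism psi -> rational_point (pi y) ->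
  rational_point y ->
  exists H : hom X X, [/\ lies_over sigma H, hom_eq (hcomp H H) (hid X) &
    H (psi y) = psi y].
Proof.
move=> s2 si be [opsi [psi' [opsi' [e1 e2]]]] rx ry.
have [lpi univ] := be.
have lT : @lies_over k0 k iota (twist sigma Y) X0 pi.
  by move=> V a; rewrite const_twist si lpi.
have [[h [oh eh]] _] := univ _ _ lT.
have lh : @lies_over k k sigma Y Y h.
  by move=> V a; rewrite -[a in LHS]s2 -[RHS]const_twist -oh s2.
have ehh : hom_eq (hcomp pi (hcomp h h)) pi.
  apply: (hom_eq_trans (hcompA _ _ _)).
  by apply: (hom_eq_trans (hcomp_eq eh (hom_eq_refl h))).
have hh : hom_eq (hcomp h h) (hid Y).
  have [_ uniq] := univ Y pi lpi; apply: uniq => //.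
  - by move=> V a; rewrite (lies_over_comp lh lh) /= s2.
  - exact: lies_over_id.
  - exact: hcomp_idr.
have hy : h y = y.
  apply/esym/(rational_fibre be rx _ ry); first exact/esym/(eh.1 y).
  exact: (rational_semilinear s2 lh ry).
exists (hcomp psi (hcomp h psi')); split.
- by move=> V a; rewrite (lies_over_comp opsi (lies_over_comp lh opsi')).
- apply: (hom_eq_trans (hom_eq_sym (hcompA _ _ _))).
  apply: hom_eq_trans e2; apply: hcomp_eq; first exact: hom_eq_refl.
  apply: (hom_eq_trans (hom_eq_sym (hcompA _ _ _))).
  have e3 : hom_eq (hcomp psi' (hcomp psi (hcomp h psi'))) (hcomp h psi').
    apply: (hom_eq_trans (hcompA _ _ _)); apply: hom_eq_trans (hcomp_idl _).
    by apply: hcomp_eq => //; exact: hom_eq_refl.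
  apply: (hom_eq_trans (hcomp_eq (hom_eq_refl h) e3)).
  apply: (hom_eq_trans (hcompA _ _ _)); apply: hom_eq_trans (hcomp_idl _).
  by apply: hcomp_eq => //; exact: hom_eq_refl.
- have -> : hcomp psi (hcomp h psi') (psi y) = psi (h (psi' (psi y))) by [].
  by rewrite (e1.1 y : psi' (psi y) = y) hy.
Qed.

(** * Fields of fractions *)

Lemma fraction_repr (S : idomainType) (q : {fraction S}) :
  exists a b : S, b != 0 /\ q = tofrac a / tofrac b.
Proof.
elim/quotW: q => x; exists x.1, x.2; have d0 : x.2 != 0 by exact: denom_ratioP.
split=> //; have D0 : tofrac x.2 != 0 by rewrite tofrac_eq0.
apply: (mulIf D0); rewrite divfK // -[x]Ratio_numden; unlock tofrac.
rewrite -[LHS]FracField.pi_mul; apply/eqmodP => /=; rewrite FracField.equivfE /=.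
by rewrite !numden_Ratio ?mulr1 ?oner_neq0 ?mulf_neq0 ?oner_neq0 // mulrC.
Qed.

Lemma subf_div (L : fieldType) (a b c d : L) : b != 0 -> d != 0 ->
  a / b - c / d = (a * d - c * b) / (b * d).
Proof. by move=> b0 d0; field; rewrite b0 d0. Qed.

Section FracLift.
Variables (S : idomainType) (L : fieldType) (ev : {rmorphism S -> L}).

Definition flift_dom : set {fraction S} :=
  [set q | exists a b, ev b != 0 /\ q = tofrac a / tofrac b].

Definition flift (q : {fraction S}) : L :=
  xget 0 [set v | exists a b,
    [/\ ev b != 0, q = tofrac a / tofrac b & v = ev a / ev b]].

Let nz b : ev b != 0 -> tofrac b != 0.
Proof. by rewrite tofrac_eq0; apply: contra_neq => ->; rewrite rmorph0. Qed.

Lemma flift_frac a b : ev b != 0 -> flift (tofrac a / tofrac b) = ev a / ev b.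
Proof.
move=> b0; rewrite /flift; case: xgetP => [_ -> [a' [b' [b0' e ->]]]|h].
  move: e => /eqP; rewrite eqr_div ?nz // -!tofracM tofrac_eq => /eqP e.
  by apply/eqP; rewrite eqr_div // -!rmorphM e.
by case: (h (ev a / ev b)); exists a, b.
Qed.

Lemma flift_sub : is_subring flift_dom.
Proof.
split=> [|_ _ [a [b [b0 ->]]] [c [d [d0 ->]]]|_ _ [a [b [b0 ->]]] [c [d [d0 ->]]]].
- by exists 1, 1; rewrite rmorph1 oner_neq0 divff // tofrac_eq0 oner_neq0.
- exists (a * d - c * b), (b * d); rewrite rmorphM mulf_neq0 //; split=> //.
  by rewrite tofracB !tofracM subf_div ?nz.
- exists (a * c), (b * d); rewrite rmorphM mulf_neq0 //; split=> //.
  by rewrite !tofracM mulf_div.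
Qed.

Lemma flift1 : flift 1 = 1.
Proof.
rewrite -[X in flift X](divff (nz (b := 1) _)) ?flift_frac ?rmorph1 ?divff //;
exact: oner_neq0.
Qed.

Lemma fliftB p q : flift_dom p -> flift_dom q -> flift (p - q) = flift p - flift q.
Proof.
move=> [a [b [b0 ->]]] [c [d [d0 ->]]].
have -> : tofrac a / tofrac b - tofrac c / tofrac d =
    tofrac (a * d - c * b) / tofrac (b * d).
  by rewrite tofracB !tofracM subf_div ?nz.
by rewrite !flift_frac ?rmorphM ?mulf_neq0 // rmorphB !rmorphM subf_div.
Qed.

Lemma fliftM p q : flift_dom p -> flift_dom q -> flift (p * q) = flift p * flift q.
Proof.
move=> [a [b [b0 ->]]] [c [d [d0 ->]]].
have -> : tofrac a / tofrac b * (tofrac c / tofrac d) =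
    tofrac (a * c) / tofrac (b * d).
  by rewrite !tofracM mulf_div.
by rewrite !flift_frac ?rmorphM ?mulf_neq0 // mulf_div.
Qed.

Lemma flift_inv p : flift_dom p -> flift p != 0 -> flift_dom p^-1.
Proof.
move=> [a [b [b0 ->]]]; rewrite flift_frac // mulf_eq0 negb_or => /andP[a0 _].
by exists b, a; split=> //; rewrite invf_div.
Qed.

(** The extension of a ring morphism to the localization at its kernel. *)
Definition frac_phom : phom {fraction S} L :=
  PHom flift_sub flift1 fliftB fliftM flift_inv.

Lemma frac_phom_tofrac a : dom frac_phom (tofrac a) /\ frac_phom (tofrac a) = ev a.
Proof.
have e : tofrac a = tofrac a / tofrac 1 by rewrite tofrac1 divr1.
have e1 : ev 1 != 0 by rewrite rmorph1 oner_neq0.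
split; first by exists a, 1.
by rewrite e /= flift_frac // rmorph1 divr1.
Qed.

Lemma frac_phom_frac a b : ev b != 0 ->
  dom frac_phom (tofrac a / tofrac b) /\ frac_phom (tofrac a / tofrac b) = ev a / ev b.
Proof. by move=> b0; split; [exists a, b | exact: flift_frac]. Qed.

End FracLift.

(** * Projective models *)

Lemma appD (K L : fieldType) (T : phom K L) a b : dom T a -> dom T b ->
  T (a + b) = T a + T b.
Proof.
move=> da db; have d0 := subring0 (dom_subring T).
have e : T (- b) = - T b by rewrite -sub0r appB // app0 sub0r.
by rewrite -{1}(opprK b) appB ?e ?opprK //; exact: (subringN (dom_subring T)).
Qed.

(** A homomorphism defined on a chart has a center there: the point whose local
    ring inverts the functions not in the kernel. *)
Section KernelPoint.
Variables (M : atlas) (L : fieldType) (T : phom (fld M) L) (j : idx M).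
Hypothesis h : forall a, chart j a -> dom T a.

Lemma kernel_prime : is_prime (chart j) [set a | chart j a /\ T a = 0].
Proof.
have sA := chart_subring j; split.
- by move=> a [].
- by split; [exact: (subring0 sA) | exact: app0].
- move=> a b [Aa a0] [Ab b0]; split; first exact: (subringD sA).
  by rewrite appD ?a0 ?b0 ?addr0 //; exact: h.
- move=> a b Aa [Ab b0]; split; first exact: (subringM sA).
  by rewrite appM ?b0 ?mulr0 //; exact: h.
- by case=> _; rewrite app1 => /eqP; rewrite oner_eq0.
- move=> a b Aa Ab [_]; rewrite appM; try exact: h.
  by move/eqP; rewrite mulf_eq0 => /orP[]/eqP e; [left|right].
Qed.

Definition kernel_point : point M := prime_point kernel_prime.

Lemma kernel_point_unit a : chart j a -> unit_in (lring kernel_point) a <-> T a != 0.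
Proof.
move=> Aa; rewrite (prime_point_unit kernel_prime Aa) /=.
by split=> [n|/eqP n [_]//]; apply/eqP => a0; apply: n.
Qed.

Lemma kernel_point_frac s : lring kernel_point s -> exists a b,
  [/\ chart j a, chart j b, T b != 0 & s = a / b].
Proof.
have hj : in_chart j kernel_point by exact: prime_point_chart.
move=> /(localization_frac (in_chart_loc hj))[a [b [Aa Ab ub ->]]].
by exists a, b; split=> //; apply/kernel_point_unit.
Qed.

End KernelPoint.

(** The value of [a / b] is [T a / T b]. *)
Lemma kernel_point_residue (k : fieldType) (M : katlas k) (T : phom (fld M) k)
  (j : idx M) (h : forall a, chart j a -> dom T a) : (forall c, T (kin M c) = c) ->
  forall s, lring (kernel_point h) s ->
  exists c, ~ unit_in (lring (kernel_point h)) (s - kin M c).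
Proof.
move=> Tc s /kernel_point_frac[a [b [Aa Ab b0 ->]]]; exists (T a / T b) => u.
have ub := (kernel_point_unit h Ab).2 b0.
have Ac : chart j (kin M (T a / T b)) by exact: kin_chart.
have Acb := subringM (chart_subring j) Ac Ab.
have Aw := subringB (chart_subring j) Aa Acb.
have : unit_in (lring (kernel_point h)) (a - kin M (T a / T b) * b).
  have -> : a - kin M (T a / T b) * b = (a / b - kin M (T a / T b)) * b.
    by rewrite mulrBl divfK //; case: ub.
  exact: (unit_inM (lring_subring _)).
have da := h _ Aa; have db := h _ Ab; have dc := h _ Ac; have dcb := h _ Acb.
by rewrite (kernel_point_unit h Aw) appB // appM // Tc divfK // subrr eqxx.
Qed.

Section DominateChart.
Variables (M N : atlas) (T : phom (fld N) (fld M)) (x : point M) (j : idx N).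
Hypothesis h : forall a, chart j a -> dom T a /\ lring x (T a).

(** The contraction to the chart [j] of the maximal ideal of [x]. *)
Lemma pullback_prime :
  is_prime (chart j) [set a | chart j a /\ ~ unit_in (lring x) (T a)].
Proof.
have lx := lring_local x; have sx := lx.1; have sj := chart_subring j.
split=> /=.
- by move=> a [].
- by split; [exact: subring0 | rewrite app0 => -[]; rewrite eqxx].
- move=> a b [Aa na] [Ab nb]; have [da xa] := h Aa; have [db xb] := h Ab.
  by split; [exact: subringD | rewrite appD //; exact: nonunitD].
- move=> a b Aa [Ab nb]; have [da xa] := h Aa; have [db xb] := h Ab.
  by split; [exact: (subringM sj) | rewrite appM //; exact: nonunitM].
- by case=> _; rewrite app1; apply; exact: unit_in1.
- move=> a b Aa Ab [_ nab]; have [da xa] := h Aa; have [db xb] := h Ab.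
  have [ua|na] := pselect (unit_in (lring x) (T a)); last by left.
  right; split=> // ub; apply: nab; rewrite appM //; exact: unit_inM.
Qed.

Lemma dominates_prime_point : dominates T x (prime_point pullback_prime).
Proof.
have sx := lring_subring x.
have key s : lring (prime_point pullback_prime) s ->
    exists a b, [/\ chart j a, chart j b, unit_in (lring x) (T b),
      dom T b^-1 & s = a / b].
  move=> [a [b [Aa Ab nb ->]]]; exists a, b.
  have ub : unit_in (lring x) (T b) by apply: contrapT => n; exact: nb.
  by split=> //; apply: dom_inv; [case: (h Ab) | case: ub].
split=> _ /key[a [b [Aa Ab ub db' ->]]]; have [da xa] := h Aa; have [db xb] := h Ab.
- exact: (subringM (dom_subring T)).
- rewrite appM // app_inv //; last by case: ub.
  by apply: (subringM sx) => //; case: ub.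
- rewrite appM // app_inv //; last by case: ub.
  move/(unit_inM sx ub); rewrite mulrC divfK //; last by case: ub.
  move=> ua; apply: (unit_inM (lring_subring _)).
    by apply/prime_point_unit => //; case.
  apply: (unit_in_inv); apply/prime_point_unit => //; case=> _; exact.
Qed.

End DominateChart.

Section ProjModel.
Variables (k K : fieldType) (iota : {rmorphism k -> K}) (n : nat).
Variable f : 'I_n.+1 -> K.
Hypothesis f0 : forall i, f i != 0.
Implicit Types i j l : 'I_n.+1.

Inductive gen_alg i : K -> Prop :=
| gen_algC c : gen_alg i (iota c)
| gen_algX j : gen_alg i (f j / f i)
| gen_algD a b of gen_alg i a & gen_alg i b : gen_alg i (a + b)
| gen_algM a b of gen_alg i a & gen_alg i b : gen_alg i (a * b).

Lemma gen_alg_min i (S : set K) : (forall c, S (iota c)) ->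
  (forall s t, S s -> S t -> S (s + t)) -> (forall s t, S s -> S t -> S (s * t)) ->
  (forall j, S (f j / f i)) -> gen_alg i `<=` S.
Proof.
move=> hC hD hM hX a; elim=> // b c _ hb _ hc; [exact: hD | exact: hM].
Qed.

Lemma gen_alg_subring i : is_subring (gen_alg i).
Proof.
split=> [|a b ha hb|]; last exact: gen_algM.
  by rewrite -(rmorph1 iota); exact: gen_algC.
apply: gen_algD => //; rewrite -mulN1r; apply: gen_algM => //.
by rewrite -(rmorph1 iota) -rmorphN; exact: gen_algC.
Qed.

Lemma gen_transK i j : f j / f i * (f i / f j) = 1.
Proof. by field; rewrite !f0. Qed.

Lemma gen_trans_loc i j a : gen_alg j a -> exists m, gen_alg i (a * (f j / f i) ^+ m).
Proof.
have sA := gen_alg_subring i.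
apply: (@gen_alg_min j [set a | exists m, gen_alg i (a * (f j / f i) ^+ m)]).
- by move=> c; exists 0%N; rewrite mulr1; exact: gen_algC.
- move=> s t [m hs] [m' ht]; exists (m + m')%N.
  rewrite mulrDl; apply: gen_algD.
    by rewrite exprD mulrA; apply: gen_algM => //; apply: (subringX sA); exact: gen_algX.
  rewrite addnC exprD mulrA; apply: gen_algM => //; apply: (subringX sA).
  exact: gen_algX.
- move=> s t [m hs] [m' ht]; exists (m + m')%N.
  by rewrite exprD mulrACA; exact: gen_algM.
- move=> l; exists 1%N; rewrite expr1.
  have -> : f l / f j * (f j / f i) = f l / f i by field; rewrite !f0.
  exact: gen_algX.
Qed.

Definition proj_atlas : atlas :=
  @Atlas K 'I_n.+1 ord0 gen_alg gen_alg_subring (fun i j => f j / f i) gen_algX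
    gen_transK gen_trans_loc.

(** The closure of the image of the rational map with homogeneous coordinates
    [f]. *)
Definition proj_model : katlas k := @KAtlas k proj_atlas iota gen_algC.

Lemma in_proj_chart (x : point proj_model) i :
  (forall j, lring x (f j / f i)) -> in_chart (M := proj_model) i x.
Proof.
move=> h; apply: gen_alg_min; first exact: (kin_lring (M := proj_model)).
- exact: (subringD (lring_subring x)).
- exact: (subringM (lring_subring x)).
- exact: h.
Qed.

Lemma proj_finite_type : finite_type (atlas_kscheme proj_model).
Proof.
exists n.+1, (fun i => chart_open (M := proj_model) i); split.
  by move=> x; exact: (point_chart x).
move=> i; split; first exact: affine_chart.
exists n.+1, (fun j => @chart_sec proj_model i _ (gen_algX i j)).
move=> S hc hD hM hX s.
have gU := @chart_openg proj_model i.
have [s' [Ss' e]] : exists s', S s' /\ value (s' : section _) = value (s : section _).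
  apply: (gen_alg_min (S := [set a | exists s', S s' /\ value (s' : section _) = a]) _ _ _ _
    (section_chart (M := proj_model) s)).
  - by move=> c; exists (const _ c); split=> //; rewrite (value_const _ gU).
  - by move=> _ _ [s1 [S1 <-]] [s2 [S2 <-]]; exists (s1 + s2); split=> //; exact: hD.
  - by move=> _ _ [s1 [S1 <-]] [s2 [S2 <-]]; exists (s1 * s2); split=> //; exact: hM.
  - by move=> j; exists (@chart_sec proj_model i _ (gen_algX i j)); split=> //;
      exact: value_chart_sec.
by rewrite -(value_inj e).
Qed.

Section MapTo.
Variables (M : atlas) (T : phom K (fld M)).
Hypotheses (Tc : forall c, dom T (iota c)).
Hypotheses (Tcx : forall c (x : point M), lring x (T (iota c))).

Lemma proj_regular (x : point M) j :
  (forall l, dom T (f l / f j) /\ lring x (T (f l / f j))) ->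
  forall a, gen_alg j a -> dom T a /\ lring x (T a).
Proof.
move=> h; have sT := dom_subring T; have sx := lring_subring x.
apply: gen_alg_min; first by move=> c; split.
- move=> s t [ds xs] [dt xt]; split; first exact: subringD.
  by rewrite appD //; exact: subringD.
- move=> s t [ds xs] [dt xt]; split; first exact: (subringM sT).
  by rewrite appM //; exact: (subringM sx).
- exact: h.
Qed.

Hypothesis defined : forall x : point M, exists j, forall l,
  dom T (f l / f j) /\ lring x (T (f l / f j)).

Lemma proj_ex_dom (x : point M) : exists y : point proj_model,
  @dominates M proj_model T x y.
Proof.
have [j h] := defined x.
exists (prime_point (pullback_prime (N := proj_model) (proj_regular h))).
exact: dominates_prime_point.
Qed.

Lemma proj_spread (x : point M) (y : point proj_model) j :
  @dominates M proj_model T x y ->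
  in_chart (M := proj_model) j y ->
  exists W : opens (point M), W x /\
    forall x' a, W x' -> gen_alg j a -> lring x' (T a).
Proof.
move=> d hj.
have hl l : dom T (f l / f j) /\ lring x (T (f l / f j)).
  have yl := hj _ (gen_algX j l).
  by split; [exact: (dominates_dom d) | exact: (dominates_in d)].
have [W [Wx hW]] : exists W : opens (point M), W x /\
    forall l x', l \in enum 'I_n.+1 -> W x' -> lring x' (T (f l / f j)).
  elim: (enum _) => [|l r [W [Wx hW]]]; first by exists (whole (point M)).
  pose D := Opens (@open_regular M (T (f l / f j))).
  exists (Opens (openI (oset_open W) (oset_open D))); split.
    by split=> //; case: (hl l).
  by move=> l' x'; rewrite inE => /orP[/eqP ->|/hW h] [Wx' Dx'] //; exact: h.
exists W; split=> // x' a Wx' Aa.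
apply: (proj_regular (j := j) (x := x') _ Aa).2 => l; split; first by case: (hl l).
by apply: hW => //; rewrite mem_enum.
Qed.

Definition proj_hom : hom (atlas_scheme M) (atlas_scheme proj_model) :=
  phom_hom proj_ex_dom (fun x y j => @proj_spread x y j).

Lemma proj_hom_follows : @follows M proj_model T proj_hom.
Proof. exact: phom_hom_follows. Qed.

End MapTo.
End ProjModel.

(** * Projective space *)

Section ProjSpace.
Variables (k : fieldType) (n : nat).
Notation S := {mpoly k[n.+1]}.
Implicit Types i j l : 'I_n.+1.

Definition scalar : {rmorphism k -> {fraction S}} :=
  @tofrac S \o @mpolyC n.+1 k.

Definition hcoord i : {fraction S} := tofrac ('X_i : S).

Lemma hcoord0 i : hcoord i != 0.
Proof. by rewrite tofrac_eq0 -msize_poly_eq0 msizeX. Qed.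

Definition pspace_model : katlas k := proj_model scalar hcoord0.
Definition pspace : kscheme k := atlas_kscheme pspace_model.

Definition coord i j : @sec pspace (chart_open (M := pspace_model) i) :=
  @chart_sec pspace_model i _ (gen_algX scalar hcoord i j).

Lemma value_coord i j : value (coord i j : section _) = hcoord j / hcoord i.
Proof. exact: value_chart_sec. Qed.

(** The numerator [G] need not be homogeneous: evaluation at [x_i = 1] is well
    defined on all fractions whose denominator is a power of [x_i]. *)
Definition homog_value i (q : {fraction S}) (G : S) : Prop :=
  exists d, q = tofrac G / hcoord i ^+ d.

Lemma homog_ex i q : gen_alg scalar hcoord i q -> exists G, homog_value i q G.
Proof.
have x0 := hcoord0 i.
move: q; apply: (gen_alg_min (S := [set q | exists G, homog_value i q G])).
- by move=> c; exists c%:MP, 0%N; rewrite divr1.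
- move=> _ _ [G [d ->]] [G' [d' ->]].
  exists (G * 'X_i ^+ d' + G' * 'X_i ^+ d), (d + d')%N.
  by rewrite tofracD !tofracM !tofracXn -/(hcoord i) exprD addf_div ?expf_neq0.
- move=> _ _ [G [d ->]] [G' [d' ->]]; exists (G * G'), (d + d')%N.
  by rewrite tofracM exprD mulf_div.
- by move=> j; exists 'X_j, 1%N; rewrite expr1.
Qed.

Section Eval.
Variables (B : comNzRingType) (c : {rmorphism k -> B}) (b : 'I_n.+1 -> B).
Variable i : 'I_n.+1.
Hypothesis bi : b i = 1.
Implicit Types s : section (chart_open (M := pspace_model) i).

Lemma mmap_coord j : mmap c b 'X_j = b j.
Proof. by rewrite mmapX mmap1U. Qed.

Lemma homog_uniq q G G' : homog_value i q G -> homog_value i q G' ->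
  mmap c b G = mmap c b G'.
Proof.
move=> [d ->] [d' /eqP]; rewrite eqr_div ?expf_neq0 ?hcoord0 //.
rewrite -!tofracXn -!tofracM tofrac_eq => /eqP /(congr1 (mmap c b)).
by rewrite !rmorphM !rmorphXn /= mmap_coord bi !expr1n !mulr1.
Qed.

Definition dehomog (s : section (chart_open (M := pspace_model) i)) : B :=
  mmap c b (projT1 (cid (homog_ex (section_chart s)))).

Lemma dehomogE s G : homog_value i (value s) G -> dehomog s = mmap c b G.
Proof.
exact: (homog_uniq (projT2 (cid (homog_ex (section_chart s))))).
Qed.

Lemma dehomogP s : exists G, homog_value i (value s) G.
Proof. exact: (homog_ex (section_chart s)). Qed.

Lemma dehomog_const a : dehomog (@const k pspace _ a) = c a.
Proof.
rewrite (@dehomogE _ a%:MP) ?mmapC //; exists 0%N.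
by rewrite (value_const _ (@chart_openg pspace_model i)) divr1.
Qed.

Lemma dehomog_coord j : dehomog (coord i j) = b j.
Proof.
by rewrite (@dehomogE _ 'X_j) ?mmap_coord //; exists 1%N; rewrite value_coord expr1.
Qed.

Lemma dehomog1 : dehomog 1 = 1.
Proof. by rewrite -(rmorph1 c) -dehomog_const rmorph1. Qed.

Lemma dehomogB : {morph dehomog : s t / s - t}.
Proof.
move=> s t; have [G [d e]] := dehomogP s; have [G' [d' e']] := dehomogP t.
have x0 := hcoord0 i.
rewrite (@dehomogE s G) ?(@dehomogE t G'); [|by exists d'|by exists d].
rewrite (@dehomogE _ (G * 'X_i ^+ d' - G' * 'X_i ^+ d)).
  by rewrite rmorphB !rmorphM !rmorphXn /= mmap_coord bi !expr1n !mulr1.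
exists (d + d')%N; rewrite valueB e e' tofracB !tofracM !tofracXn -/(hcoord i).
by rewrite exprD subf_div ?expf_neq0.
Qed.

Lemma dehomogM : {morph dehomog : s t / s * t}.
Proof.
move=> s t; have [G [d e]] := dehomogP s; have [G' [d' e']] := dehomogP t.
have x0 := hcoord0 i.
rewrite (@dehomogE s G) ?(@dehomogE t G'); [|by exists d'|by exists d].
rewrite (@dehomogE _ (G * G')) ?rmorphM //.
by exists (d + d')%N; rewrite valueM e e' !tofracM exprD mulf_div.
Qed.

Definition dehomog_morph : {rmorphism section (chart_open (M := pspace_model) i) -> B} :=
  mk_rmorphism dehomog1 dehomogB dehomogM.

End Eval.

Lemma coord_morphism_ex i (B : comPzRingType) (c : {rmorphism k -> B})
  (b : 'I_n.+1 -> B) : b i = 1 ->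
  exists phi : {rmorphism @sec pspace (chart_open (M := pspace_model) i) -> B},
    (forall a, phi (const _ a) = c a) /\ (forall j, phi (coord i j) = b j).
Proof.
(* Evaluation of polynomials requires a nonzero ring. *)
move=> bi; have [/eqP B0|B1] := boolP (1 == 0 :> B).
  have triv (u v : B) : u = v by rewrite -[u]mulr1 -[v]mulr1 B0 !mulr0.
  exists (@mk_rmorphism (@sec pspace (chart_open (M := pspace_model) i)) B
    (fun=> 0) (triv _ _) (fun _ _ => triv _ _) (fun _ _ => triv _ _)).
  by split=> *; exact: triv.
pose B' : comNzRingType := HB.pack (GRing.ComPzRing.sort B) B
  (GRing.PzSemiRing_isNonZero.Build B B1).
exists (@dehomog_morph B' c b i bi); split.
- exact: (@dehomog_const B' c b i bi).
- exact: (@dehomog_coord B' c b i bi).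
Qed.

Lemma coord_morphism_uniq i (B : comPzRingType)
  (phi psi : {rmorphism @sec pspace (chart_open (M := pspace_model) i) -> B}) :
  (forall a, phi (const _ a) = psi (const _ a)) ->
  (forall j, phi (coord i j) = psi (coord i j)) -> phi =1 psi.
Proof.
move=> hc hX s; have gU := @chart_openg pspace_model i.
have [s' [e e']] : exists s', phi s' = psi s' /\ value (s' : section _) = value (s : section _).
  apply: (gen_alg_min (S := [set a | exists s', phi s' = psi s' /\ value (s' : section _) = a]) _ _ _ _
    (section_chart (M := pspace_model) s)).
  - by move=> a; exists (const _ a); split=> //; rewrite (value_const _ gU).
  - by move=> _ _ [s1 [e1 <-]] [s2 [e2 <-]]; exists (s1 + s2); rewrite !rmorphD e1 e2.
  - by move=> _ _ [s1 [e1 <-]] [s2 [e2 <-]]; exists (s1 * s2); rewrite !rmorphM e1 e2.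
  - by move=> j; exists (coord i j); split=> //; exact: value_coord.
by rewrite -(value_inj e').
Qed.

Lemma pspaceP : projective_space coord.
Proof.
split.
- split=> [x|i]; first exact: (point_chart x).
  exact: affine_chart.
- move=> i; split.
    apply: value_inj; rewrite value_coord divff ?hcoord0 //.
    by rewrite (value1 (@chart_openg pspace_model i)).
  move=> B c b bi; split; first exact: coord_morphism_ex.
  exact: coord_morphism_uniq.
- move=> i j x hx; rewrite (inv_atP (coord i j) hx) value_coord.
  split=> [hj|u]; first exact: (@trans_unit pspace_model i j x hx hj).
  exact: (@in_chart_of_unit pspace_model i j x hx u).
- move=> i j l W hi hj; apply: value_eq => Wg.
  rewrite valueM !(value_rres _ _ Wg) !value_coord.
  by rewrite mulrA divfK ?hcoord0.
Qed.

End ProjSpace.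

(** * Projective models are projective *)

Section Embedding.
Variables (k K : fieldType) (iota : {rmorphism k -> K}) (n : nat).
Variable f : 'I_n.+1 -> K.
Hypothesis f0 : forall i, f i != 0.
Notation X := (proj_model iota f0).
Notation P := (pspace_model k n).

Definition coord_phom : phom (fld P) K := frac_phom (mmap iota f).

Lemma coord_phom_scalar c : dom coord_phom (scalar k n c) /\
  coord_phom (scalar k n c) = iota c.
Proof.
have [d e] := frac_phom_tofrac (mmap iota f) (c%:MP : {mpoly k[n.+1]}).
by split=> //; rewrite e /= mmapC.
Qed.

Lemma coord_phom_coord j l : dom coord_phom (hcoord k l / hcoord k j) /\
  coord_phom (hcoord k l / hcoord k j) = f l / f j.
Proof.
have ex i : mmap iota f 'X_i = f i by rewrite mmapX mmap1U.
have [|d e] := @frac_phom_frac _ _ (mmap iota f) 'X_l ('X_j : {mpoly k[n.+1]}).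
  by rewrite /= ex.
by split=> //; rewrite e /= !ex.
Qed.

Lemma embedding_defined (x : point X) : exists j, forall l,
  dom coord_phom (hcoord k l / hcoord k j) /\
  lring x (coord_phom (hcoord k l / hcoord k j)).
Proof.
have [j hj] := point_chart x; exists j => l.
have [d ->] := coord_phom_coord j l; split=> //.
by apply: hj; exact: gen_algX.
Qed.

Lemma embedding_scalar c (x : point X) : lring x (coord_phom (scalar k n c)).
Proof. by rewrite (coord_phom_scalar c).2; exact: (kin_lring (M := X)). Qed.

Definition embedding : hom (atlas_scheme X) (atlas_scheme P) :=
  @proj_hom k (fld P) (scalar k n) n (@hcoord k n) (@hcoord0 k n) X coord_phom
    (fun c => (coord_phom_scalar c).1) embedding_scalar embedding_defined.

Lemma embedding_follows : @follows X P coord_phom embedding.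
Proof. exact: proj_hom_follows. Qed.

Let dm x := follows_dominates x embedding_follows.

Lemma coord_phom_gen j t : @chart P j t ->
  dom coord_phom t /\ gen_alg iota f j (coord_phom t).
Proof.
have sd := dom_subring coord_phom.
apply: (gen_alg_min (S := [set t | dom coord_phom t /\
  gen_alg iota f j (coord_phom t)])).
- move=> c; have [d e] := coord_phom_scalar c; split=> //.
  by rewrite e; exact: gen_algC.
- move=> a b [da ga] [db gb]; split; first exact: subringD.
  by rewrite appD //; exact: gen_algD.
- move=> a b [da ga] [db gb]; split; first exact: (subringM sd).
  by rewrite appM //; exact: gen_algM.
- move=> l; have [d e] := coord_phom_coord j l; split=> //.
  by rewrite e; exact: gen_algX.
Qed.

Lemma coord_phom_surj j a : gen_alg iota f j a ->
  exists t, @chart P j t /\ coord_phom t = a.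
Proof.
have dt t : @chart P j t -> dom coord_phom t by case/coord_phom_gen.
move: a; apply: (gen_alg_min (S := [set a | exists t, @chart P j t /\
  coord_phom t = a])).
- move=> c; exists (scalar k n c); split; first exact: gen_algC.
  exact: (coord_phom_scalar c).2.
- move=> _ _ [t [Pt <-]] [t' [Pt' <-]]; exists (t + t'); split.
    exact: gen_algD.
  by rewrite appD //; exact: dt.
- move=> _ _ [t [Pt <-]] [t' [Pt' <-]]; exists (t * t'); split.
    exact: gen_algM.
  by rewrite appM //; exact: dt.
- move=> l; exists (hcoord k l / hcoord k j); split; first exact: gen_algX.
  exact: (coord_phom_coord j l).2.
Qed.

Lemma embedding_chart j x :
  in_chart (M := P) j (embedding x) <-> in_chart (M := X) j x.
Proof.
split=> h.
  apply: in_proj_chart => l; rewrite -(coord_phom_coord j l).2.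
  by apply: (dominates_in (dm x)); apply: h; exact: gen_algX.
by apply: (dominates_chart (dm x)) => a /coord_phom_gen[d g]; split=> //; exact: h.
Qed.

Lemma embedding_inj : injective embedding.
Proof.
move=> x y e; have [j hj] := point_chart (embedding x).
have hx := (embedding_chart j x).1 hj.
have hy : in_chart (M := X) j y by apply/embedding_chart; rewrite -e.
apply: (point_eq_chart hx hy) => _ /coord_phom_surj[t [Pt <-]].
have Lx := hj _ Pt; rewrite (dominates_unitE (dm x) Lx).
by rewrite (dominates_unitE (dm y)) -e.
Qed.

(** If the functions restricting to zero on [X] all vanish at [y], the prime of
    [y] comes from a prime of the chart of [X], whose ring is the quotient by
    these functions. *)
Lemma embedding_lift j (y : point P) : in_chart (M := P) j y ->
  (forall t, @chart P j t -> coord_phom t = 0 -> ~ unit_in (lring y) t) ->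
  exists x, embedding x = y.
Proof.
move=> hj hk.
have dt t : @chart P j t -> dom coord_phom t by case/coord_phom_gen.
have ly := lring_local y; have sP := @chart_subring P j.
pose q := [set a | exists t, [/\ @chart P j t, ~ unit_in (lring y) t &
  coord_phom t = a]].
have qE t : @chart P j t -> q (coord_phom t) <-> ~ unit_in (lring y) t.
  move=> Pt; split=> [[t' [Pt' n' e]] u|u]; last by exists t.
  have Pd : @chart P j (t - t') by exact: (subringB sP).
  have nd : ~ unit_in (lring y) (t - t').
    by apply: hk => //; rewrite appB ?e ?subrr //; exact: dt.
  by apply: (nonunitD ly (hj _ Pd) (hj _ Pt') nd n'); rewrite subrK.
have hq : is_prime (@chart X j) q.
  split.
  - by move=> _ [t [/coord_phom_gen[_ g] _ <-]].
  - exists 0; rewrite app0; split=> //; first exact: subring0.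
    by case; rewrite eqxx.
  - move=> _ _ [t [Pt nt <-]] [t' [Pt' nt' <-]]; exists (t + t').
    have dtt := dt _ Pt; have dtt' := dt _ Pt'.
    rewrite appD //; split=> //; first exact: (subringD sP).
    by apply: (nonunitD ly) => //; exact: hj.
  - move=> _ _ /coord_phom_surj[t [Pt <-]] [t' [Pt' nt' <-]]; exists (t * t').
    have dtt := dt _ Pt; have dtt' := dt _ Pt'.
    rewrite appM //; split=> //; first exact: (subringM sP).
    by apply: (nonunitM ly) => //; exact: hj.
  - rewrite -(app1 coord_phom) qE; last exact: (subring1 sP).
    by apply; exact: (unit_in1 ly.1).
  - move=> _ _ /coord_phom_surj[t [Pt <-]] /coord_phom_surj[t' [Pt' <-]].
    have dtt := dt _ Pt; have dtt' := dt _ Pt'.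
    rewrite -appM // !qE //; last exact: (subringM sP).
    move=> nn; apply: contrapT => /not_orP[/contrapT ut /contrapT ut'].
    by apply: nn; exact: (unit_inM ly.1).
exists (prime_point hq); apply: (dominates_uniq (dm _)).
have hx : in_chart (M := X) j (prime_point hq) by exact: prime_point_chart.
have uE t : @chart P j t ->
    unit_in (lring (prime_point hq)) (coord_phom t) <-> unit_in (lring y) t.
  move=> Pt; rewrite prime_point_unit; last by case: (coord_phom_gen Pt).
  by rewrite qE //; split=> [/contrapT|u].
have sx := lring_subring (prime_point hq).
split=> s /(localization_frac (in_chart_loc hj))[a [b [Aa Ab ub ->]]];
  have [da ga] := coord_phom_gen Aa; have [db gb] := coord_phom_gen Ab;
  have [b0 xb xbi] := (uE _ Ab).2 ub; have dbi := dom_inv db b0.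
- exact: (subringM (dom_subring coord_phom)).
- rewrite appM // app_inv //; apply: (subringM sx) => //; exact: hx.
- rewrite appM // app_inv // => u.
  apply: (unit_inM ly.1); last exact: unit_in_inv.
  apply/uE => //; have := unit_inM sx u (And3 b0 xb xbi).
  by rewrite divfK.
Qed.

(** A point off the image is separated from it by a function restricting to
    zero on [X]. Sections lift locally because numerators and denominators do,
    by [coord_phom_surj]. *)
Lemma embedding_closed : closed_immersion
  (embedding : hom (atlas_kscheme X) (pspace k n)).
Proof.
split; first exact: embedding_inj.
- move=> A cA y cy; apply: contrapT => nA.
  have [j hj] := point_chart (y : point P).
  have far (D : opens (point P)) : D y -> (forall x, A x -> ~ D (embedding x)) -> False.
    move=> Dy h; have := cy D (open_nbhs_nbhs (conj (oset_open D) Dy)).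
    by move=> [_ [[x Ax <-] /(h _ Ax)]].
  have bop t : open (bopen (M := P) j t).
    rewrite (_ : bopen j t = in_chart j `&` [set y | unit_in (lring y) t]) //.
    by apply: openI; [exact: open_chart | exact: open_unit].
  have [x ex] : exists x, embedding x = y.
    apply: (embedding_lift hj) => t Pt t0 ut.
    apply: (far (Opens (bop t))); first exact: (conj hj ut).
    move=> x _ [hx].
    by rewrite -(dominates_unitE (dm x) (hx _ Pt)) t0 => -[]; rewrite eqxx.
  have nAx : ~ A x by move=> Ax; apply: nA; exists x.
  have hx : in_chart (M := X) j x by apply/embedding_chart; rewrite ex.
  have [s [As us sub]] := @opens_basis X j x (Opens (closed_openC cA)) nAx hx.
  have [t [Pt et]] := coord_phom_surj As.
  apply: (far (Opens (bop t))).
    split=> //; rewrite -ex; apply/(dominates_unitE (dm x)).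
      by rewrite ex; exact: hj.
    by rewrite et.
  move=> x' Ax' [hx' ut]; apply: (sub x' _) => //; split.
    exact/embedding_chart.
  by rewrite -et; apply/(dominates_unitE (dm x')) => //; exact: hx'.
- move=> V s x Vx; have [j hj] := point_chart (embedding x).
  have hx := (embedding_chart j x).1 hj.
  have Ux : hpre embedding V x by [].
  have [a [b [Aa Ab ub e]]] :=
    localization_frac (in_chart_loc hx) (value_in (s : section _) Ux).
  have [a' [Pa ea]] := coord_phom_surj Aa; have [b' [Pb eb]] := coord_phom_surj Ab.
  have ub' : unit_in (lring (embedding x)) b'.
    by apply/(dominates_unitE (dm x)); [exact: hj | rewrite eb].
  have da := (coord_phom_gen Pa).1; have db := (coord_phom_gen Pb).1.
  have b0 : coord_phom b' != 0 by rewrite eb; case: ub.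
  pose W : opens (pspace k n) :=
    Opens (openI (oset_open V) (@open_regular P (a' / b'))).
  have h : W `<=` V by move=> ? [].
  have h' : hpre embedding W `<=` hpre embedding V by move=> y; exact: h.
  pose t : @sec (pspace k n) W :=
    @to_sec P W (a' / b') (fun y (Wy : W y) => Wy.2).
  have Wx : W (embedding x).
    split=> //=; apply: (subringM (lring_subring (embedding x))); first exact: hj.
    by case: ub'.
  exists W, h, h', t; split=> //; apply: value_eq => Wg.
  rewrite (value_rres _ _ Wg) (embedding_follows.2 _ _ _ (Wg : W (embedding _))).
  rewrite (value_to_sec _ (Wg : W (embedding _))) appM // ?app_inv // ?ea ?eb ?e //.
  exact: dom_inv.
Qed.

Lemma proj_model_projective : projective (atlas_kscheme X).
Proof.
exists n, (pspace k n), _, (@coord k n), embedding; split.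
- exact: pspaceP.
- apply: (@follows_lies_over k k P X id coord_phom _ embedding_follows) => c.
  exact: (coord_phom_scalar c).2.
- exact: embedding_closed.
Qed.

End Embedding.

(** * Expansions and Laurent polynomials *)

(** Here [G] stands for [z^12 + z^-12 - 2] and [z] for the parameter of one of
    the two branches at the marked point, [O] being the local ring of that
    branch. Then [jet T c h] says that [h] is [c + T / G] up to terms of order
    at least 13, and the principal parts [T] of interest have a pole of order
    at most 4. *)
Section Filtration.
Variables (K : fieldType) (O : set K) (cst : set K) (z G w : K).
Hypotheses (sO : is_subring O) (cO : cst `<=` O) (z0 : z != 0) (Oz : O z).
Hypotheses (G0 : G != 0) (Ow : O w) (Gw : G^-1 = z ^+ 12 * w).
Hypothesis inv_cst : forall c a, cst c -> c != 0 -> O a -> unit_in O (c + z * a).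

Definition jet (T c h : K) : Prop := exists2 r, O r & (h - c) * G = T + z * r.

Let ez T c h r : (h - c) * G = T + z * r -> h = c + (T + z * r) / G.
Proof. by move=> e; rewrite -e mulfK // addrC subrK. Qed.

Let OX n : O (z ^+ n). Proof. exact: (subringX sO). Qed.

Lemma jetD T c h T' c' h' : jet T c h -> jet T' c' h' ->
  jet (T + T') (c + c') (h + h').
Proof.
move=> [r Or e] [r' Or' e']; exists (r + r'); first exact: subringD.
have -> : h + h' - (c + c') = (h - c) + (h' - c') by ring.
by rewrite mulrDl e e'; ring.
Qed.

Let O_quot T r : O (z ^+ 4 * T) -> O r -> O (z ^+ 4 * (T + z * r)).
Proof.
move=> OT Or; have -> : z ^+ 4 * (T + z * r) = z ^+ 4 * T + z ^+ 5 * r by ring.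
by apply: subringD => //; exact: (subringM sO).
Qed.

(** The products of two elements of order at least 8 still have positive order
    when multiplied by [G]: only the linear terms matter. *)
Lemma jetM T c h T' c' h' : cst c -> cst c' ->
  O (z ^+ 4 * T) -> O (z ^+ 4 * T') ->
  jet T c h -> jet T' c' h' -> jet (c * T' + c' * T) (c * c') (h * h').
Proof.
move=> kc kc' OT OT' [r Or e] [r' Or' e'].
exists (c * r' + c' * r + z ^+ 3 * (z ^+ 4 * (T + z * r)) * (z ^+ 4 * (T' + z * r')) * w).
  have Oc := cO kc; have Oc' := cO kc'.
  have h1 := O_quot OT Or; have h2 := O_quot OT' Or'.
  do ?[apply: subringD => //|apply: (subringM sO) => //].
have -> : w = G^-1 / z ^+ 12 by rewrite Gw mulrC mulKf // expf_neq0.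
rewrite (ez e) (ez e'); field; rewrite z0 G0 //.
Qed.

Lemma jet_small T c h : O (z ^+ 4 * T) -> jet T c h ->
  exists2 s, O s & h = c + z * s.
Proof.
move=> OT [r Or e]; exists (z ^+ 7 * (z ^+ 4 * (T + z * r)) * w).
  have h1 := O_quot OT Or.
  do ?[apply: subringD => //|apply: (subringM sO) => //].
by rewrite (ez e) -[(_ + _) / G]mulrC Gw; ring.
Qed.

Lemma jetV T c h : cst c -> cst c^-1 -> c != 0 -> O (z ^+ 4 * T) -> jet T c h ->
  jet (- T / c ^+ 2) c^-1 h^-1.
Proof.
move=> kc kci c0 OT jh; have [s Os es] := jet_small OT jh.
have [h0 _ Oi] : unit_in O h by rewrite es; exact: inv_cst.
have [r Or e] := jh; have Oci := cO kci.
exists (z ^+ 3 * (z ^+ 4 * T) * (z ^+ 4 * (T + z * r)) * w * (c^-1 * c^-1) * h^-1 -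
  r * c^-1 * h^-1).
  have h1 := O_quot OT Or.
  by apply: (subringB sO); do ?[apply: (subringM sO) => //].
have -> : w = G^-1 / z ^+ 12 by rewrite Gw mulrC mulKf // expf_neq0.
have hE : h = c + (T + z * r) / G := ez e.
have -> : (h^-1 - c^-1) * G = - ((h - c) * G) / (c * h) by field; rewrite c0 h0.
rewrite e; have -> : r = ((h - c) * G - T) / z.
  by apply: (mulIf z0); rewrite divfK // e; ring.
by field; rewrite c0 h0 z0 G0.
Qed.

End Filtration.

(** Only the exponents occurring in [G], [F] and the linear forms in [1, z,
    z^-1] are needed. *)
Section Laurent.
Variable K : fieldType.

Definition lau (z : K) (a12 a4 a2 a1 a0 b1 b2 b4 b12 : K) : K :=
  a12 * z ^+ 12 + a4 * z ^+ 4 + a2 * z ^+ 2 + a1 * z + a0 +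
  b1 / z + b2 / z ^+ 2 + b4 / z ^+ 4 + b12 / z ^+ 12.

End Laurent.

Lemma quot_swap (K : fieldType) (x y z : K) : x != 0 -> z != 0 -> x / z = y ->
  z = x / y.
Proof. by move=> x0 z0 <-; field; rewrite x0 z0. Qed.

Section FunctionField.
Variable C : numClosedFieldType.
Notation K := {fraction {poly C}}.

Definition cst : {rmorphism C -> K} := @tofrac {poly C} \o @polyC C.
Definition zz : K := tofrac 'X.

Lemma zz0 : zz != 0. Proof. by rewrite tofrac_eq0 polyX_eq0. Qed.

Definition at0 : phom K C := frac_phom (horner_eval (0 : C)).
Definition O0 : set K := dom at0.

Lemma O0_sub : is_subring O0. Proof. exact: (dom_subring at0). Qed.
Lemma O0_poly p : O0 (tofrac p). Proof. exact: (frac_phom_tofrac _ p).1. Qed.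
Lemma O0_cst c : O0 (cst c). Proof. exact: O0_poly. Qed.
Lemma O0_zz : O0 zz. Proof. exact: O0_poly. Qed.
Lemma at0_cst c : at0 (cst c) = c.
Proof. by rewrite (frac_phom_tofrac _ _).2 /= /horner_eval hornerC. Qed.
Lemma at0_zz : at0 zz = 0.
Proof. by rewrite (frac_phom_tofrac _ _).2 /= /horner_eval hornerX. Qed.

Lemma O0_unit a : O0 a -> at0 a != 0 -> unit_in O0 a.
Proof.
move=> Oa na; split=> //; last exact: (dom_inv (p := at0)).
by apply: contra_neq na => ->; exact: app0.
Qed.

Lemma O0_inv_cst c a : range cst c -> c != 0 -> O0 a -> unit_in O0 (c + zz * a).
Proof.
move=> [c' _ <-]; rewrite fmorph_eq0 => c0 Oa.
have Oza : O0 (zz * a) by apply: (subringM O0_sub) => //; exact: O0_zz.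
apply: O0_unit; first by apply: (subringD O0_sub) => //; exact: O0_cst.
rewrite appD //; last exact: O0_cst.
by rewrite appM ?at0_zz ?at0_cst ?mul0r ?addr0 //; exact: O0_zz.
Qed.

(** The endomorphism of [C(z)] acting on constants by [sigma] and sending [z]
    to [t]. *)
Section Subst.
Variables (sigma : {rmorphism C -> C}) (t : K).
Hypothesis ht : forall a, t != cst a.

Definition subst_poly : {rmorphism {poly C} -> K} :=
  @horner_morph C K (cst \o sigma) t (fun a => mulrC t (cst (sigma a))).

Lemma subst_polyC a : subst_poly a%:P = cst (sigma a).
Proof. exact: horner_morphC. Qed.

Lemma subst_polyX : subst_poly 'X = t.
Proof. exact: horner_morphX. Qed.

(** A polynomial over an algebraically closed field is a product of linear
    factors, so an element which is not constant is transcendental. *)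
Lemma subst_poly_neq0 p : p != 0 -> subst_poly p != 0.
Proof.
move=> p0; have [r e] := closed_field_poly_normal p.
rewrite e -mul_polyC rmorphM /= subst_polyC mulf_neq0 //.
  by rewrite !fmorph_eq0 lead_coef_eq0.
rewrite rmorph_prod /= prodf_seq_neq0; apply/allP => a _ /=.
by rewrite rmorphB /= subst_polyC subst_polyX subr_eq0 ht.
Qed.

Lemma subst_dom q : dom (frac_phom subst_poly) q.
Proof.
have [a [b [b0 ->]]] := fraction_repr q.
by exists a, b; split=> //; exact: subst_poly_neq0.
Qed.

Definition subst : {rmorphism K -> K} :=
  mk_rmorphism (app1 (frac_phom subst_poly))
    (fun a b => appB (subst_dom a) (subst_dom b))
    (fun a b => appM (subst_dom a) (subst_dom b)).

Lemma subst_tofrac p : subst (tofrac p) = subst_poly p.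
Proof. exact: (frac_phom_tofrac subst_poly p).2. Qed.

Lemma subst_cst a : subst (cst a) = cst (sigma a).
Proof. by rewrite subst_tofrac subst_polyC. Qed.

Lemma subst_zz : subst zz = t.
Proof. by rewrite subst_tofrac subst_polyX. Qed.

End Subst.

Lemma rmorph_poly_eq (S : comNzRingType) (u v : {rmorphism {poly C} -> S}) :
  (forall a, u a%:P = v a%:P) -> u 'X = v 'X -> u =1 v.
Proof.
move=> hC hX; elim/poly_ind => [|p c IH]; first by rewrite !rmorph0.
by rewrite !rmorphD !rmorphM /= IH hX hC.
Qed.

Lemma rmorph_frac_eq (u v : {rmorphism K -> K}) :
  (forall a, u (cst a) = v (cst a)) -> u zz = v zz -> u =1 v.
Proof.
move=> hC hX q; have [a [b [_ ->]]] := fraction_repr q.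
have e : (u \o @tofrac {poly C}) =1 (v \o @tofrac {poly C}).
  by apply: rmorph_poly_eq.
by rewrite !fmorph_div; congr (_ / _); apply: e.
Qed.

Lemma zz_not_cst a : zz != cst a.
Proof.
rewrite tofrac_eq; apply/negP => /eqP /(congr1 (fun p : {poly C} => size p)).
by rewrite size_polyX size_polyC; case: eqP.
Qed.

Lemma scaled_inv_not_cst c : c != 0 -> forall a, cst c / zz != cst a.
Proof.
move=> c0 a; have k0 : cst c != 0 by rewrite fmorph_eq0.
apply: contraNneq (zz_not_cst (c / a)) => /(quot_swap k0 zz0) ->.
by rewrite fmorph_div.
Qed.

(** Expansions at infinity are treated as expansions at 0 of the functions
    composed with [z -> 1 / z]. *)
Definition swap : {rmorphism K -> K} :=
  subst idfun (scaled_inv_not_cst (oner_neq0 C)).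

Lemma swap_cst a : swap (cst a) = cst a. Proof. exact: subst_cst. Qed.
Lemma swap_zz : swap zz = zz^-1.
Proof. by rewrite [LHS]subst_zz rmorph1 div1r. Qed.

Lemma low_coef_eq0 (p q s : {poly C}) n : q.[0] != 0 -> p * q = 'X^n * s ->
  forall i, (i < n)%N -> p`_i = 0.
Proof.
move=> q0 e; elim/ltn_ind => i IH lt_in.
have := congr1 (fun p : {poly C} => p`_i) e; rewrite coefXnM lt_in coefM.
rewrite big_ord_recr /= subnn big1 => [|j _]; last first.
  by rewrite IH ?mul0r // (ltn_trans _ lt_in).
rewrite add0r => /eqP; rewrite mulf_eq0 -horner_coef0 (negbTE q0) orbF.
by move/eqP.
Qed.

(** The Laurent polynomial multiplied by [z^12]. *)
Definition lau_poly (a12 a4 a2 a1 a0 b1 b2 b4 b12 : C) : {poly C} :=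
  a12%:P * 'X^24 + a4%:P * 'X^16 + a2%:P * 'X^14 + a1%:P * 'X^13 + a0%:P * 'X^12 +
  b1%:P * 'X^11 + b2%:P * 'X^10 + b4%:P * 'X^8 + b12%:P.

Definition clau a12 a4 a2 a1 a0 b1 b2 b4 b12 : K :=
  lau zz (cst a12) (cst a4) (cst a2) (cst a1) (cst a0) (cst b1) (cst b2) (cst b4)
    (cst b12).

Lemma lau_polyE (L : fieldType) (z a12 a4 a2 a1 a0 b1 b2 b4 b12 : L) : z != 0 ->
  z ^+ 12 * lau z a12 a4 a2 a1 a0 b1 b2 b4 b12 =
  a12 * z ^+ 24 + a4 * z ^+ 16 + a2 * z ^+ 14 + a1 * z ^+ 13 + a0 * z ^+ 12 +
  b1 * z ^+ 11 + b2 * z ^+ 10 + b4 * z ^+ 8 + b12.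
Proof. by move=> z0; rewrite /lau; field; rewrite z0. Qed.

Lemma clau_poly a12 a4 a2 a1 a0 b1 b2 b4 b12 :
  zz ^+ 12 * clau a12 a4 a2 a1 a0 b1 b2 b4 b12 =
  tofrac (lau_poly a12 a4 a2 a1 a0 b1 b2 b4 b12).
Proof.
have mon a n : tofrac (a%:P * 'X^n) = cst a * zz ^+ n by rewrite tofracM tofracXn.
by rewrite lau_polyE ?zz0 // /lau_poly !tofracD !mon.
Qed.

Lemma clau_low m a12 a4 a2 a1 a0 b1 b2 b4 b12 r : O0 r ->
  clau a12 a4 a2 a1 a0 b1 b2 b4 b12 = zz ^+ m * r ->
  forall i, (i < 12 + m)%N -> (lau_poly a12 a4 a2 a1 a0 b1 b2 b4 b12)`_i = 0.
Proof.
move=> [p [q [q0 ->]]] e; apply: (low_coef_eq0 (q := q) (s := p)) => //.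
have qF : tofrac q != 0.
  by rewrite tofrac_eq0; apply: contraNneq q0 => ->; rewrite rmorph0.
have := clau_poly a12 a4 a2 a1 a0 b1 b2 b4 b12; rewrite e mulrA -exprD mulrA.
move/(congr1 (fun u => u * tofrac q)); rewrite divfK //.
by rewrite -tofracXn -!tofracM => /eqP; rewrite tofrac_eq => /eqP ->.
Qed.

Lemma swap_clau a12 a4 a2 a1 a0 b1 b2 b4 b12 :
  swap (clau a12 a4 a2 a1 a0 b1 b2 b4 b12) =
  clau b12 b4 b2 b1 a0 a1 a2 a4 a12.
Proof.
have h (L : fieldType) (f : {rmorphism L -> L}) (z : L) (u1 u2 u3 u4 u5 u6 u7 u8 u9 : L) :
    z != 0 -> f z = z^-1 -> f (lau z u1 u2 u3 u4 u5 u6 u7 u8 u9) =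
    lau z (f u9) (f u8) (f u7) (f u6) (f u5) (f u4) (f u3) (f u2) (f u1).
  move=> z0 fz.
  have m1 a n : f (a * z ^+ n) = f a / z ^+ n by rewrite rmorphM rmorphXn fz exprVn.
  have m2 a n : f (a / z ^+ n) = f a * z ^+ n.
    by rewrite fmorph_div rmorphXn fz exprVn invrK.
  have m3 a : f (a * z) = f a / z by rewrite rmorphM fz.
  have m4 a : f (a / z) = f a * z by rewrite fmorph_div fz invrK.
  by rewrite /lau !rmorphD !m2 m4 m3 !m1; ring.
by rewrite [LHS](h _ swap _ _ _ _ _ _ _ _ _ _ zz0 swap_zz) !swap_cst.
Qed.

(** Without pole at 0 and infinity a Laurent polynomial is constant, and the
    constant is its value at 0. *)
Lemma clau_eq0 a12 a4 a2 a1 a0 b1 b2 b4 b12 r r' : O0 r -> O0 r' ->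
  clau a12 a4 a2 a1 a0 b1 b2 b4 b12 = zz * r ->
  swap (clau a12 a4 a2 a1 a0 b1 b2 b4 b12) = r' ->
  [/\ a12 = 0, a4 = 0, a2 = 0, a1 = 0 & a0 = 0] /\
  [/\ b1 = 0, b2 = 0, b4 = 0 & b12 = 0].
Proof.
move=> Or Or' e e'; rewrite swap_clau in e'.
have l1 := clau_low (m := 1) Or e.
have l2 := clau_low (m := 0) Or' (etrans e' (esym (mul1r _))).
have cE u12 u4 u2 u1 u0 v1 v2 v4 v12 i :
    (lau_poly u12 u4 u2 u1 u0 v1 v2 v4 v12)`_i =
    u12 *+ (i == 24) + u4 *+ (i == 16) + u2 *+ (i == 14) + u1 *+ (i == 13) +
    u0 *+ (i == 12) + v1 *+ (i == 11) + v2 *+ (i == 10) + v4 *+ (i == 8) +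
    v12 *+ (i == 0%N).
  have mon (c : C) n : (c%:P * 'X^n)`_i = c *+ (i == n).
    by rewrite coefCM coefXn mulr_natr.
  by rewrite /lau_poly !coefD !mon coefC; case: (i == 0%N).
split; split.
- by have := l2 0%N isT; rewrite cE /= !mulr0n !add0r.
- by have := l2 8%N isT; rewrite cE /= !mulr0n !(add0r, addr0).
- by have := l2 10%N isT; rewrite cE /= !mulr0n !(add0r, addr0).
- by have := l2 11%N isT; rewrite cE /= !mulr0n !(add0r, addr0).
- by have := l1 12%N isT; rewrite cE /= !mulr0n !(add0r, addr0).
- by have := l1 11%N isT; rewrite cE /= !mulr0n !(add0r, addr0).
- by have := l1 10%N isT; rewrite cE /= !mulr0n !(add0r, addr0).
- by have := l1 8%N isT; rewrite cE /= !mulr0n !(add0r, addr0).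
- by have := l1 0%N isT; rewrite cE /= !mulr0n !(add0r, addr0).
Qed.

End FunctionField.

Import Num.Theory.

(** * The curve *)

(** The elements [c], [c t], [c / t] are the quotients of [1], [z], [z^-1] by a
    coordinate which does not vanish. Since [t^12 = G - t^-12 + 2], a factor
    [t^12] can be exchanged for smaller powers at the cost of one factor [c G],
    which is regular. So [c^N t^n] is small as soon as [N] is about [n / 12],
    whereas without [G] it would take [N] about [n]. *)
Section Integrality.
Variables (K : fieldType) (O : set K) (t c : K).
Hypotheses (lO : is_local O) (t0 : t != 0).
Let sO := lO.1.

Definition small a := O a /\ ~ unit_in O a.

Lemma small0 : small 0.
Proof. by split; [exact: subring0 | case; rewrite eqxx]. Qed.

Lemma smallD a b : small a -> small b -> small (a + b).
Proof. by move=> [Oa na] [Ob nb]; split; [exact: subringD | exact: nonunitD]. Qed.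

Lemma smallM a b : O a -> small b -> small (a * b).
Proof. by move=> Oa [Ob nb]; split; [exact: (subringM sO) | exact: nonunitM]. Qed.

Lemma smallN a : small a -> small (- a).
Proof.
by move=> [Oa na]; split; [exact: subringN | move=> /(unit_inN sO); rewrite opprK].
Qed.

Lemma smallX a n : (0 < n)%N -> small a -> small (a ^+ n).
Proof.
case: n => // n _ sa; rewrite exprSr; apply: smallM => //.
by apply: (subringX sO); case: sa.
Qed.

Lemma small_sum (I : Type) (r : seq I) (F : I -> K) :
  (forall i, small (F i)) -> small (\sum_(i <- r) F i).
Proof. by move=> h; apply: big_ind => //; [exact: small0 | exact: smallD]. Qed.

Lemma small_root a n : O a -> small (a ^+ n) -> small a.
Proof.
by move=> Oa [_ n_]; split=> // u; apply: n_; exact: unit_inX.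
Qed.

Hypotheses (OG : O (c * (t ^+ 12 + (t ^+ 12)^-1 - 2))).
Hypotheses (sc : small c) (sct : small (c * t)) (sct' : small (c / t)).

Lemma small_powers n N : (n + 144 <= 12 * N)%N ->
  small (c ^+ N * t ^+ n) /\ small (c ^+ N / t ^+ n).
Proof.
pose sm (s : K) m M := small (c ^+ M * s ^+ m).
suff step s : s = t \/ s = t^-1 -> forall n, (forall m M, (m < n)%N ->
    (m + 144 <= 12 * M)%N -> sm t m M /\ sm t^-1 m M) ->
    forall N, (n + 144 <= 12 * N)%N -> sm s n N.
  elim/ltn_ind: n N => n IH N hN; rewrite -exprVn.
  have IH' m M : (m < n)%N -> (m + 144 <= 12 * M)%N -> sm t m M /\ sm t^-1 m M.
    by move=> mn hM; rewrite /sm exprVn; exact: IH.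
  by split; apply: step IH' _ hN; [left|right].
move=> hs {}n IH {}N hN.
have s0 : s != 0 by case: hs => ->; rewrite ?invr_eq0.
have scs : small (c * s) by case: hs => ->.
have sG : O (c * (s ^+ 12 + (s ^+ 12)^-1 - 2)).
  case: hs => -> //; rewrite exprVn invrK.
  by have -> : (t ^+ 12)^-1 + t ^+ 12 - 2 = t ^+ 12 + (t ^+ 12)^-1 - 2 by ring.
have IHs m M : (m < n)%N -> (m + 144 <= 12 * M)%N -> sm s m M /\ sm s^-1 m M.
  by move=> mn hM; have [h1 h2] := IH m M mn hM; case: hs => ->; rewrite ?invrK.
have [n12|n12] := leqP n 12.
  (* Each of the [n] factors [s] takes one factor [c], and one more is left over:
     this is what the margin 144 is for. *)
  have nN : (n < N)%N by lia.
  have -> : sm s n N = small ((c * s) ^+ n * c ^+ (N - n)).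
    by congr small; rewrite exprMn mulrAC -exprD subnKC // ltnW.
  apply: smallM; last by apply: smallX => //; rewrite subn_gt0.
  by apply: (subringX sO); case: scs.
have [N' NE] : exists N', N = N'.+1 by exists N.-1; lia.
have [m nE] : exists m, n = (m + 12)%N by exists (n - 12)%N; lia.
have [m1 mn] : (0 < m)%N /\ (m < n)%N by lia.
have [hN' hNN] : (m + 144 <= 12 * N')%N /\ (m + 144 <= 12 * N)%N by lia.
have [h1 _] := IHs _ _ mn hN'; have [h2 _] := IHs _ _ mn hNN.
have h3 : small (c ^+ N * (s ^+ m / s ^+ 12)).
  have [m12|m12] := leqP 12 m.
    have -> : s ^+ m / s ^+ 12 = s ^+ (m - 12).
      by rewrite -[in LHS](subnK m12) exprD mulfK // expf_neq0.
    by apply: (IHs _ _ _ _).1; lia.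
  have -> : s ^+ m / s ^+ 12 = s^-1 ^+ (12 - m).
    have -> : s ^+ 12 = s ^+ m * s ^+ (12 - m) by rewrite -exprD subnKC // ltnW.
    by rewrite invfM mulrA divff ?expf_neq0 // mul1r exprVn.
  by apply: (IHs _ _ _ _).2; lia.
have -> : sm s n N = small (c ^+ N' * s ^+ m * (c * (s ^+ 12 + (s ^+ 12)^-1 - 2))
    - c ^+ N * (s ^+ m / s ^+ 12) + 2 * (c ^+ N * s ^+ m)).
  have h (u v x y : K) : v != 0 -> (u * y) * (x * v) =
      u * x * (y * (v + v^-1 - 2)) - u * y * (x / v) + 2 * (u * y * x).
    by move=> v0; field; rewrite v0.
  by congr small; rewrite nE NE exprD exprSr; apply: h; rewrite expf_neq0.
apply: smallD; last first.
  by apply: smallM => //; exact: (subring_nat sO).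
apply: smallD; last exact: smallN.
by rewrite mulrC; exact: smallM.
Qed.

End Integrality.

Section LaurentIdentities.
Variables (L : fieldType) (z : L).

Lemma lau_G : lau z 1 0 0 0 (- 2) 0 0 0 1 = z ^+ 12 + (z ^+ 12)^-1 - 2.
Proof. by rewrite /lau !mul0r !addr0 !mul1r addrAC. Qed.

Lemma lau_F b b' : lau z 0 b 1 0 0 0 (- 1) b' 0 =
  b * z ^+ 4 + b' / z ^+ 4 + z ^+ 2 - (z ^+ 2)^-1.
Proof.
by rewrite /lau !mul0r !addr0 !add0r mul1r mulN1r; ring.
Qed.

Lemma F_at_oo b b' : z != 0 ->
  b = (z^-1) ^+ 3 * ((b * z ^+ 4 + b' / z ^+ 4 + z ^+ 2 - (z ^+ 2)^-1) / z) -
      (b' * (z^-1) ^+ 7 + z^-1 - (z^-1) ^+ 5) * z^-1.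
Proof. by move=> z0; field; rewrite z0. Qed.

Lemma F_at_0 b b' : z != 0 ->
  b' = z ^+ 3 * ((b * z ^+ 4 + b' / z ^+ 4 + z ^+ 2 - (z ^+ 2)^-1) / z^-1) -
      (b * z ^+ 7 + z ^+ 5 - z) * z.
Proof. by move=> z0; rewrite invrK; field; rewrite z0. Qed.

End LaurentIdentities.

Section Curve.
Variable C : numClosedFieldType.
Notation K := {fraction {poly C}}.
Notation z := (zz C).
Notation cst := (cst C).

(** The coefficients [1 + i] and [1 - i] of [FF] are conjugate, which makes
    [FF] invariant under conjugation followed by [z -> i / z]. On the other
    hand [1 - i] is neither [1 + i] nor its opposite, which excludes the
    involutions [z -> c z]. *)
Definition bb : C := 1 + 'i.
Definition bb' : C := 1 - 'i.

Definition GG : K := clau 1 0 0 0 (- 2) 0 0 0 1.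
Definition FF : K := clau 0 bb 1 0 0 0 (- 1) bb' 0.
(** The values are 0 where [z^12 = 1] and 1 where [z^12 = - 1], with poles at 0
    and infinity. *)
Definition gg : K := cst (- 4^-1) * GG.

Lemma GGE : GG = z ^+ 12 + (z ^+ 12)^-1 - 2.
Proof. by rewrite -lau_G /GG /clau !rmorph0 rmorph1 rmorphN rmorph_nat. Qed.

Lemma FFE : FF = cst bb * z ^+ 4 + cst bb' / z ^+ 4 + z ^+ 2 - (z ^+ 2)^-1.
Proof. by rewrite -lau_F /FF /clau !rmorph0 rmorph1 rmorphN rmorph1. Qed.

Lemma bb0 : bb != 0.
Proof.
rewrite /bb addrC addr_eq0; apply/eqP => e; have := sqrCi C.
by rewrite e sqrrN expr1n => /eqP; rewrite -subr_eq0 opprK -mulr2n pnatr_eq0.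
Qed.

Lemma bb_conj : bb^* = bb'.
Proof. by rewrite /bb rmorphD rmorph1 /= conjCi. Qed.

Lemma bb'_conj : bb'^* = bb.
Proof. by rewrite -bb_conj conjCK. Qed.

Lemma bb'0 : bb' != 0.
Proof. by rewrite -bb_conj conjC_eq0 bb0. Qed.

Lemma bb'_neq : bb' != bb.
Proof.
rewrite /bb /bb' (inj_eq (addrI 1)) eq_sym -subr_eq0 opprK -mulr2n mulrn_eq0.
exact: neq0Ci.
Qed.

Lemma bb'_neqN : bb' != - bb.
Proof.
rewrite /bb /bb' opprD (inj_eq (addIr _)) -subr_eq0 opprK -mulr2n mulrn_eq0.
exact: oner_neq0.
Qed.

Lemma clau_neq0 a12 a4 a2 a1 a0 b1 b2 b4 b12 : a12 != 0 \/ a2 != 0 ->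
  clau a12 a4 a2 a1 a0 b1 b2 b4 b12 != 0 :> K.
Proof.
move=> h; apply/eqP => e0; have O00 := subring0 (O0_sub C).
have := clau_eq0 O00 O00 (etrans e0 (esym (mulr0 _))).
by rewrite e0 rmorph0 => /(_ erefl)[[a12_0 _ a2_0 _ _] _];
  case: h; rewrite ?a12_0 ?a2_0 eqxx.
Qed.

Lemma GG0 : GG != 0. Proof. by apply: clau_neq0; left; exact: oner_neq0. Qed.
Lemma FF0 : FF != 0. Proof. by apply: clau_neq0; right; exact: oner_neq0. Qed.

Lemma four0 : (4 : C) != 0. Proof. by rewrite pnatr_eq0. Qed.

Lemma gg0 : gg != 0.
Proof.
apply: mulf_neq0; last exact: GG0.
by rewrite fmorph_eq0 oppr_eq0 invr_eq0 four0.
Qed.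

Definition cf (i : 'I_5) : K := nth 0 [:: gg; 1; z; z^-1; FF] i.

Lemma cf0 i : cf i != 0.
Proof.
case: i => [[|[|[|[|[|n]]]]] hi] //; rewrite /cf /=.
- exact: gg0.
- exact: oner_neq0.
- exact: zz0.
- by rewrite invr_eq0; exact: zz0.
- exact: FF0.
Qed.

Definition i0 : 'I_5 := @Ordinal 5 0 isT.
Definition i1 : 'I_5 := @Ordinal 5 1 isT.
Definition i2 : 'I_5 := @Ordinal 5 2 isT.
Definition i3 : 'I_5 := @Ordinal 5 3 isT.
Definition i4 : 'I_5 := @Ordinal 5 4 isT.

Definition XM : katlas C := proj_model cst cf0.
Definition X : kscheme C := atlas_kscheme XM.

Implicit Types x : point XM.

Lemma lring_cst x c : lring x (cst c).
Proof. exact: (kin_lring (M := XM)). Qed.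

Lemma lring_cf x i j : in_chart (M := XM) i x -> lring x (cf j / cf i).
Proof. by apply; exact: gen_algX. Qed.

Lemma unit_cst x c : c != 0 -> unit_in (lring x) (cst c).
Proof.
move=> c0; split; rewrite ?fmorph_eq0 //; first exact: lring_cst.
by rewrite -fmorphV; exact: lring_cst.
Qed.

(** Where [z^-1] is regular and vanishes, [F / z] has a pole of order 3 since
    the coefficient of [z^4] in [F] is not zero. So [F / z] and [z^-1] can only
    be both regular where [z^-1] is invertible. *)
Lemma chart2_sub x : in_chart (M := XM) i2 x -> in_chart (M := XM) i1 x.
Proof.
move=> h; apply: (in_chart_of_unit h).
have -> : @trans XM i2 i1 = z^-1 by rewrite /= /cf /= div1r.
have O1 : lring x z^-1 by have := lring_cf i1 h; rewrite /cf /= div1r.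
have OF : lring x (FF / z) by exact: (lring_cf i4 h).
have lO := lring_local x; have sO := lO.1; have OX n := subringX sO n O1.
apply: contrapT => nu; have sz : small (lring x) z^-1 by [].
have [_] : small (lring x) (cst bb); last by apply; exact: unit_cst bb0.
rewrite (F_at_oo (cst bb) (cst bb') (zz0 C)) -FFE; apply: (smallD lO).
  by rewrite mulrC; apply: (smallM lO) => //; exact: (smallX lO).
apply: (smallN lO); apply: (smallM lO) => //.
apply: (subringB sO); last exact: OX.
apply: (subringD sO) => //; apply: (subringM sO); last exact: OX.
exact: lring_cst.
Qed.

Lemma chart3_sub x : in_chart (M := XM) i3 x -> in_chart (M := XM) i1 x.
Proof.
move=> h; apply: (in_chart_of_unit h).
have -> : @trans XM i3 i1 = z by rewrite /= /cf /= div1r invrK.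
have O1 : lring x z by have := lring_cf i1 h; rewrite /cf /= div1r invrK.
have OF : lring x (FF / z^-1) by exact: (lring_cf i4 h).
have lO := lring_local x; have sO := lO.1; have OX n := subringX sO n O1.
apply: contrapT => nu; have sz : small (lring x) z by [].
have [_] : small (lring x) (cst bb'); last by apply; exact: unit_cst bb'0.
rewrite (F_at_0 (cst bb) (cst bb') (zz0 C)) -FFE; apply: (smallD lO).
  by rewrite mulrC; apply: (smallM lO) => //; exact: (smallX lO).
apply: (smallN lO); apply: (smallM lO) => //.
apply: (subringB sO) => //; apply: (subringD sO); last exact: OX.
apply: (subringM sO); last exact: OX.
exact: lring_cst.
Qed.

Lemma off_chart1 x i : in_chart (M := XM) i x -> ~ in_chart (M := XM) i1 x ->
  [/\ small (lring x) (cf i1 / cf i), small (lring x) (cf i2 / cf i) &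
      small (lring x) (cf i3 / cf i)].
Proof.
move=> h n; split; (split; first exact: lring_cf) => u; apply: n.
- exact: (in_chart_of_unit h u).
- exact/chart2_sub/(in_chart_of_unit h u).
- exact/chart3_sub/(in_chart_of_unit h u).
Qed.

Lemma tofrac_poly (p : {poly C}) :
  tofrac p = \sum_(i < size p) cst p`_i * z ^+ i.
Proof.
rewrite -{1}[p]coefK poly_def (raddf_sum (@tofrac {poly C})); apply: eq_bigr => i _.
by rewrite -mul_polyC [LHS]tofracM tofracXn.
Qed.

Lemma FF_pow : exists p : {poly C}, (size p <= 145)%N /\
  FF ^+ 18 * z ^+ 72 = tofrac p.
Proof.
pose q : {poly C} := bb%:P * 'X^8 + bb'%:P + 'X^6 - 'X^2.
exists (q ^+ 18); split.
  apply: (leq_trans (size_poly_exp_leq _ _)).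
  have sq : (size q <= 9)%N.
    rewrite /q (leq_trans (size_polyD _ _)) // geq_max size_polyN size_polyXn andbT.
    rewrite (leq_trans (size_polyD _ _)) // geq_max size_polyXn andbT.
    rewrite (leq_trans (size_polyD _ _)) // geq_max.
    rewrite (leq_trans (size_polyC_leq1 _)) // andbT.
    by rewrite mul_polyC (leq_trans (size_scale_leq _ _)) // size_polyXn.
  by lia.
have gen (L : fieldType) (u b b' : L) : u != 0 ->
    (b * u ^+ 4 + b' / u ^+ 4 + u ^+ 2 - (u ^+ 2)^-1) * u ^+ 4 =
    b * u ^+ 8 + b' + u ^+ 6 - u ^+ 2 by move=> u0; field; rewrite u0.
have e : FF * z ^+ 4 = tofrac q.
  rewrite FFE (gen _ _ _ _ (zz0 C)) /q tofracB !tofracD.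
  have mon a n : tofrac (a%:P * 'X^n) = cst a * z ^+ n by rewrite tofracM tofracXn.
  by rewrite mon !tofracXn.
by rewrite tofracXn -e exprMn -exprM.
Qed.

(** The powers [z^j] occurring in [F^18] have [|j| <= 72], and [72 + 144 = 12 *
    18] meets the bound of [small_powers]; this determines the exponent 18. *)
Lemma small_FF x i : in_chart (M := XM) i x -> ~ in_chart (M := XM) i1 x ->
  small (lring x) ((FF / cf i) ^+ 18).
Proof.
move=> h n; have [s1 s2 s3] := off_chart1 h n; have lO := lring_local x.
have sO := lO.1; set c := cf i1 / cf i in s1.
have s2' : small (lring x) (c * z) by rewrite /c mulrAC mul1r.
have s3' : small (lring x) (c / z) by rewrite /c mulrAC mul1r.
have OG : lring x (c * (z ^+ 12 + (z ^+ 12)^-1 - 2)).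
  rewrite -GGE; have := lring_cf i0 h; rewrite /c /cf /= /gg => hg.
  have -> : 1 / nth 0 [:: cst (- 4^-1) * GG; 1; z; z^-1; FF] i * GG =
     cst (- 4) * (cst (- 4^-1) * GG / nth 0 [:: cst (- 4^-1) * GG; 1; z; z^-1; FF] i).
    rewrite [RHS]mulrA [cst (- 4) * _]mulrA -rmorphM mulrNN divff ?four0 // rmorph1.
    by rewrite mul1r mul1r mulrC.
  by apply: (subringM sO) => //; exact: lring_cst.
have pw := small_powers lO (zz0 C) OG s1 s2' s3'.
have [p [sp ep]] := FF_pow; have z72 : z ^+ 72 != 0 by rewrite expf_neq0 ?zz0.
have -> : (FF / cf i) ^+ 18 = \sum_(j < size p) cst p`_j * (c ^+ 18 * (z ^+ j / z ^+ 72)).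
  rewrite (_ : FF / cf i = c * FF); last by rewrite /c mulrAC mul1r.
  rewrite exprMn; have -> : FF ^+ 18 = tofrac p / z ^+ 72 by rewrite -ep mulfK.
  rewrite tofrac_poly mulr_suml mulr_sumr; apply: eq_bigr => j _.
  have comm (L : fieldType) (u a b d : L) : u * (a * b / d) = a * (u * (b / d)).
    by ring.
  exact: comm.
apply: small_sum => // j; apply: (smallM lO); first exact: lring_cst.
have j145 : (j < 145)%N := leq_trans (ltn_ord j) sp.
have [j72|j72] := leqP 72 j.
  have -> : z ^+ j / z ^+ 72 = z ^+ (j - 72).
    by rewrite -{1}(subnK j72) exprD mulfK.
  by apply: (pw _ _ _).1; lia.
have -> : z ^+ j / z ^+ 72 = (z ^+ (72 - j))^-1.
  have hv (L : fieldType) (v : L) : v != 0 -> v ^+ j / v ^+ 72 = (v ^+ (72 - j))^-1.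
    move=> v0; rewrite -{1}(subnKC (ltnW j72)) exprD invfM mulrA divff ?mul1r //.
    exact: expf_neq0.
  exact: hv (zz0 C).
by apply: (pw _ _ _).2; lia.
Qed.

Lemma chart4_sub x : in_chart (M := XM) i4 x -> in_chart (M := XM) i1 x.
Proof.
move=> h; apply: contrapT => n; have [_] := small_FF h n.
rewrite divff ?FF0 // expr1n; apply; exact: (unit_in1 (lring_subring x)).
Qed.

Lemma chart0_or_1 x : in_chart (M := XM) i1 x \/
  (in_chart (M := XM) i0 x /\ forall j, j != i0 -> small (lring x) (cf j / cf i0)).
Proof.
have [h1|n1] := pselect (in_chart (M := XM) i1 x); [by left | right].
have [i hi] := point_chart x.
have h0 : in_chart (M := XM) i0 x.
  have to_i (m : 'I_5) : val i = val m -> in_chart (M := XM) m x.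
    by move=> /val_inj <-.
  case: i hi to_i => [[|[|[|[|[|m]]]]] hm] // hi to_i; first exact: to_i.
  - by case: n1; exact: to_i.
  - by case: n1; apply: chart2_sub; exact: to_i.
  - by case: n1; apply: chart3_sub; exact: to_i.
  - by case: n1; apply: chart4_sub; exact: to_i.
split=> // j j0; have [s1 s2 s3] := off_chart1 h0 n1.
have s4 : small (lring x) (cf i4 / cf i0).
  apply: (small_root (lring_local x) (n := 18)); first exact: lring_cf.
  exact: small_FF.
have to_j (m : 'I_5) : val j = val m -> small (lring x) (cf m / cf i0) ->
    small (lring x) (cf j / cf i0) by move=> /val_inj ->.
by case: j j0 to_j => [[|[|[|[|[|m]]]]] hm] // _ to_j;
  first [exact: (to_j i1 erefl s1) | exact: (to_j i2 erefl s2) |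
         exact: (to_j i3 erefl s3) | exact: (to_j i4 erefl s4)].
Qed.

End Curve.

Section MarkedPoint.
Variable C : numClosedFieldType.
Notation K := {fraction {poly C}}.
Notation z := (zz C).
Notation cst := (cst C).
Notation GG := (GG C).
Notation gg := (gg C).
Notation FF := (FF C).
Notation cf := (@cf C).
Notation XM := (XM C).
Notation X := (X C).
Notation at0 := (at0 C).
Notation O0 := (@O0 C).
Implicit Types x y : point XM.

Let sO := O0_sub C.

(** ** The point where 0 and infinity are glued *)

(** The unit factor of [1 / G], which has order 12 at 0. *)
Definition ww : K := (z ^+ 12 * GG)^-1.

Lemma GGV : GG^-1 = z ^+ 12 * ww.
Proof.
have h (L : fieldType) (u v : L) : u != 0 -> v^-1 = u * (u * v)^-1.
  by move=> u0; rewrite invfM mulrA divff ?mul1r.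
by apply: h; rewrite expf_neq0 ?zz0.
Qed.

Lemma O0_ww : O0 ww.
Proof.
have e : z ^+ 12 * GG = tofrac (lau_poly 1 0 0 0 (- 2) 0 0 0 1).
  exact: clau_poly.
rewrite /ww e; have [d v] := frac_phom_tofrac (horner_eval (0 : C))
  (lau_poly 1 0 0 0 (- 2) 0 0 0 1).
apply: (dom_inv (p := at0)) => //.
have mon (c : C) n : (c%:P * 'X^(n.+1)).[0] = 0.
  by rewrite hornerM hornerXn expr0n mulr0.
by rewrite v /= /horner_eval /lau_poly !hornerD !mon hornerC !add0r oner_neq0.
Qed.

Lemma O0_z4 (i : 'I_5) : i != i0 -> O0 (z ^+ 4 * cf i).
Proof.
have OX n : O0 (z ^+ n) by apply: (subringX sO); exact: O0_zz.
case: i => [[|[|[|[|[|m]]]]] hm] // _; rewrite /cf /=.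
- by rewrite mulr1; exact: OX.
- by rewrite -exprSr; exact: OX.
- by rewrite exprSr mulfK ?zz0 //; exact: OX.
- have gen (L : fieldType) (u b b' : L) : u != 0 ->
    u ^+ 4 * (b * u ^+ 4 + b' / u ^+ 4 + u ^+ 2 - (u ^+ 2)^-1) =
    b * u ^+ 8 + b' + u ^+ 6 - u ^+ 2 by move=> u0; field; rewrite u0.
  rewrite FFE (gen _ _ _ _ (zz0 C)); apply: (subringB sO); last exact: OX.
  apply: (subringD sO); last exact: OX.
  apply: (subringD sO); last exact: O0_cst.
  by apply: (subringM sO); [exact: O0_cst | exact: OX].
Qed.

Lemma ggV : gg^-1 = z ^+ 12 * (cst (- 4) * ww).
Proof.
rewrite /gg invfM GGV -fmorphV invrN invrK.
have h (L : fieldType) (a b c : L) : a * (b * c) = b * (a * c) by ring.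
exact: h.
Qed.

(** At 0 the pole of [g] has order 12, those of the other coordinates have
    order at most 4. *)
Lemma cf_small (i : 'I_5) : i != i0 -> exists2 r, O0 r & cf i / gg = z * r.
Proof.
move=> hi; exists (z ^+ 7 * (cst (- 4) * ww) * (z ^+ 4 * cf i)).
  apply: (subringM sO); last exact: O0_z4.
  apply: (subringM sO); first by apply: (subringX sO); exact: O0_zz.
  by apply: (subringM sO); [exact: O0_cst | exact: O0_ww].
rewrite ggV; have h (L : fieldType) (a b c : L) :
    c * (a ^+ 12 * b) = a * (a ^+ 7 * b * (a ^+ 4 * c)) by ring.
exact: h.
Qed.

Lemma at0_zM r : O0 r -> O0 (z * r) /\ at0 (z * r) = 0.
Proof.
move=> Or; split; first by apply: (subringM sO) => //; exact: O0_zz.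
by rewrite appM ?at0_zz ?mul0r //; exact: O0_zz.
Qed.

Lemma chart0_O0 a : gen_alg cst cf i0 a -> O0 a.
Proof.
move: a; apply: (gen_alg_min (S := O0)).
- exact: O0_cst.
- by move=> s t; exact: (subringD sO).
- exact: (subringM sO).
- move=> j; have [->|hj] := eqVneq j i0.
    by rewrite divff ?cf0 //; exact: (subring1 sO).
  by have [r Or ->] := cf_small hj; case: (at0_zM Or).
Qed.

(** In the chart of [g] the other coordinates vanish at 0 and at infinity, so
    that these two points of the projective line have the same image: the
    center of the evaluation at 0. *)
Definition glue : point XM := @kernel_point XM C at0 i0 chart0_O0.

Lemma glue_chart0 : in_chart (M := XM) i0 glue.
Proof. exact: prime_point_chart. Qed.

Lemma glue_unit a : gen_alg cst cf i0 a -> unit_in (lring glue) a <-> at0 a != 0.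
Proof. exact: (@kernel_point_unit XM C at0 i0 chart0_O0). Qed.

Lemma glue_frac h : lring glue h -> exists a b,
  [/\ gen_alg cst cf i0 a, gen_alg cst cf i0 b, at0 b != 0 & h = a / b].
Proof. exact: (@kernel_point_frac XM C at0 i0 chart0_O0). Qed.

Lemma glue_not_chart1 : ~ in_chart (M := XM) i1 glue.
Proof.
move=> h; have := @trans_unit XM i0 i1 glue glue_chart0 h.
have Aa : gen_alg cst cf i0 (cf i1 / cf i0) by exact: gen_algX.
rewrite (glue_unit Aa); have [r Or e] := @cf_small i1 isT.
by rewrite -[cf i0]/gg e (at0_zM Or).2 eqxx.
Qed.

Lemma glue_rational : rational_point (glue : X).
Proof.
move=> U s Us; have [c nc] := @kernel_point_residue C XM at0 i0 chart0_O0 (@at0_cst C)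
  _ (value_in (s : section _) Us).
exists c; apply/(vanishes_atP (s - const U c) Us).
by rewrite valueB (value_const _ Us).
Qed.

(** All coordinates but the first vanish at such a point, and this determines
    the value of every function of the chart. *)
Lemma off_torus x : ~ in_chart (M := XM) i1 x -> x = glue.
Proof.
move=> n; have [//|[h0 sm]] := chart0_or_1 x.
have lx := lring_local x; have sx := lx.1.
have val a : gen_alg cst cf i0 a -> exists c,
    [/\ O0 a, at0 a = c & small (lring x) (a - cst c)].
  move: a; apply: (gen_alg_min (S := [set a | exists c,
    [/\ O0 a, at0 a = c & small (lring x) (a - cst c)]])).
  - move=> c; exists c; rewrite subrr; split; first exact: O0_cst.
      exact: at0_cst.
    exact: small0.
  - move=> a b [c [Oa ac sa]] [d [Ob bd sb]]; exists (c + d); split.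
    + exact: (subringD sO).
    + by rewrite appD // ac bd.
    + have -> : a + b - cst (c + d) = (a - cst c) + (b - cst d).
        by rewrite rmorphD opprD addrACA.
      exact: smallD.
  - move=> a b [c [Oa ac sa]] [d [Ob bd sb]]; exists (c * d); split.
    + exact: (subringM sO).
    + by rewrite appM // ac bd.
    + have h (L : fieldType) (u v w t : L) :
          u * v - w * t = u * (v - t) + t * (u - w) by ring.
      rewrite rmorphM h; apply: (smallD lx); apply: (smallM lx) => //.
        rewrite -(subrK (cst c) a); apply: (subringD sx); first by case: sa.
        exact: lring_cst.
      exact: lring_cst.
  - move=> j; have [->|hj] := eqVneq j i0.
      exists 1; rewrite divff ?cf0 // app1 rmorph1 subrr; split=> //.
        exact: (subring1 sO).
      exact: small0.
    exists 0; have [r Or e] := cf_small hj; rewrite rmorph0 subr0; split.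
    + by rewrite -[cf i0]/gg e; case: (at0_zM Or).
    + by rewrite -[cf i0]/gg e; case: (at0_zM Or).
    + exact: sm.
apply: (point_eq_chart h0 glue_chart0) => a Aa; rewrite (glue_unit Aa).
have [c [Oa -> sc]] := val a Aa; split=> [u|c0].
  by apply/eqP => c0; move: sc; rewrite c0 rmorph0 subr0 => -[].
apply: contrapT => na; have [_] : small (lring x) (cst c).
  have -> : cst c = a - (a - cst c) by rewrite opprB addrC subrK.
  apply: (smallD lx); last exact: smallN.
  by split=> //; exact: h0.
by apply; exact: unit_cst.
Qed.

(** ** The torus *)

(** Here [g] and [F] are polynomials in [z] and [z^-1]. *)
Lemma chart1_min (S : set K) : (forall c, S (cst c)) ->
  (forall s t, S s -> S t -> S (s + t)) -> (forall s t, S s -> S t -> S (s * t)) ->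
  S z -> S z^-1 -> gen_alg cst cf i1 `<=` S.
Proof.
move=> hC hD hM Sz Szi; have hX s n : S s -> S (s ^+ n).
  move=> Ss; elim: n => [|n IH]; first by rewrite expr0 -(rmorph1 cst).
  by rewrite exprS; exact: hM.
have hN s : S s -> S (- s).
  by move=> Ss; rewrite -mulN1r -(rmorph1 cst) -rmorphN; exact: hM.
have SG : S GG.
  rewrite GGE; apply: (hD); first by apply: (hD); [|rewrite -exprVn]; exact: hX.
  by rewrite -(rmorph_nat cst); exact/hN/hC.
have SF : S FF.
  rewrite FFE; apply: (hD); last by apply: hN; rewrite -exprVn; exact: hX.
  apply: (hD); last exact: hX.
  by apply: (hD); apply: hM => //; rewrite -?exprVn; exact: hX.
apply: gen_alg_min => // j; rewrite [cf i1]/(1 : K) divr1.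
case: j => [[|[|[|[|[|m]]]]] hm] //; rewrite /cf //=.
- exact: hM.
- by rewrite -(rmorph1 cst).
Qed.

Lemma chart1_z : gen_alg cst cf i1 z.
Proof. by have := gen_algX cst cf i1 i2; rewrite /cf /= divr1. Qed.

Lemma chart1_zV : gen_alg cst cf i1 z^-1.
Proof. by have := gen_algX cst cf i1 i3; rewrite /cf /= divr1. Qed.

Lemma torus_z x : in_chart (M := XM) i1 x -> unit_in (lring x) z.
Proof.
by move=> h; split; [exact: zz0 | exact: (h _ chart1_z) | exact: (h _ chart1_zV)].
Qed.

Lemma chart1_laurent a : gen_alg cst cf i1 a -> exists p m, a = tofrac p / z ^+ m.
Proof.
move: a; apply: (chart1_min (S := [set a | exists p m, a = tofrac p / z ^+ m])).
- by move=> c; exists c%:P, 0%N; rewrite expr0 divr1.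
- move=> _ _ [p [m ->]] [q [n ->]]; exists (p * 'X^n + q * 'X^m), (m + n)%N.
  by rewrite tofracD !tofracM !tofracXn exprD addf_div ?expf_neq0 ?zz0.
- move=> _ _ [p [m ->]] [q [n ->]]; exists (p * q), (m + n)%N.
  by rewrite tofracM exprD mulf_div.
- by exists 'X, 0%N; rewrite expr0 divr1.
- by exists 1, 1%N; rewrite tofrac1 div1r expr1.
Qed.

Lemma chart1_poly p : gen_alg cst cf i1 (tofrac p).
Proof.
rewrite tofrac_poly; apply: (subring_sum (@chart_subring XM i1)) => i.
apply: gen_algM; first exact: gen_algC.
by apply: (subringX (@chart_subring XM i1)); exact: chart1_z.
Qed.

Section TorusPoint.
Variable a : C.
Hypothesis a0 : a != 0.

Definition ata : phom K C := frac_phom (horner_eval a).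

Lemma ata_poly p : dom ata (tofrac p) /\ ata (tofrac p) = p.[a].
Proof. exact: (frac_phom_tofrac (horner_eval a) p). Qed.

Lemma ata_cst c : ata (cst c) = c.
Proof. by rewrite (ata_poly _).2 hornerC. Qed.

Lemma ata_chart1 s : gen_alg cst cf i1 s -> dom ata s.
Proof.
have sd := dom_subring ata; move: s; apply: chart1_min.
- by move=> c; case: (ata_poly c%:P).
- by move=> s t; exact: (subringD sd).
- exact: (subringM sd).
- by case: (ata_poly 'X).
- by have [d e] := ata_poly 'X; apply: dom_inv => //; rewrite e hornerX.
Qed.

Lemma chart1_za : gen_alg cst cf i1 (z - cst a).
Proof. exact: (subringB (@chart_subring XM i1) chart1_z (gen_algC _ _ _ _)). Qed.

Lemma ata_za : ata (z - cst a) = 0.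
Proof.
rewrite appB; [|by case: (ata_poly 'X)|by case: (ata_poly a%:P)].
by rewrite (ata_poly 'X).2 ata_cst hornerX subrr.
Qed.

(** Division by [z - a] of Laurent polynomials. *)
Lemma chart1_div s : gen_alg cst cf i1 s -> exists c t,
  gen_alg cst cf i1 t /\ s = cst c + (z - cst a) * t.
Proof.
have sA := @chart_subring XM i1.
move: s; apply: (chart1_min (S := [set s | exists c t,
  gen_alg cst cf i1 t /\ s = cst c + (z - cst a) * t])).
- by move=> c; exists c, 0; rewrite mulr0 addr0; split=> //; exact: (subring0 sA).
- move=> _ _ [c [t [At ->]]] [d [u [Au ->]]]; exists (c + d), (t + u).
  split; first exact: (subringD sA).
  by rewrite rmorphD mulrDr addrACA.
- move=> _ _ [c [t [At ->]]] [d [u [Au ->]]].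
  exists (c * d), (cst c * u + cst d * t + (z - cst a) * (t * u)).
  split.
    apply: (subringD sA); last first.
      apply: (subringM sA); last exact: (subringM sA).
      by apply: (subringB sA); [exact: chart1_z | exact: gen_algC].
    by apply: (subringD sA); apply: (subringM sA) => //; exact: gen_algC.
  have h (L : fieldType) (v x y e f : L) : (e + v * x) * (f + v * y) =
    e * f + v * (e * y + f * x + v * (x * y)) by ring.
  by rewrite h rmorphM.
- exists a, 1; split; first exact: (subring1 sA).
  by rewrite mulr1 addrC subrK.
- exists a^-1, (- cst a^-1 * z^-1); split.
    apply: (subringM sA); last exact: chart1_zV.
    by apply: (subringN sA); exact: gen_algC.
  have h (L : fieldType) (v b : L) : v != 0 -> b != 0 ->
    v^-1 = b^-1 + (v - b) * (- b^-1 * v^-1) by move=> v0 b0; field; rewrite v0 b0.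
  by rewrite fmorphV; apply: h; rewrite ?zz0 // fmorph_eq0.
Qed.

Lemma ata_div s : gen_alg cst cf i1 s -> exists2 t, gen_alg cst cf i1 t &
  s = cst (ata s) + (z - cst a) * t.
Proof.
move=> As; have [c [t [At es]]] := chart1_div As; exists t => //.
suff -> : ata s = c by [].
have At' := ata_chart1 At; have Az := ata_chart1 chart1_za.
have dc : dom ata (cst c) by case: (ata_poly c%:P).
by rewrite es appD ?appM ?ata_za ?mul0r ?addr0 ?ata_cst //;
  exact: (subringM (dom_subring ata)).
Qed.

Definition torus_pt : point XM := @kernel_point XM C ata i1 ata_chart1.

Lemma torus_pt_chart : in_chart (M := XM) i1 torus_pt.
Proof. exact: prime_point_chart. Qed.

Lemma torus_pt_unit s : gen_alg cst cf i1 s -> unit_in (lring torus_pt) s <-> ata s != 0.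
Proof. exact: (@kernel_point_unit XM C ata i1 ata_chart1). Qed.

Lemma torus_pt_frac s : lring torus_pt s -> exists u v,
  [/\ gen_alg cst cf i1 u, gen_alg cst cf i1 v, ata v != 0 & s = u / v].
Proof. exact: (@kernel_point_frac XM C ata i1 ata_chart1). Qed.

Lemma torus_pt_residue s : lring torus_pt s -> exists c, ~ unit_in (lring torus_pt) (s - cst c).
Proof. exact: (@kernel_point_residue C XM ata i1 ata_chart1 ata_cst). Qed.

Lemma torus_pt_small : small (lring torus_pt) (z - cst a).
Proof.
split; first exact: (torus_pt_chart chart1_za).
by rewrite (torus_pt_unit chart1_za) ata_za eqxx.
Qed.

(** Modulo [z - a] every Laurent polynomial is constant. *)
Lemma torus_pt_uniq x : in_chart (M := XM) i1 x -> small (lring x) (z - cst a) -> x = torus_pt.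
Proof.
move=> hx sx; have sA := @chart_subring XM i1.
have val y s c t : in_chart (M := XM) i1 y -> small (lring y) (z - cst a) ->
    gen_alg cst cf i1 t -> s = cst c + (z - cst a) * t ->
    unit_in (lring y) s <-> c != 0.
  move=> hy sy At ->; have ly := lring_local y.
  have st : small (lring y) ((z - cst a) * t).
    by rewrite mulrC; apply: (smallM ly) => //; exact: hy.
  split=> [u|c0].
    by apply/eqP => c0; rewrite c0 rmorph0 add0r in u; case: st.
  by apply: (unit_inD ly); [exact: unit_cst | case: st | case: st].
apply: (point_eq_chart hx torus_pt_chart) => s /chart1_div[c [t [At es]]].
by rewrite (val x s c t) // (val torus_pt s c t) //; [exact: torus_pt_chart | exact: torus_pt_small].
Qed.

(** Near a point of the torus the function [z - a] cuts out the given point,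
    and near the marked point it is avoided thanks to [1 - g(a) / g]. *)
Lemma torus_pt_closed : closed [set torus_pt].
Proof.
rewrite -openC atlas_openE => x /= xTP.
have [hx|nx] := pselect (in_chart (M := XM) i1 x).
  exists i1, (z - cst a); split.
  - by apply: (subringB (@chart_subring XM i1)); [exact: chart1_z | exact: gen_algC].
  - split=> //; apply: contrapT => n; apply: xTP; apply: torus_pt_uniq => //.
    split=> //; apply: hx; apply: (subringB (@chart_subring XM i1)).
      exact: chart1_z.
    exact: gen_algC.
  - by move=> y [_ uy] /= yT; rewrite yT in uy; case: torus_pt_small.
rewrite (off_torus nx).
have Ag : gen_alg cst cf i1 gg.
  by have := gen_algX cst cf i1 i0; rewrite /cf /= divr1.
have [c [t [At es]]] := chart1_div Ag.
have [r Or e1] := @cf_small i1 isT.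
have As : gen_alg cst cf i0 (1 - cst c * (cf i1 / cf i0)).
  apply: (subringB (@chart_subring XM i0)).
    exact: (subring1 (@chart_subring XM i0)).
  by apply: gen_algM; [exact: gen_algC | exact: gen_algX].
exists i0, (1 - cst c * (cf i1 / cf i0)); split=> //.
- split; first exact: glue_chart0.
  have [Oz z0] := at0_zM Or.
  have Oc := O0_cst c; have O1 := subring1 sO; have Ocz := subringM sO Oc Oz.
  apply/(glue_unit As); rewrite -[cf i0]/gg e1 appB // app1 appM // z0 mulr0 subr0.
  exact: oner_neq0.
- move=> y [hy uy] /= yT; rewrite yT in hy uy; have lT := lring_local torus_pt.
  have ug : unit_in (lring torus_pt) (cf i1 / cf i0).
    exact: (@trans_unit XM i0 i1 torus_pt hy torus_pt_chart).
  have e : 1 - cst c * (cf i1 / cf i0) = (cf i1 / cf i0) * t * (z - cst a).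
    have h (L : fieldType) (g d v s : L) : g != 0 -> g = d + v * s ->
        1 - d * (1 / g) = 1 / g * s * v.
      by move=> g0 eg; have -> : d = g - v * s by [rewrite eg addrK]; field.
    by apply: h => //; exact: gg0.
  move: uy; rewrite e; apply: (nonunitM lT).
  - apply: (subringM lT.1); last exact: (torus_pt_chart At).
    by case: ug.
  - by case: torus_pt_small.
  - by case: torus_pt_small.
Qed.

End TorusPoint.
End MarkedPoint.

Section Dimension.
Variable C : numClosedFieldType.
Notation K := {fraction {poly C}}.
Notation z := (zz C).
Notation cst := (cst C).
Notation cf := (@cf C).
Notation XM := (XM C).
Notation X := (X C).
Notation glue := (glue C).
Implicit Types x y : point XM.

Lemma glue_closed : closed [set glue].
Proof.
rewrite -openC; rewrite (_ : ~` [set glue] = [set x | in_chart (M := XM) i1 x]).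
  exact: open_chart.
apply/seteqP; split=> x /=.
  by move=> n; apply: contrapT => /(off_torus); exact: n.
by move=> h e; rewrite e in h; case: (@glue_not_chart1 C).
Qed.

(** Factor [p] into linear factors. *)
Lemma root_point (p : {poly C}) : p != 0 -> exists2 rs : seq C, all (predC1 0) rs &
  forall x, in_chart (M := XM) i1 x -> ~ unit_in (lring x) (tofrac p) ->
    exists2 r, r \in rs & small (lring x) (z - cst r).
Proof.
move=> p0; have [r e] := closed_field_poly_normal p.
exists [seq a <- r | a != 0]; first exact: filter_all.
move=> x hx; have lx := lring_local x; have sx := lx.1.
have zx c : lring x (z - cst c).
  by apply: (subringB sx); [case: (torus_z hx) | exact: lring_cst].
rewrite e -mul_polyC tofracM => nu.
have : exists2 a, a \in r & small (lring x) (z - cst a).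
  apply: contrapT => nex; apply: nu; apply: (unit_inM sx).
    by apply: unit_cst; rewrite lead_coef_eq0.
  rewrite (rmorph_prod (@tofrac {poly C})) /=.
  have h (s : seq C) : {subset s <= r} ->
      unit_in (lring x) (\prod_(i <- s) tofrac ('X - i%:P)).
    elim: s => [|a s IH] sub; first by rewrite big_nil; exact: (unit_in1 sx).
    rewrite big_cons; apply: (unit_inM sx).
      apply: contrapT => na; apply: nex; exists a.
        by apply: sub; rewrite inE eqxx.
      by split=> //; rewrite /= tofracB in na.
    by apply: IH => b bs; apply: sub; rewrite inE bs orbT.
  exact: h.
move=> [a ar sa]; exists a => //; rewrite mem_filter ar andbT.
apply/eqP => a0; case: sa => _; apply; rewrite a0 rmorph0 subr0.
exact: torus_z.
Qed.

(** The complement is a neighbourhood of the generic point, so it contains the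
    torus deprived of the zeros of a nonzero Laurent polynomial. *)
Lemma proper_closed_finite (Z : set (point XM)) : closed Z -> Z != setT ->
  exists2 rs : seq C, all (predC1 0) rs &
    forall x, Z x -> x = glue \/
      exists r (r0 : r != 0), r \in rs /\ x = torus_pt r0.
Proof.
move=> cZ ZT; pose U : opens (point XM) := Opens (closed_openC cZ).
have [y Uy] : exists y, U y.
  apply: contrapT => n; move: ZT => /eqP; apply; apply/seteqP; split=> // y _.
  by apply: contrapT => nZ; apply: n; exists y.
have Ug := generic_open Uy.
have gc : in_chart (M := XM) i1 (generic XM) by exact: generic_chart.
have [s [As us sub]] := opens_basis Ug gc.
have [p [m es]] := chart1_laurent As.
have p0 : p != 0.
  by case: us => s0 _ _; apply: contra_neq s0; rewrite es => ->; rewrite tofrac0 mul0r.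
have [rs rs0 hrs] := root_point p0; exists rs => // x Zx.
have [hx|/off_torus ->] := pselect (in_chart (M := XM) i1 x); last by left.
right; have [|r rin sr] := hrs x hx.
  move=> u; have : U x; last by apply.
  apply: sub; split=> //; rewrite es; apply: (unit_inM (lring_subring x)) => //.
  by apply: unit_in_inv; apply: (unit_inX (lring_subring x)); exact: torus_z.
have r0 : r != 0 by exact: (allP rs0).
by exists r, r0; split=> //; exact: torus_pt_uniq.
Qed.

(** Finitely many closed points form an irreducible set only if there is one of
    them. *)
Lemma irreducible_proper (Z : set (point XM)) : irreducible_closed Z ->
  Z != setT -> exists p, Z `<=` [set p].
Proof.
move=> [cZ Z0 iZ] ZT; have [rs rs0 hrs] := proper_closed_finite cZ ZT.
have : Z `<=` [set glue] `|` [set x | exists r (r0 : r != 0), r \in rs /\ x = torus_pt r0].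
  by move=> x /hrs.
elim: rs rs0 {hrs} => [|r rs IH] /=.
  move=> _ sub; exists glue => x /sub[//|[r [r0 [rin _]]]].
  by rewrite in_nil in rin.
move=> /andP[/= r0 rs0] sub.
have cl (s : seq C) : closed [set x | exists r (r0 : r != 0), r \in s /\ x = torus_pt r0].
  elim: s => [|a s IHs].
    rewrite (_ : [set x | _] = set0); first exact: closed0.
    by apply/seteqP; split=> // x [b [b0 []]]; rewrite in_nil.
  have [a0|a0] := eqVneq a 0.
    rewrite (_ : [set x | _] = [set x | exists r (r0 : r != 0), r \in s /\ x = torus_pt r0]) //.
    apply/seteqP; split=> x [b [b0 [bin ->]]]; exists b, b0; split=> //.
      by move: bin; rewrite inE a0 (negbTE b0).
    by rewrite inE bin orbT.
  rewrite (_ : [set x | _] = [set torus_pt a0] `|`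
      [set x | exists r (r0 : r != 0), r \in s /\ x = torus_pt r0]).
    by apply: closedU => //; exact: torus_pt_closed.
  apply/seteqP; split=> x.
    move=> [b [b0 [bin ->]]]; move: bin; rewrite inE => /orP[/eqP ba|bs].
      by left; rewrite /=; move: b0; rewrite ba => b0; rewrite (Prop_irrelevance b0 a0).
    by right; exists b, b0.
  by move=> [->|[b [b0 [bs ->]]]]; [exists a, a0 | exists b, b0];
    split=> //; rewrite inE ?eqxx ?bs ?orbT.
have [|||h|h] := iZ [set torus_pt r0]
  ([set glue] `|` [set x | exists r (r0 : r != 0), r \in rs /\ x = torus_pt r0]).
- exact: torus_pt_closed.
- by apply: closedU; [exact: glue_closed | exact: cl].
- move=> x /sub[->|[b [b0 [bin ->]]]]; first by right; left.
  move: bin; rewrite inE => /orP[/eqP br|bs]; last by right; right; exists b, b0.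
  by left; move: b0; rewrite br => b0 /=; rewrite (Prop_irrelevance b0 r0).
- by exists (torus_pt r0).
- by apply: IH.
Qed.

Lemma setT_irreducible : irreducible_closed (setT : set (point XM)).
Proof.
split; [exact: closedT | by exists glue|].
have full (A : set (point XM)) : closed A -> A (generic XM) -> setT `<=` A.
  move=> cA Ag x _; apply: contrapT => nA.
  exact: (generic_open (U := Opens (closed_openC cA)) nA Ag).
by move=> A B cA cB /(_ (generic XM) I)[/(full _ cA)|/(full _ cB)]; [left|right].
Qed.

Lemma X_dimension : has_dimension X 1.
Proof.
split.
  exists (fun i => if i == 0%N then [set glue] else setT); split.
    move=> [|i] _ /=; last exact: setT_irreducible.
    split; [exact: glue_closed | by exists glue|].
    by move=> A B _ _ /(_ glue erefl)[h|h]; [left|right] => _ ->.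
  move=> [|i] //= _; split=> // /(_ (generic XM) I) /= e.
  have := @glue_not_chart1 C; rewrite -e; apply; exact: generic_chart.
move=> [|[|e]] // Z [irr lt].
have h0 := irr 0%N isT; have h1 := irr 1%N isT.
have [sub01 n01] := lt 0%N isT; have [_ n12] := lt 1%N isT.
have Z1T : Z 1%N != setT.
  by apply/eqP => e1; apply: n12; rewrite e1.
have [p hp] := irreducible_proper h1 Z1T.
case: h0 => _ [y Zy] _; case: n01 => x Zx.
by rewrite (hp x Zx) -(hp y (sub01 _ Zy)).
Qed.

Lemma X_curve : curve X.
Proof.
split.
- exact: (@geometrically_integral_closed C X (atlas_integral XM)).
- exact: atlas_separated.
- exact: proj_finite_type.
- exact: X_dimension.
Qed.

Definition XP : pointed_scheme C := @PointedScheme C X glue.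

Lemma XP_marked : marked_curve XP.
Proof. by split; [exact: X_curve | exact: glue_rational]. Qed.

End Dimension.

(** * Composition of morphisms given by homomorphisms of fields *)

Definition rmorph_phom (K L : fieldType) (f : {rmorphism K -> L}) : phom K L :=
  @PHom K L setT f (IsSubring I (fun _ _ _ _ => I) (fun _ _ _ _ => I))
    (rmorph1 f) (fun a b _ _ => rmorphB f a b) (fun a b _ _ => rmorphM f a b)
    (fun _ _ _ => I).

Lemma follows_comp (L M N : atlas) (T : phom (fld N) (fld M))
  (T' : phom (fld M) (fld L)) (T'' : phom (fld N) (fld L))
  (f : hom (atlas_scheme M) (atlas_scheme N)) (g : hom (atlas_scheme L) (atlas_scheme M)) :
  follows T f -> follows T' g ->
  (forall s, dom T s -> dom T' (T s) -> dom T'' s /\ T'' s = T' (T s)) ->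
  follows T'' (hcomp f g).
Proof.
move=> hf hg h.
have reg x s : lring (f (g x)) s -> dom T'' s /\ T'' s = T' (T s).
  move=> xs; apply: h; first exact: (dominates_dom (follows_dominates (g x) hf)).
  apply: (dominates_dom (follows_dominates x hg)).
  exact: (dominates_in (follows_dominates (g x) hf)).
split=> [x s /reg[]//|V s x Vx].
have h1 : hpre (hcomp f g) V `<=` hpre g (hpre f V) by [].
have -> : pull (hcomp f g) V s = res h1 (pull g (hpre f V) (pull f V s)).
  by rewrite -(@pull_hcomp _ _ _ f g V s _ (@subset_refl _ (hpre (hcomp f g) V)) h1) res_id.
rewrite (value_rres _ _ (Vx : hpre (hcomp f g) V x)).
rewrite (hg.2 (hpre f V) (pull f V s) x) // (hf.2 V s (g x)) //.
by have [|_ ->] := reg x (value s) => //; exact: value_in.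
Qed.

Lemma follows_hid (M : atlas) : follows (id_phom (fld M)) (hid (atlas_scheme M)).
Proof.
split=> // V s x Vx; have h : hpre (hid (atlas_scheme M)) V `<=` V by [].
have -> : pull (hid (atlas_scheme M)) V s = res h s.
  by rewrite -(@pull_hid (atlas_scheme M) V s _ (@subset_refl _ (hpre (hid (atlas_scheme M)) V)) h) res_id.
by rewrite (value_rres _ _ (Vx : hpre (hid (atlas_scheme M)) V x)).
Qed.

(** The image of the generic point lies in every nonempty open set, so every
    function can be pulled back to it. *)
Section InducedField.
Variables (M N : atlas) (H : hom (atlas_scheme M) (atlas_scheme N)).
Hypothesis full : forall a : fld N, lring (generic N) a.
Hypothesis surj : forall y, exists x, H x = y.

Lemma dominant (V : opens (atlas_scheme N)) y : V y -> V (H (generic M)).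
Proof.
have [x <-] := surj y => Vx.
exact: (@generic_open M (hpre H V) x Vx).
Qed.

Definition hval (V : opens (atlas_scheme N)) (s : sec V) : fld M :=
  value (pull H V s : section (hpre H V)).

Lemma hval_res (U V : opens (atlas_scheme N)) (h : V `<=` U) (s : sec U) y :
  V y -> hval (res h s) = hval s.
Proof.
move=> Vy; have h' : hpre H V `<=` hpre H U by move=> x; exact: h.
by rewrite /hval (pull_res _ h') (value_rres _ _ (dominant Vy : hpre H V _)).
Qed.

Definition regular_open (a : fld N) : opens (atlas_scheme N) :=
  Opens (@open_regular N a).

Definition regular_sec (a : fld N) : @sec (atlas_scheme N) (regular_open a) :=
  @to_sec N (regular_open a) a (fun y h => h).

Definition induced_fun (a : fld N) : fld M := hval (regular_sec a).

Lemma induced_value (V : opens (atlas_scheme N)) (s : sec V) y : V y ->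
  hval s = induced_fun (value (s : section V)).
Proof.
move=> Vy; have h : V `<=` regular_open (value (s : section V)).
  by move=> x Vx; exact: (value_in (s : section V)).
rewrite /induced_fun -(hval_res h _ Vy); congr hval; apply: value_eq => Vg.
by rewrite (value_rres _ _ Vg) (value_to_sec _ (h _ Vg)).
Qed.

Let common (a b : fld N) : opens (atlas_scheme N) :=
  Opens (openI (oset_open (regular_open a)) (oset_open (regular_open b))).

Let common_l a b : common a b `<=` regular_open a. Proof. by move=> ? []. Qed.
Let common_r a b : common a b `<=` regular_open b. Proof. by move=> ? []. Qed.
Let common_g a b : common a b (generic N). Proof. by split; exact: full. Qed.

Let value_l a b : value (res (@common_l a b) (regular_sec a) : section (common a b)) = a.
Proof. by rewrite (value_rres _ _ (common_g a b)) (value_to_sec _ (full a : regular_open a _)). Qed.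

Let value_r a b : value (res (@common_r a b) (regular_sec b) : section (common a b)) = b.
Proof. by rewrite (value_rres _ _ (common_g a b)) (value_to_sec _ (full b : regular_open b _)). Qed.

Lemma induced_1 : induced_fun 1 = 1.
Proof.
have g1 : regular_open 1 (generic N) := full 1.
have -> : induced_fun 1 = hval (1 : sec (regular_open 1)).
  by rewrite (induced_value (1 : sec (regular_open 1)) g1) (value1 g1).
by rewrite /hval rmorph1 (value1 (dominant g1 : hpre H (regular_open 1) _)).
Qed.

Lemma induced_B : {morph induced_fun : a b / a - b}.
Proof.
move=> a b.
have e1 := induced_value (res (@common_l a b) (regular_sec a)) (common_g a b).
have e2 := induced_value (res (@common_r a b) (regular_sec b)) (common_g a b).
have e3 := induced_value (res (@common_l a b) (regular_sec a) -
  res (@common_r a b) (regular_sec b)) (common_g a b).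
rewrite valueB value_l value_r in e3; rewrite value_l in e1; rewrite value_r in e2.
by rewrite -e1 -e2 -e3 /hval rmorphB valueB.
Qed.

Lemma induced_M : {morph induced_fun : a b / a * b}.
Proof.
move=> a b.
have e1 := induced_value (res (@common_l a b) (regular_sec a)) (common_g a b).
have e2 := induced_value (res (@common_r a b) (regular_sec b)) (common_g a b).
have e3 := induced_value (res (@common_l a b) (regular_sec a) *
  res (@common_r a b) (regular_sec b)) (common_g a b).
rewrite valueM value_l value_r in e3; rewrite value_l in e1; rewrite value_r in e2.
by rewrite -e1 -e2 -e3 /hval rmorphM valueM.
Qed.

Definition induced : {rmorphism fld N -> fld M} :=
  mk_rmorphism induced_1 induced_B induced_M.

Lemma induced_follows : follows (rmorph_phom induced) H.
Proof. by split=> // V s x Vx; exact: (induced_value s Vx). Qed.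

End InducedField.

(** * The semilinear automorphism of order four *)

Section Alpha.
Variable C : numClosedFieldType.
Notation K := {fraction {poly C}}.
Notation z := (zz C).
Notation cst := (cst C).
Notation GG := (GG C).
Notation gg := (gg C).
Notation FF := (FF C).
Notation cf := (@cf C).
Notation XM := (XM C).
Notation X := (X C).
Notation glue := (glue C).
Implicit Types x y : point XM.

Definition conj : {rmorphism C -> C} := @Num.conj C.

Variable c : C.
Hypothesis c2 : c ^+ 2 = - 1.

Lemma alpha_c0 : c != 0.
Proof.
apply/eqP => c0; move: c2; rewrite c0 expr0n /= => /eqP.
by rewrite eq_sym oppr_eq0 oner_eq0.
Qed.

(** For [c = i] or [c = - i] the square of this semilinear automorphism is [z
    -> - z]: it has order four, and so is no descent datum. *)
Definition alpha_field : {rmorphism K -> K} := subst conj (scaled_inv_not_cst alpha_c0).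

Lemma alpha_cst a : alpha_field (cst a) = cst a^*.
Proof. exact: subst_cst. Qed.

Lemma alpha_z : alpha_field z = cst c / z.
Proof. exact: subst_zz. Qed.

Lemma alpha_GG : alpha_field GG = GG.
Proof.
have h (L : fieldType) (f : {rmorphism L -> L}) (v d : L) : v != 0 -> d ^+ 2 = -1 ->
    f v = d / v -> f (v ^+ 12 + (v ^+ 12)^-1 - 2) = v ^+ 12 + (v ^+ 12)^-1 - 2.
  move=> v0 d2 fv; rewrite rmorphB rmorphD fmorphV rmorphXn fv rmorph_nat.
  have -> : (d / v) ^+ 12 = (v ^+ 12)^-1.
    by rewrite expr_div_n (exprM d 2 6) d2 -signr_odd expr0 div1r.
  by rewrite invrK [X in X - _]addrC.
rewrite GGE; apply: h; [exact: zz0 | | exact: alpha_z].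
by rewrite -rmorphXn c2 rmorphN rmorph1.
Qed.

Lemma alpha_FF : alpha_field FF = FF.
Proof.
have h (L : fieldType) (f : {rmorphism L -> L}) (v d b b' : L) : v != 0 ->
    d ^+ 2 = -1 -> f v = d / v -> f b = b' -> f b' = b ->
    f (b * v ^+ 4 + b' / v ^+ 4 + v ^+ 2 - (v ^+ 2)^-1) =
    b * v ^+ 4 + b' / v ^+ 4 + v ^+ 2 - (v ^+ 2)^-1.
  move=> v0 d2 fv fb fb'.
  have f2 : f (v ^+ 2) = - (v ^+ 2)^-1.
    by rewrite rmorphXn fv expr_div_n d2 mulN1r.
  have f4 : f (v ^+ 4) = (v ^+ 4)^-1.
    by rewrite (exprM v 2 2) rmorphXn f2 sqrrN exprVn.
  rewrite rmorphB !rmorphD fmorph_div rmorphM fmorphV f2 f4 fb fb' invrK invrN invrK.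
  by ring.
rewrite FFE; apply: h; [exact: zz0 | | exact: alpha_z | | ].
- by rewrite -rmorphXn c2 rmorphN rmorph1.
- by rewrite alpha_cst bb_conj.
- by rewrite alpha_cst bb'_conj.
Qed.

Lemma alpha_gg : alpha_field gg = gg.
Proof.
rewrite /gg rmorphM alpha_GG alpha_cst; congr (cst _ * _).
by rewrite rmorphN fmorphV rmorph_nat.
Qed.

Lemma alpha_zV : alpha_field z^-1 = cst c^-1 * z.
Proof. by rewrite fmorphV alpha_z invf_div fmorphV mulrC. Qed.

(** The action of the automorphism on the coordinates, up to constants. *)
Definition perm5 (i : 'I_5) : 'I_5 := nth i0 [:: i0; i1; i3; i2; i4] i.

Lemma perm5K : involutive perm5.
Proof. by case=> [[|[|[|[|[|m]]]]] hm] //; exact: val_inj. Qed.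

Lemma alpha_cf i : exists2 d, d != 0 & alpha_field (cf i) = cst d * cf (perm5 i).
Proof.
case: i => [[|[|[|[|[|m]]]]] hm] //.
- by exists 1; rewrite ?oner_neq0 // rmorph1 mul1r; exact: alpha_gg.
- by exists 1; rewrite ?oner_neq0 // rmorph1 mul1r; exact: rmorph1.
- by exists c; [exact: alpha_c0 | exact: alpha_z].
- by exists c^-1; [rewrite invr_eq0; exact: alpha_c0 | exact: alpha_zV].
- by exists 1; rewrite ?oner_neq0 // rmorph1 mul1r; exact: alpha_FF.
Qed.

Lemma alpha_quot i j : exists2 d, d != 0 &
  alpha_field (cf i / cf (perm5 j)) = cst d * (cf (perm5 i) / cf j).
Proof.
have [d d0 e] := alpha_cf i; have [f f0 e'] := alpha_cf (perm5 j).
rewrite perm5K in e'; exists (d / f); first by rewrite mulf_neq0 ?invr_eq0.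
by rewrite !fmorph_div e e' mulf_div.
Qed.

Notation T := (rmorph_phom alpha_field).

Lemma alpha_defined x : exists j, forall l,
  dom T (cf l / cf j) /\ lring x (T (cf l / cf j)).
Proof.
have [i hi] := point_chart x; exists (perm5 i) => l; split=> //.
have [d _ ->] : exists2 d, d != 0 & T (cf l / cf (perm5 i)) = cst d * (cf (perm5 l) / cf i).
  exact: alpha_quot.
apply: (subringM (lring_subring x)); first exact: lring_cst.
exact: lring_cf.
Qed.

Lemma alpha_scalar a x : lring x (T (cst a)).
Proof. by rewrite [T _]alpha_cst; exact: lring_cst. Qed.

Definition alpha : hom (atlas_scheme XM) (atlas_scheme XM) :=
  @proj_hom C K cst 4 cf (@cf0 C) XM T (fun _ => I) alpha_scalar alpha_defined.

Lemma alpha_follows : @follows XM XM T alpha.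
Proof. exact: proj_hom_follows. Qed.

Lemma alpha_semilinear : @lies_over C C conj X X alpha.
Proof. exact: (follows_lies_over alpha_follows alpha_cst). Qed.

Lemma alpha_glue : alpha glue = glue.
Proof.
apply: off_torus => h; case: (@glue_not_chart1 C); apply: in_proj_chart => l.
have [d d0 e] := alpha_quot (perm5 l) i1; rewrite perm5K in e.
have : lring glue (alpha_field (cf (perm5 l) / cf (perm5 i1))).
  apply: (dominates_in (follows_dominates glue alpha_follows)).
  exact: lring_cf.
rewrite e => Pl.
have -> : cf l / cf i1 = cst d^-1 * (cst d * (cf l / cf i1)).
  by rewrite fmorphV mulKf // fmorph_eq0.
by apply: (subringM (lring_subring glue)) => //; exact: lring_cst.
Qed.

End Alpha.

Section AlphaInverse.
Variable C : numClosedFieldType.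
Notation XM := (XM C).
Notation X := (X C).
Variables (c c' : C).
Hypotheses (c2 : c ^+ 2 = - 1) (c2' : c' ^+ 2 = - 1) (cc : c'^* = c).

Lemma alpha_inverse : hom_eq (hcomp (alpha c2) (alpha c2')) (hid (atlas_scheme XM)).
Proof.
apply: (@follows_eq XM XM (id_phom _)); last exact: follows_hid.
apply: (follows_comp (alpha_follows c2) (alpha_follows c2')) => s _ _; split=> //.
have ec a : alpha_field c2' (alpha_field c2 (cst C a)) = cst C a.
  by rewrite !alpha_cst conjCK.
have h (L : fieldType) (d v : L) : d != 0 -> v != 0 -> d / (d / v) = v.
  by move=> d0 v0; rewrite invf_div mulrCA divff ?mulr1.
have ez : alpha_field c2' (alpha_field c2 (zz C)) = zz C.
  rewrite alpha_z fmorph_div alpha_cst alpha_z -cc conjCK.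
  by apply: h; rewrite ?zz0 // fmorph_eq0 (alpha_c0 c2').
apply/esym; exact: (rmorph_frac_eq (u := alpha_field c2' \o alpha_field c2)
  (v := idfun)).
Qed.

End AlphaInverse.

(** * The field of moduli *)

Section Moduli.
Variable C : numClosedFieldType.
Notation X := (X C).

Definition ci2 : ('i : C) ^+ 2 = - 1 := sqrCi C.
Lemma cni2 : (- 'i : C) ^+ 2 = - 1. Proof. by rewrite sqrrN sqrCi. Qed.

(** Since the twist has the same underlying scheme, a semilinear automorphism
    of [X] is a linear isomorphism from the twist to [X]. *)
Lemma X_conj_iso :
  @isomorphism C (twist (conj C) X) X (alpha ci2 : hom (twist (conj C) X) X).
Proof.
split.
  by move=> V a; rewrite (alpha_semilinear ci2) const_twist.
exists (alpha cni2 : hom X (twist (conj C) X)); split.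
  by move=> V a; rewrite const_twist (alpha_semilinear cni2) /= conjCK.
split.
- by apply: alpha_inverse; rewrite conjCi.
- by apply: alpha_inverse; rewrite rmorphN /= conjCi opprK.
Qed.

Definition XP_conj : pointed_scheme C := @PointedScheme C (twist (conj C) X) (glue C).

Lemma XP_conj_base_ext : marked_curve_base_ext (conj C) (XP C) XP_conj.
Proof.
exists (hid X); split=> //; apply: twist_base_extension; exact: conjCK.
Qed.

Lemma XP_conj_iso : marked_curve_iso XP_conj (XP C).
Proof. by exists (alpha ci2); split; [exact: X_conj_iso | exact: alpha_glue]. Qed.

End Moduli.

(** * Expansions of the functions regular at the glued point *)

Section SubringPolynomials.
Variables (L : fieldType) (O : set L).
Hypothesis sO : is_subring O.

Lemma ratio_numer_in c v i : O c -> O v -> O i ->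
  O (((1 - c ^+ 2) * v ^+ 12 + 2 * c - 2) * i).
Proof.
move=> Oc Ov Oi; have O2 := subring_nat sO 2; have O1 := subring1 sO.
apply: (subringM sO) => //; apply: (subringB sO) => //; apply: (subringD sO).
  apply: (subringM sO); last exact: (subringX sO).
  by apply: (subringB sO) => //; exact: (subringX sO).
exact: (subringM sO).
Qed.

Lemma ratio_denom_in c v : O c -> O v -> O (c * v ^+ 23 - 2 * v ^+ 11).
Proof.
move=> Oc Ov; have O2 := subring_nat sO 2.
by apply: (subringB sO); apply: (subringM sO) => //; exact: (subringX sO).
Qed.

Lemma ratio_formula (v c d G Hv : L) : v != 0 -> Hv != 0 -> c * d = 1 ->
  G = v ^+ 12 + (v ^+ 12)^-1 - 2 -> v ^+ 12 * Hv = d + v * (c * v ^+ 23 - 2 * v ^+ 11) ->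
  G / Hv = c + v ^+ 12 * (((1 - c ^+ 2) * v ^+ 12 + 2 * c - 2) * (v ^+ 12 * Hv)^-1).
Proof.
move=> v0 Hv0 cd eG' eHv; have v12 : v ^+ 12 != 0 by rewrite expf_neq0.
have P0 : v ^+ 12 * Hv != 0 by rewrite mulf_neq0.
have -> : G / Hv = (v ^+ 12 * G) / (v ^+ 12 * Hv).
  by rewrite -mulf_div divff // mul1r.
have -> : v ^+ 12 * G = v ^+ 24 + 1 - 2 * v ^+ 12 by rewrite eG'; field; rewrite v0.
have -> : v ^+ 24 + 1 - 2 * v ^+ 12 =
    c * (v ^+ 12 * Hv) + v ^+ 12 * ((1 - c ^+ 2) * v ^+ 12 + 2 * c - 2).
  by rewrite eHv [c * (d + _)]mulrDr cd; ring.
move: (v ^+ 12 * Hv) P0 => P P0; move: (v ^+ 12) => w.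
by rewrite mulrDl mulfK // -[_ * _ / P]mulrA.
Qed.

Lemma lau_sumE (v c x y u t e4 e2 d2 d4 e0 b b' : L) : v != 0 ->
  c * (v ^+ 12 + (v ^+ 12)^-1 - 2) +
  (x * (b * v ^+ 4 + b' / v ^+ 4 + v ^+ 2 - (v ^+ 2)^-1) + y + u * v + t / v) +
  lau v 0 e4 e2 0 e0 0 d2 d4 0 =
  lau v c (x * b + e4) (x + e2) u (y - c *+ 2 + e0) t (- x + d2) (x * b' + d4) c.
Proof. by move=> v0; rewrite /lau; field; rewrite v0. Qed.

Lemma rmorph_shape (f : {rmorphism L -> L}) (a b l d w : L) :
  f (a * b + l + d * w) = f a * f b + f l + f d * f w.
Proof. by rewrite !rmorphD !rmorphM. Qed.

Lemma lau_const (v a : L) : a * 1 = lau v 0 0 0 0 a 0 0 0 0.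
Proof. by rewrite /lau !mul0r !addr0 !add0r mulr1. Qed.

Lemma lau_z4 (v c4 c2 d2 d4 : L) : v != 0 ->
  v ^+ 4 * lau v 0 c4 c2 0 0 0 d2 d4 0 = c4 * v ^+ 8 + c2 * v ^+ 6 + d2 * v ^+ 2 + d4.
Proof. by move=> v0; rewrite /lau; field; rewrite v0. Qed.

Lemma lau_z4_in (v c4 c2 d2 d4 : L) : v != 0 -> O v -> O c4 -> O c2 -> O d2 -> O d4 ->
  O (v ^+ 4 * lau v 0 c4 c2 0 0 0 d2 d4 0).
Proof.
move=> v0 Ov h4 h2 k2 k4; rewrite lau_z4 //.
have hm c n : O c -> O (c * v ^+ n).
  by move=> Oc; apply: (subringM sO) => //; exact: (subringX sO).
apply: (subringD sO) => //; apply: (subringD sO); last exact: hm.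
by apply: (subringD sO); exact: hm.
Qed.

Lemma lau_scale (v a p4 p2 q2 q4 : L) : a * lau v 0 p4 p2 0 0 0 q2 q4 0 =
  lau v 0 (a * p4) (a * p2) 0 0 0 (a * q2) (a * q4) 0.
Proof. by rewrite /lau; ring. Qed.

End SubringPolynomials.

Section Jets.
Variable C : numClosedFieldType.
Notation K := {fraction {poly C}}.
Notation z := (zz C).
Notation cst := (cst C).
Notation GG := (GG C).
Notation gg := (gg C).
Notation FF := (FF C).
Notation cf := (@cf C).
Notation at0 := (at0 C).
Notation O0 := (@O0 C).
Notation swap := (swap C).

Let sO := O0_sub C.

(** The principal parts: combinations of [F], [1], [v] and [v^-1]. *)
Definition lin (F v : K) (x y u t : C) : K := cst x * F + cst y + cst u * v + cst t / v.

Lemma swap_GG : swap GG = GG.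
Proof. by rewrite [LHS]swap_clau. Qed.

Lemma swap_lin x y u t : swap (lin FF z x y u t) = lin (swap FF) z^-1 x y u t.
Proof.
have h (L : fieldType) (f : {rmorphism L -> L}) (p q r s v w : L) :
    f (p * v + q + r * w + s / w) = f p * f v + f q + f r * f w + f s / f w.
  by rewrite !rmorphD !rmorphM fmorphV.
by rewrite /lin h !swap_cst swap_zz.
Qed.

Lemma lin_order F v x y u t : O0 (z ^+ 4 * F) -> O0 (z ^+ 4 * v) -> O0 (z ^+ 4 / v) ->
  O0 (z ^+ 4 * lin F v x y u t).
Proof.
move=> hF hv hv'.
have h (L : fieldType) (w_ F_ v_ w'_ x_ y_ u_ t_ : L) :
    w_ * (x_ * F_ + y_ + u_ * v_ + t_ * w'_) = x_ * (w_ * F_) + y_ * w_ + u_ * (w_ * v_) + t_ * (w_ * w'_).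
  by ring.
rewrite /lin h; have Oc := @O0_cst C.
have Oz4 : O0 (z ^+ 4) by apply: (subringX sO); exact: O0_zz.
by do 3![apply: (subringD sO); last by apply: (subringM sO)]; apply: (subringM sO).
Qed.

Lemma z4_swap_FF : O0 (z ^+ 4 * swap FF).
Proof.
have h (L : fieldType) (f : {rmorphism L -> L}) (v b b' : L) : v != 0 ->
    f v = v^-1 -> f b = b -> f b' = b' ->
    v ^+ 4 * f (b * v ^+ 4 + b' / v ^+ 4 + v ^+ 2 - (v ^+ 2)^-1) =
    b + b' * v ^+ 8 + v ^+ 2 - v ^+ 6.
  move=> v0 fv fb fb'.
  rewrite rmorphB !rmorphD fmorph_div rmorphM fmorphV !rmorphXn fv fb fb' !exprVn !invrK.
  by field; rewrite v0.
have OX n : O0 (z ^+ n) by apply: (subringX sO); exact: O0_zz.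
rewrite FFE h ?zz0 ?swap_zz ?swap_cst //; apply: (subringB sO) => //.
apply: (subringD sO) => //; apply: (subringD sO); first exact: O0_cst.
by apply: (subringM sO) => //; exact: O0_cst.
Qed.

Lemma order_lin0 x y u t : O0 (z ^+ 4 * lin FF z x y u t).
Proof.
apply: lin_order; first exact: (@O0_z4 C i4).
  exact: (@O0_z4 C i2).
exact: (@O0_z4 C i3).
Qed.

Lemma order_linoo x y u t : O0 (z ^+ 4 * lin (swap FF) z^-1 x y u t).
Proof.
apply: lin_order; first exact: z4_swap_FF.
  exact: (@O0_z4 C i3).
by rewrite invrK; exact: (@O0_z4 C i2).
Qed.

Lemma linD F v x y u t x' y' u' t' :
  lin F v x y u t + lin F v x' y' u' t' = lin F v (x + x') (y + y') (u + u') (t + t').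
Proof.
have h (L : fieldType) (F_ v_ w_ x_ y_ u_ t_ x'_ y'_ u'_ t'_ : L) :
  (x_ * F_ + y_ + u_ * v_ + t_ * w_) + (x'_ * F_ + y'_ + u'_ * v_ + t'_ * w_) =
  (x_ + x'_) * F_ + (y_ + y'_) + (u_ + u'_) * v_ + (t_ + t'_) * w_ by ring.
by rewrite /lin h !rmorphD.
Qed.

Lemma linZ c F v x y u t :
  cst c * lin F v x y u t = lin F v (c * x) (c * y) (c * u) (c * t).
Proof.
have h (L : fieldType) (c_ F_ v_ w_ x_ y_ u_ t_ : L) :
  c_ * (x_ * F_ + y_ + u_ * v_ + t_ * w_) =
  c_ * x_ * F_ + c_ * y_ + c_ * u_ * v_ + c_ * t_ * w_ by ring.
by rewrite /lin h !rmorphM.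
Qed.

(** A function regular at the marked point has expansions on both branches, at
    0 and at infinity, with the same constant and the same principal part [x F
    + y + u z + t / z]. *)
Definition bijet (c : C) (h : K) : Prop := exists x y u t : C,
  jet O0 z GG (lin FF z x y u t) (cst c) h /\
  jet O0 z GG (lin (swap FF) z^-1 x y u t) (cst c) (swap h).

Let cO : range cst `<=` O0. Proof. by move=> _ [c _ <-]; exact: O0_cst. Qed.
Let rc c : range cst (cst c). Proof. by exists c. Qed.

Lemma bijetD c h c' h' : bijet c h -> bijet c' h' -> bijet (c + c') (h + h').
Proof.
move=> [x [y [u [t [j1 j2]]]]] [x' [y' [u' [t' [j1' j2']]]]].
exists (x + x'), (y + y'), (u + u'), (t + t').
rewrite -!linD (rmorphD cst c c') (rmorphD swap h h').
by split; [exact: (jetD sO j1 j1') | exact: (jetD sO j2 j2')].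
Qed.

Lemma bijetM c h c' h' : bijet c h -> bijet c' h' -> bijet (c * c') (h * h').
Proof.
move=> [x [y [u [t [j1 j2]]]]] [x' [y' [u' [t' [j1' j2']]]]].
exists (c * x' + c' * x), (c * y' + c' * y), (c * u' + c' * u), (c * t' + c' * t).
rewrite -!linD -!linZ (rmorphM cst c c') (rmorphM swap h h'); split.
  by apply: (jetM sO cO (zz0 C) (O0_zz C) (GG0 C) (O0_ww C) (GGV C)) => //;
    exact: order_lin0.
by apply: (jetM sO cO (zz0 C) (O0_zz C) (GG0 C) (O0_ww C) (GGV C)) => //;
  exact: order_linoo.
Qed.

Lemma bijetV c h : c != 0 -> bijet c h -> bijet c^-1 h^-1.
Proof.
move=> c0 [x [y [u [t [j1 j2]]]]]; pose d := - (c ^+ 2)^-1.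
exists (d * x), (d * y), (d * u), (d * t).
have k0 : cst c != 0 by rewrite fmorph_eq0.
have dE T : cst d * T = - T / (cst c) ^+ 2.
  by rewrite /d rmorphN fmorphV rmorphXn mulNr mulrC mulNr.
rewrite -!linZ !dE (fmorphV cst c) (fmorphV swap h).
have ri : range cst (cst c)^-1 by rewrite -fmorphV.
split.
  by apply: (jetV sO cO (zz0 C) (O0_zz C) (GG0 C) (O0_ww C) (GGV C) (@O0_inv_cst C)) => //;
    exact: order_lin0.
by apply: (jetV sO cO (zz0 C) (O0_zz C) (GG0 C) (O0_ww C) (GGV C) (@O0_inv_cst C)) => //;
  exact: order_linoo.
Qed.

Lemma bijet_cst c : bijet c (cst c).
Proof.
exists 0, 0, 0, 0; have O00 := subring0 sO.
have l0 F v : lin F v 0 0 0 0 = 0 by rewrite /lin rmorph0 !mul0r !addr0.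
by rewrite !l0 swap_cst; split; exists 0; rewrite // subrr mul0r mulr0 addr0.
Qed.

Lemma bijet_coord i : i != i0 -> bijet 0 (cf i / cf i0).
Proof.
move=> hi; have O00 := subring0 sO.
have g0 := gg0 C.
have key (v : K) x y u t : v = lin FF z x y u t -> bijet 0 (v / gg).
  have e : v / gg * GG = cst (- 4) * v.
    rewrite /gg; have h (L : fieldType) (a d G w : L) : a != 0 -> G != 0 -> d * a = 1 ->
        w / (a * G) * G = d * w.
      move=> a0 G0 da; have -> : d = a^-1 by apply: (mulIf a0); rewrite da mulVf.
      by field; rewrite a0 G0.
    apply: h; first by rewrite fmorph_eq0 oppr_eq0 invr_eq0 four0.
      exact: GG0.
    by rewrite -rmorphM mulrNN divff ?four0 // rmorph1.
  move=> ev; exists (- 4 * x), (- 4 * y), (- 4 * u), (- 4 * t).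
  rewrite -!linZ rmorph0; split.
    by exists 0; rewrite // subr0 e mulr0 addr0 ev.
  exists 0; rewrite // subr0 -{1}swap_GG -rmorphM e rmorphM swap_cst ev.
  by rewrite swap_lin mulr0 addr0.
case: i hi => [[|[|[|[|[|m]]]]] hm] // _.
- by apply: (key 1 0 1 0 0); rewrite /lin rmorph0 rmorph1 !mul0r add0r !addr0.
- by apply: (key z 0 0 1 0); rewrite /lin rmorph0 rmorph1 !mul0r !add0r addr0 mul1r.
- by apply: (key z^-1 0 0 0 1); rewrite /lin rmorph0 rmorph1 !mul0r !add0r mul1r.
- by apply: (key FF 1 0 0 0); rewrite /lin rmorph0 rmorph1 !mul0r !addr0 mul1r.
Qed.

Lemma bijet_chart0 a : gen_alg cst cf i0 a -> bijet (at0 a) a.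
Proof.
suff h b : gen_alg cst cf i0 b -> O0 b /\ bijet (at0 b) b by case/h.
move: b; apply: (gen_alg_min (S := [set b | O0 b /\ bijet (at0 b) b])).
- by move=> c; split; [exact: O0_cst | rewrite at0_cst; exact: bijet_cst].
- move=> s t [Os js] [Ot jt]; split; first exact: (subringD sO).
  by rewrite appD //; exact: bijetD.
- move=> s t [Os js] [Ot jt]; split; first exact: (subringM sO).
  by rewrite appM //; exact: bijetM.
- move=> j; have [->|hj] := eqVneq j i0.
    rewrite divff ?cf0 //; split; first exact: (subring1 sO).
    by rewrite app1 -[X in bijet _ X](rmorph1 cst); exact: bijet_cst.
  have [r Or e] := @cf_small C _ hj; have [Oz z0] := at0_zM Or.
  have e' : cf j / cf i0 = z * r := e.
  by rewrite e'; split=> //; rewrite z0 -e'; exact: bijet_coord.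
Qed.

(** The property holds for the generators of the chart of [g] and is stable
    under the ring operations and under inversion. *)
Lemma bijet_glue h : lring (glue C) h -> exists c, bijet c h.
Proof.
move=> /glue_frac[a [b [Aa Ab b0 ->]]]; exists (at0 a / at0 b).
by apply: bijetM; [exact: bijet_chart0 | apply: bijetV => //; exact: bijet_chart0].
Qed.

(** ** Automorphisms preserving the glued point *)

(** Here [G'] and [F'] are the images of [G] and [F] under an automorphism of
    [C(z)] preserving the local ring of the marked point, which contains [1 /
    g] and [F / g]. *)
Section Rigid.
Variables (A B : C) (G' F' : K) (a4 a2 b2 b4 : C).
Hypotheses (AB : A * B = 1).
Hypotheses (eG : G' = clau A 0 0 0 (- 2) 0 0 0 B).
Hypotheses (eF : F' = clau 0 a4 a2 0 0 0 b2 b4 0).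
Hypotheses (h1 : lring (glue C) (cst (- 4) / G')).
Hypotheses (h2 : lring (glue C) (cst (- 4) * F' / G')).

Let A0 : A != 0.
Proof. by apply: contra_eq_neq AB => ->; rewrite mul0r eq_sym oner_neq0. Qed.
Let B0 : B != 0.
Proof. by apply: contra_eq_neq AB => ->; rewrite mulr0 eq_sym oner_neq0. Qed.

Let OX n : O0 (z ^+ n). Proof. by apply: (subringX sO); exact: O0_zz. Qed.

(** Multiplied by [z^12], the numerator and the denominator are [1] and [b] up
    to order 12, and [a = 1 / b]. *)
Lemma ratio_order (a b : C) : a * b = 1 -> exists2 s, O0 s &
  GG / clau a 0 0 0 (- 2) 0 0 0 b = cst a + z ^+ 12 * s.
Proof.
move=> ab; have b0 : b != 0.
  by apply: contra_eq_neq ab => ->; rewrite mulr0 eq_sym oner_neq0.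
set H := clau _ _ _ _ _ _ _ _ _; have Oc := @O0_cst C.
have eH : z ^+ 12 * H = cst b + z * (cst a * z ^+ 23 - 2 * z ^+ 11).
  have h (L : fieldType) (v c d : L) : v != 0 ->
      v ^+ 12 * lau v c 0 0 0 (- 2) 0 0 0 d = d + v * (c * v ^+ 23 - 2 * v ^+ 11).
    by move=> v0; rewrite lau_polyE //; ring.
  by rewrite /H /clau !rmorph0 rmorphN rmorph_nat h ?zz0.
have [u0 _ Oi] : unit_in O0 (z ^+ 12 * H).
  rewrite eH; apply: O0_inv_cst; [exact: rc | by rewrite fmorph_eq0 |].
  exact: (ratio_denom_in sO (Oc a) (O0_zz C)).
have H0 : H != 0 by apply: contra_neq u0 => ->; rewrite mulr0.
exists (((1 - cst a ^+ 2) * z ^+ 12 + 2 * cst a - 2) * (z ^+ 12 * H)^-1).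
  exact: (ratio_numer_in sO (Oc a) (O0_zz C) Oi).
have cab : cst a * cst b = 1 by rewrite -(rmorphM cst) ab rmorph1.
exact: (ratio_formula (zz0 C) H0 cab (GGE C) eH).
Qed.

(** Multiply [h] by [G] and replace [G / W] by its value [a], up to order 12:
    the Laurent polynomial [c0 G + T + 4 a V] has positive order. *)
Lemma expansion (a b c0 : C) (T h V r W : K) : a * b = 1 ->
  O0 r -> O0 (z ^+ 4 * V) -> W = clau a 0 0 0 (- 2) 0 0 0 b ->
  h = cst (- 4) * V / W -> (h - cst c0) * GG = T + z * r ->
  exists2 s, O0 s & cst c0 * GG + T + cst (4 * a) * V = z * s.
Proof.
move=> ab Or OV -> -> e; have [s Os es] := ratio_order ab.
exists (- r - cst 4 * (z ^+ 4 * V) * (z ^+ 7 * s)).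
  apply: (subringB sO); first exact: (subringN sO).
  apply: (subringM sO); last exact: (subringM sO).
  by apply: (subringM sO) => //; exact: O0_cst.
have h' (L : fieldType) (G H f V' c T' r' v s' a' : L) :
    (- f * V' / H - c) * G = T' + v * r' -> G / H = a' + v ^+ 12 * s' ->
    c * G + T' + f * a' * V' = v * (- r' - f * (v ^+ 4 * V') * (v ^+ 7 * s')).
  move=> e1 e2; have -> : T' = (- f * V' / H - c) * G - v * r' by rewrite e1 addrK.
  have -> : (- f * V' / H - c) * G = - f * V' * (G / H) - c * G by ring.
  by rewrite e2; ring.
rewrite rmorphM; apply: (h' _ _ _ _ _ _ _ _ _ _ _ _ es).
by rewrite -rmorphN.
Qed.

Let swapG : swap G' = clau B 0 0 0 (- 2) 0 0 0 A.
Proof. by rewrite eG swap_clau. Qed.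

Let swapF : swap F' = clau 0 b4 b2 0 0 0 a2 a4 0.
Proof. by rewrite eF swap_clau. Qed.

Let BA : B * A = 1. Proof. by rewrite mulrC. Qed.

Lemma lau_sum c x y u t e4 e2 d2 d4 e0 :
  cst c * GG + lin FF z x y u t + clau 0 e4 e2 0 e0 0 d2 d4 0 =
  clau c (x * bb C + e4) (x + e2) u (y - c *+ 2 + e0) t (- x + d2) (x * bb' C + d4) c.
Proof.
rewrite /lin GGE FFE /clau !rmorph0 (lau_sumE _ _ _ _ _ _ _ _ _ _ _ _ (zz0 C)).
by rewrite !(rmorphD cst, rmorphM cst, rmorphN cst, rmorphMn cst).
Qed.

(** By [expansion] for [V = 1], the function [c G + x F + y + u z + t / z]
    becomes zero at 0 when [4 A] is added to it, and zero at infinity when [4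
    B] is added. So it is constant, and the two constants agree. *)
Lemma rigid_AB : A = B.
Proof.
have [c [x [y [u [t [[r Or e1] [r' Or' e2]]]]]]] := bijet_glue h1.
have O1 : O0 (z ^+ 4 * 1) by rewrite mulr1.
have [|s Os es] := @expansion A B c _ _ 1 r G' AB Or O1 eG _ e1; first by rewrite mulr1.
have [|s' Os' es'] := @expansion B A c _ _ 1 r' (swap G') BA Or' O1 swapG _ e2.
  by rewrite mulr1 fmorph_div swap_cst.
have one a : cst a * 1 = clau 0 0 0 0 a 0 0 0 0.
  by rewrite /clau rmorph0; exact: lau_const.
rewrite one lau_sum in es.
have e3 : swap (z * s) = z * s' + cst (4 * A - 4 * B).
  rewrite -es -lau_sum -one rmorph_shape !swap_cst swap_GG swap_lin rmorph1 -es'.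
  have h (p q m n : K) : p + q + m * 1 = p + q + n * 1 + (m - n).
    by rewrite !mulr1 -[in RHS]addrA [n + _]addrC subrK.
  by rewrite (h _ _ _ (cst (4 * B))) -(rmorphB cst).
have O3 : O0 (z * s' + cst (4 * A - 4 * B)).
  by apply: (subringD sO); [apply: (subringM sO) => //; exact: O0_zz | exact: O0_cst].
have zs0 : z * s = 0.
  have [[k1 k2 k3 k4 k5] [l1 l2 l3 _]] :=
    clau_eq0 Os O3 es (etrans (congr1 swap es) e3).
  by rewrite -es k2 k3 k5 l2 l3 k1 k4 l1 /clau rmorph0 /lau !mul0r !addr0.
have e4 : at0 (z * s' + cst (4 * A - 4 * B)) = 0 by rewrite -e3 zs0 rmorph0; exact: app0.
have [Oz z0] := at0_zM Os'; have Oc := O0_cst (4 * A - 4 * B).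
move: e4; rewrite appD // z0 add0r at0_cst -mulrBr => /eqP.
by rewrite mulf_eq0 (negbTE (four0 C)) /= subr_eq0 => /eqP.
Qed.

(** By [expansion] for [V = F'], where now [A = B], the same Laurent polynomial
    [c G + x F + y + u z + t / z + 4 A F'] vanishes at 0 and at infinity. So it
    is zero; compare the coefficients of [z^4], [z^2], [z^-2] and [z^-4]. *)
Lemma rigid_F : exists m, [/\ a4 = m * bb C, a2 = m, b2 = - m & b4 = m * bb' C].
Proof.
have eAB := rigid_AB.
have [c [x [y [u [t [[r Or e1] [r' Or' e2]]]]]]] := bijet_glue h2.
have z4 p4 p2 q2 q4 : O0 (z ^+ 4 * clau 0 p4 p2 0 0 0 q2 q4 0).
  by rewrite /clau rmorph0; apply: (lau_z4_in sO (zz0 C) (O0_zz C)); exact: O0_cst.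
have [|s Os es] := @expansion A B c _ _ F' r G' AB Or _ eG erefl e1.
  by rewrite eF.
have [||s' Os' es'] := @expansion B A c _ _ (swap F') r' (swap G') BA Or' _ swapG _ e2.
- by rewrite swapF.
- by rewrite fmorph_div rmorphM swap_cst.
have scale a p4 p2 q2 q4 : cst a * clau 0 p4 p2 0 0 0 q2 q4 0 =
    clau 0 (a * p4) (a * p2) 0 0 0 (a * q2) (a * q4) 0.
  by rewrite /clau !(rmorphM cst) !rmorph0; exact: lau_scale.
rewrite eF scale lau_sum in es.
have e3 : swap (z * s) = z * s'.
  rewrite -es -lau_sum -scale -eF rmorph_shape !swap_cst swap_GG swap_lin -es'.
  by rewrite eAB.
have O3 : O0 (z * s') by apply: (subringM sO) => //; exact: O0_zz.
have [[c00 x4 x2 _ _] [_ y2 y4 _]] := clau_eq0 Os O3 es (etrans (congr1 swap es) e3).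
have fA : 4 * A != 0 by rewrite mulf_neq0 ?four0.
have solve (p q : C) : p + 4 * A * q = 0 -> q = - p / (4 * A).
  move=> /eqP; rewrite addrC addr_eq0 => /eqP e; apply: (mulfI fA).
  by rewrite e mulrC divfK.
exists (- x / (4 * A)); rewrite (solve _ _ x4) (solve _ _ x2) (solve _ _ y2) (solve _ _ y4).
by split; ring.
Qed.

End Rigid.
End Jets.

(** * No semilinear involution fixes the marked point *)

Section SubstitutionFormulas.
Variables (L : fieldType) (f : {rmorphism L -> L}) (v d b b' : L).
Hypotheses (v0 : v != 0) (d0 : d != 0) (fb : f b = b') (fb' : f b' = b).

Lemma image_G_scale : f v = d * v ->
  f (v ^+ 12 + (v ^+ 12)^-1 - 2) = lau v (d ^+ 12) 0 0 0 (- 2) 0 0 0 (d ^+ 12)^-1.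
Proof.
move=> fv; rewrite rmorphB rmorphD fmorphV rmorphXn fv rmorph_nat exprMn.
by rewrite /lau !mul0r !addr0 invfM addrAC.
Qed.

Lemma image_G_inv : f v = d / v ->
  f (v ^+ 12 + (v ^+ 12)^-1 - 2) = lau v (d ^+ 12)^-1 0 0 0 (- 2) 0 0 0 (d ^+ 12).
Proof.
move=> fv; rewrite rmorphB rmorphD fmorphV rmorphXn fv rmorph_nat expr_div_n.
by rewrite /lau !mul0r !addr0 invf_div [v ^+ 12 / _]mulrC; ring.
Qed.

Let fF4 : f (v ^+ 4) = f v ^+ 4. Proof. exact: rmorphXn. Qed.
Let fF2 : f (v ^+ 2) = f v ^+ 2. Proof. exact: rmorphXn. Qed.

Lemma image_F_scale : f v = d * v ->
  f (b * v ^+ 4 + b' / v ^+ 4 + v ^+ 2 - (v ^+ 2)^-1) =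
  lau v 0 (b' * d ^+ 4) (d ^+ 2) 0 0 0 (- (d ^+ 2)^-1) (b / d ^+ 4) 0.
Proof.
move=> fv; rewrite rmorphB !rmorphD fmorph_div rmorphM fmorphV fF4 fF2 fv fb fb'.
by rewrite /lau; field; rewrite v0 d0.
Qed.

Lemma image_F_inv : f v = d / v ->
  f (b * v ^+ 4 + b' / v ^+ 4 + v ^+ 2 - (v ^+ 2)^-1) =
  lau v 0 (b / d ^+ 4) (- (d ^+ 2)^-1) 0 0 0 (d ^+ 2) (b' * d ^+ 4) 0.
Proof.
move=> fv; rewrite rmorphB !rmorphD fmorph_div rmorphM fmorphV fF4 fF2 fv fb fb'.
by rewrite !expr_div_n invf_div /lau; field; rewrite v0 d0.
Qed.

End SubstitutionFormulas.

Section MonomialFormulas.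
Variables (L : fieldType) (f : {rmorphism L -> L}) (v d d' : L).
Hypotheses (v0 : v != 0) (d0 : d != 0) (fd : f d = d').

Lemma mono_quot_ge k m : (m <= k)%N -> d * v ^+ k / v ^+ m = d * v ^+ (k - m).
Proof. by move=> mk; rewrite -{1}(subnK mk) exprD mulrA mulfK // expf_neq0. Qed.

Lemma mono_quot_lt k m : (k < m)%N -> d * v ^+ k / v ^+ m = d / v ^+ (m - k).
Proof.
move=> km; rewrite -{1}(subnK (ltnW km)) exprD -mulrA; congr (_ * _).
by rewrite invfM mulrC divfK // expf_neq0.
Qed.

Lemma mono_twice e : f v = d * v ^+ e -> f (f v) = d' * d ^+ e * v ^+ (e * e).
Proof.
by move=> fv; rewrite [in LHS]fv rmorphM rmorphXn fd fv exprMn -exprM mulrA.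
Qed.

Lemma mono_inv_twice e : f v = d / v ^+ e -> f (f v) = d' / d ^+ e * v ^+ (e * e).
Proof.
move=> fv; rewrite [in LHS]fv fmorph_div rmorphXn fd fv expr_div_n -exprM.
by rewrite invf_div mulrA mulrAC.
Qed.

End MonomialFormulas.

Section NoInvolution.
Variable C : numClosedFieldType.
Notation K := {fraction {poly C}}.
Notation z := (zz C).
Notation cst := (cst C).
Notation GG := (GG C).
Notation gg := (gg C).
Notation FF := (FF C).
Notation cf := (@cf C).
Notation XM := (XM C).
Notation X := (X C).
Notation glue := (glue C).

Lemma generic_full (a : K) : lring (generic XM) a.
Proof.
have [p [q [q0 ->]]] := fraction_repr a.
have gc : in_chart (M := XM) i1 (generic XM) by exact: generic_chart.
apply: (subringM (lring_subring (generic XM))); first exact/gc/chart1_poly.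
have : unit_in (lring (generic XM)) (tofrac q); last by case.
apply/(generic_unit (M := XM)); split; first by rewrite tofrac_eq0.
exact/gc/chart1_poly.
Qed.

(** A divisor of a power of the variable. *)
Lemma monomial_of_unit (p q : {poly C}) N : p * q = 'X^N ->
  exists c k, c != 0 /\ p = c%:P * 'X^k.
Proof.
move=> e; have : p %| ('X - 0%:P) ^+ N by rewrite subr0 -e dvdp_mulr.
case/dvdp_exp_XsubCP => k _; rewrite subr0 => /eqpP[[u w] /= /andP[u0 w0] euw].
exists (w / u), k; split; first by rewrite mulf_neq0 ?invr_eq0.
rewrite mul_polyC; apply: (scalerI u0).
by rewrite euw scalerA mulrC divfK.
Qed.

Variable H : hom (atlas_scheme XM) (atlas_scheme XM).
Hypotheses (lH : @lies_over C C (conj C) X X H).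
Hypotheses (HH : hom_eq (hcomp H H) (hid (atlas_scheme XM))) (HP : H glue = glue).

Let HHpt x : H (H x) = x. Proof. exact: (HH.1 x). Qed.
Let Hsurj y : exists x, H x = y. Proof. by exists (H y). Qed.

Definition theta : {rmorphism K -> K} :=
  @induced XM XM H generic_full Hsurj.

Lemma theta_follows : @follows XM XM (rmorph_phom theta) H.
Proof. exact: induced_follows. Qed.

Lemma theta_cst a : theta (cst a) = cst a^*.
Proof.
have wg : whole (point XM) (H (generic XM)) := I.
have wg' : hpre H (whole (point XM)) (generic XM) := I.
have := theta_follows.2 _ (@const C X (whole (point XM)) a) (generic XM) wg.
by rewrite (value_const _ wg) lH (value_const _ wg').
Qed.

Lemma thetaK : involutive theta.
Proof.
move=> a; have f2 : @follows XM XM (rmorph_phom (theta \o theta)) (hcomp H H).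
  exact: (follows_comp theta_follows theta_follows).
pose V := regular_open (N := XM) a; pose s := regular_sec (N := XM) a.
have Vg : V (generic XM) := generic_full a.
have Vs : value (s : section V) = a by rewrite (value_to_sec _ Vg).
have VH : V (hcomp H H (generic XM)) by rewrite (HH.1 (generic XM)).
have h1 : V `<=` hpre (hcomp H H) V.
  by move=> x Vx; rewrite /hpre /preim /= HHpt.
have h2 : V `<=` hpre (hid (atlas_scheme XM)) V by [].
have e := congr1 (fun t : section V => value t) (HH.2 V s V h1 h2).
have e1 : value (res h1 (pull (hcomp H H) V s) : section V) = theta (theta a).
  by rewrite (value_rres _ _ Vg) -[in RHS]Vs; exact: (f2.2 V s _ VH).
have e2 : value (res h2 (pull (hid (atlas_scheme XM)) V s) : section V) = a.
  by rewrite (value_rres _ _ Vg) -[in RHS]Vs; exact: ((@follows_hid XM).2 V s _ Vg).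
by rewrite -e1 -[RHS]e2.
Qed.

Lemma H_torus x : in_chart (M := XM) i1 x -> in_chart (M := XM) i1 (H x).
Proof.
move=> hx; apply: contrapT => /off_torus e.
by apply: (@glue_not_chart1 C); rewrite -HP -e HHpt.
Qed.

Lemma theta_chart1 a : gen_alg cst cf i1 a -> gen_alg cst cf i1 (theta a).
Proof.
move=> Aa; have reg x : chart_open (M := XM) i1 x -> lring x (theta a).
  move=> hx; apply: (dominates_in (follows_dominates x theta_follows)).
  exact: (H_torus hx).
have := section_chart (to_sec reg).
by rewrite (value_to_sec _ (@chart_openg XM i1)).
Qed.

Lemma theta_glue a : lring glue a -> lring glue (theta a).
Proof.
move=> Pa; apply: (dominates_in (follows_dominates glue theta_follows)).
by rewrite HP.
Qed.

Let znz := zz0 C.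

Lemma mono_eq (c : C) n : cst c * z ^+ n = z -> c = 1 /\ n = 1%N.
Proof.
have -> : cst c * z ^+ n = tofrac (c *: 'X^n) by rewrite -mul_polyC tofracM tofracXn.
move=> /eqP; rewrite tofrac_eq => /eqP e.
have c0 : c != 0.
  apply/eqP => c0; move: e; rewrite c0 scale0r => /eqP.
  by rewrite eq_sym polyX_eq0.
have n1 : n = 1%N.
  have := congr1 (fun p : {poly C} => size p) e.
  by rewrite size_scale // size_polyXn size_polyX => -[].
split=> //; have := congr1 (fun p : {poly C} => p`_1) e.
by rewrite coefZ coefXn coefX n1 /= mulr1.
Qed.

(** The involution preserves the ring of Laurent polynomials, hence maps its
    unit [z] to a monomial [c z^e], and [e^2 = 1]. For [e = - 1] the condition
    that the square of [theta] fixes [z] says that [c] is real. *)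
Lemma theta_z : exists2 c, c != 0 &
  theta z = cst c * z \/ (theta z = cst c / z /\ c^* = c).
Proof.
have [p [m ep]] := chart1_laurent (theta_chart1 (chart1_z C)).
have [q [n eq]] := chart1_laurent (theta_chart1 (chart1_zV C)).
have zX k : z ^+ k != 0 by rewrite expf_neq0.
have pq : p * q = 'X^(m + n).
  have : theta z * theta z^-1 = 1 by rewrite -rmorphM divff // rmorph1.
  rewrite ep eq mulf_div -tofracM -exprD => /(canRL (divfK (zX _))).
  by rewrite mul1r -tofracXn => /eqP; rewrite tofrac_eq => /eqP.
have [c [k [c0 pE]]] := monomial_of_unit pq; exists c => //.
have k0 : cst c != 0 by rewrite fmorph_eq0.
have e1 : theta z = cst c * z ^+ k / z ^+ m by rewrite ep pE tofracM tofracXn.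
have tt : theta (theta z) = z := thetaK z.
have [mk|km] := leqP m k; [left | right].
  have e2 : theta z = cst c * z ^+ (k - m) := etrans e1 (mono_quot_ge _ znz mk).
  have : cst (c^* * c ^+ (k - m)) * z ^+ ((k - m) * (k - m)) = z.
    by rewrite (rmorphM cst) (rmorphXn cst) -(mono_twice (theta_cst c) e2).
  case/mono_eq => _ dd; move: e2 dd; case: (k - m)%N => [|[|d]] // -> _.
have e2 : theta z = cst c / z ^+ (m - k) := etrans e1 (mono_quot_lt _ znz km).
have : cst (c^* / c ^+ (m - k)) * z ^+ ((m - k) * (m - k)) = z.
  by rewrite (fmorph_div cst) (rmorphXn cst) -(mono_inv_twice (theta_cst c) e2).
case/mono_eq => cc dd; move: e2 dd cc; case: (m - k)%N => [|[|d]] // -> _.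
by rewrite ?expr1 => cc; split=> //; rewrite -[c^*](divfK c0) cc mul1r.
Qed.

Lemma theta_gg (a b : K) : theta GG = b -> theta (a / gg) = cst (- 4) * theta a / b.
Proof.
move=> eb; rewrite fmorph_div /gg rmorphM eb theta_cst.
have -> : ((- 4^-1)^* : C) = - 4^-1 by rewrite rmorphN fmorphV rmorph_nat.
by rewrite invfM -fmorphV invrN invrK mulrA [cst _ * _]mulrC.
Qed.

(** By [rigid_F] the image of [F] is a multiple [m F]. If [z] goes to [c z],
    comparing coefficients yields [m^2 = 1] and [1 - i = m (1 + i)]. If [z]
    goes to [c / z], it yields [c^2 = - 1], although [c] is real. *)
Lemma no_involution : False.
Proof.
have [c c0 ez] := theta_z; have k0 : cst c != 0 by rewrite fmorph_eq0.
have lc j : lring glue (theta (cf j / cf i0)).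
  by apply: theta_glue; apply: (glue_chart0 (C := C)); exact: gen_algX.
have l1 := lc i1; have l4 := lc i4.
have tb : theta (cst (bb C)) = cst (bb' C) by rewrite theta_cst bb_conj.
have tb' : theta (cst (bb' C)) = cst (bb C) by rewrite theta_cst bb'_conj.
have l1' b : theta GG = b -> lring glue (cst (- 4) / b).
  by move=> eb; have := l1; rewrite [theta _](theta_gg 1 eb) rmorph1 mulr1.
have l4' b : theta GG = b -> lring glue (cst (- 4) * theta FF / b).
  by move=> eb; have := l4; rewrite [theta _](theta_gg FF eb).
have c12 : c ^+ 12 != 0 by rewrite expf_neq0.
case: ez => [ez|[ez cr]].
- have eG : theta GG = clau (c ^+ 12) 0 0 0 (- 2) 0 0 0 (c ^+ 12)^-1.
    rewrite GGE (image_G_scale ez) /clau !rmorph0 (rmorphXn cst).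
    by rewrite (fmorphV cst) (rmorphXn cst) rmorphN rmorph_nat.
  have eF : theta FF = clau 0 (bb' C * c ^+ 4) (c ^+ 2) 0 0 0 (- (c ^+ 2)^-1)
      (bb C / c ^+ 4) 0.
    rewrite FFE (image_F_scale znz k0 tb tb' ez) /clau !rmorph0 (rmorphXn cst).
    rewrite (rmorphM cst) (rmorphXn cst) (rmorphN cst) (fmorphV cst) (rmorphXn cst).
    by rewrite (fmorph_div cst) (rmorphXn cst).
  have [m [m1 m2 m3 m4]] := rigid_F (divff c12) eG eF (l1' _ erefl) (l4' _ erefl).
  have mm : m * m = 1.
    rewrite -{1}m2; have -> : m = (c ^+ 2)^-1 by apply: oppr_inj.
    by rewrite divff // expf_neq0.
  have mb : bb' C = m * bb C.
    by rewrite -m1 (exprM c 2 2) m2 expr2 mm mulr1.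
  have : (m - 1) * (m + 1) = 0 by rewrite -subr_sqr expr2 mm expr1n subrr.
  move/eqP; rewrite mulf_eq0 subr_eq0 addr_eq0 => /orP[]/eqP em.
    by have := bb'_neq C; rewrite mb em mul1r eqxx.
  by have := bb'_neqN C; rewrite mb em mulN1r eqxx.
- have eG : theta GG = clau (c ^+ 12)^-1 0 0 0 (- 2) 0 0 0 (c ^+ 12).
    rewrite GGE (image_G_inv ez) /clau !rmorph0 (rmorphXn cst).
    by rewrite (fmorphV cst) (rmorphXn cst) rmorphN rmorph_nat.
  have eF : theta FF = clau 0 (bb C / c ^+ 4) (- (c ^+ 2)^-1) 0 0 0 (c ^+ 2)
      (bb' C * c ^+ 4) 0.
    rewrite FFE (image_F_inv znz k0 tb tb' ez) /clau !rmorph0.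
    rewrite (fmorph_div cst) (rmorphXn cst) (rmorphN cst) (fmorphV cst) !(rmorphXn cst).
    by rewrite (rmorphM cst) (rmorphXn cst).
  have [m [m1 m2 m3 m4]] := rigid_F (mulVf c12) eG eF (l1' _ erefl) (l4' _ erefl).
  have c2n : c ^+ 2 != 0 by rewrite expf_neq0.
  have m5 : m = (c ^+ 4)^-1 by apply: (mulIf (bb0 C)); rewrite -m1 mulrC.
  have : c ^+ 2 = - 1.
    have : - (c ^+ 2)^-1 = (c ^+ 2)^-1 * (c ^+ 2)^-1.
      by rewrite m2 m5 (exprM c 2 2) expr2 invfM.
    move=> e; apply: (invr_inj); rewrite invrN1; apply: (mulIf (invr_neq0 c2n)).
    by rewrite mulN1r e.
  move=> cm; have := mul_conjC_ge0 c.
  by rewrite cr -expr2 cm oppr_ge0 ler10.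
Qed.

End NoInvolution.

(** * Points of projective space *)

Section PspacePoint.
Variables (k : fieldType) (n : nat).
Notation P := (pspace_model k n).
Implicit Types x y : point P.

Lemma pspace_scalar x c : lring x (scalar k n c).
Proof. exact: (kin_lring (M := P)). Qed.

Lemma pspace_scalar_unit x c : c != 0 -> unit_in (lring x) (scalar k n c).
Proof.
move=> c0; split; rewrite ?fmorph_eq0 //; first exact: pspace_scalar.
by rewrite -fmorphV; exact: pspace_scalar.
Qed.

Definition coords_at x (i : 'I_n.+1) (e : 'I_n.+1 -> k) : Prop :=
  in_chart (M := P) i x /\
  forall j, small (lring x) (hcoord k j / hcoord k i - scalar k n (e j)).

(** Every function of the chart is a polynomial in the coordinates, so they
    determine its value. *)
Lemma coords_at_inj x y i e : coords_at x i e -> coords_at y i e -> x = y.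
Proof.
move=> [hx cx] [hy cy].
have val a : gen_alg (scalar k n) (@hcoord k n) i a -> exists c,
    small (lring x) (a - scalar k n c) /\ small (lring y) (a - scalar k n c).
  move: a; apply: (gen_alg_min (S := [set a | exists c,
    small (lring x) (a - scalar k n c) /\ small (lring y) (a - scalar k n c)])).
  - by move=> c; exists c; rewrite subrr; split;
      [exact: (small0 (lring_local x)) | exact: (small0 (lring_local y))].
  - move=> a b [c [sx sy]] [d [tx ty]]; exists (c + d).
    have -> : a + b - scalar k n (c + d) = (a - scalar k n c) + (b - scalar k n d).
      by rewrite (rmorphD (scalar k n)) opprD addrACA.
    by split; [exact: (smallD (lring_local x)) | exact: (smallD (lring_local y))].
  - move=> a b [c [sx sy]] [d [tx ty]]; exists (c * d).
    have h (L : fieldType) (u v w t : L) :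
      u * v - w * t = u * (v - t) + t * (u - w) by ring.
    rewrite (rmorphM (scalar k n)) h.
    have prod (w : point P) : small (lring w) (a - scalar k n c) ->
        small (lring w) (b - scalar k n d) -> small (lring w)
        (a * (b - scalar k n d) + scalar k n d * (a - scalar k n c)).
      move=> sa sb; have lw := lring_local w; apply: (smallD lw); apply: (smallM lw) => //.
        rewrite -(subrK (scalar k n c) a); apply: (subringD lw.1); first by case: sa.
        exact: pspace_scalar.
      exact: pspace_scalar.
    by split; exact: prod.
  - by move=> j; exists (e j); split; [exact: cx | exact: cy].
have uE (w : point P) a c : lring w a -> small (lring w) (a - scalar k n c) ->
    unit_in (lring w) a <-> c != 0.
  move=> wa sa; have lw := lring_local w; split=> [u|c0].
    by apply/eqP => c0; move: sa; rewrite c0 rmorph0 subr0 => -[].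
  have -> : a = scalar k n c + (a - scalar k n c) by rewrite addrC subrK.
  by apply: (unit_inD lw); [exact: pspace_scalar_unit | case: sa | case: sa].
apply: (point_eq_chart hx hy) => a Aa; have [c [sx sy]] := val a Aa.
by rewrite (uE x a c) ?(uE y a c) //; [exact: hy | exact: hx].
Qed.

End PspacePoint.

Lemma rmorph_mpoly_eq (k : fieldType) (n : nat) (S : comNzRingType)
  (u v : {rmorphism {mpoly k[n]} -> S}) :
  (forall c, u c%:MP = v c%:MP) -> (forall i, u 'X_i = v 'X_i) -> u =1 v.
Proof.
move=> hC hX; elim/mpolyind => [|c m p _ _ IH]; first by rewrite !rmorph0.
rewrite !rmorphD IH -mul_mpolyC !rmorphM hC; congr (_ * _ + _).
rewrite mpolyXE_id !rmorph_prod; apply: eq_bigr => i _.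
by rewrite !rmorphXn hX.
Qed.

(** * Complex conjugation of projective space *)

Section PspaceConj.
Variables (k : fieldType) (n : nat) (sigma : {rmorphism k -> k}).
Hypothesis sigmaK : involutive sigma.
Notation P := (pspace_model k n).
Notation S := {mpoly k[n.+1]}.

Definition conj_mpoly : {rmorphism S -> S} :=
  mmap (@mpolyC n.+1 k \o sigma) (fun i => 'X_i : S).

Lemma conj_mpolyC c : conj_mpoly c%:MP = (sigma c)%:MP.
Proof. by rewrite /= mmapC. Qed.

Lemma conj_mpolyX i : conj_mpoly 'X_i = 'X_i.
Proof. by rewrite /= mmapX mmap1U. Qed.

Lemma conj_mpolyK : involutive conj_mpoly.
Proof.
have eC c : conj_mpoly (conj_mpoly c%:MP) = c%:MP by rewrite !conj_mpolyC sigmaK.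
have eX i : conj_mpoly (conj_mpoly 'X_i) = 'X_i by rewrite !conj_mpolyX.
exact: (rmorph_mpoly_eq (u := conj_mpoly \o conj_mpoly) (v := idfun)).
Qed.

Definition conj_phom : phom (fld P) (fld P) :=
  frac_phom (@tofrac S \o conj_mpoly).

Lemma conj_phom_frac (a b : S) : b != 0 -> dom conj_phom (tofrac a / tofrac b) /\
  conj_phom (tofrac a / tofrac b) = tofrac (conj_mpoly a) / tofrac (conj_mpoly b).
Proof.
move=> b0; apply: (frac_phom_frac (ev := @tofrac S \o conj_mpoly)).
rewrite /= tofrac_eq0; apply: contra_neq b0 => e.
by rewrite -(conj_mpolyK b) [conj_mpoly b]e rmorph0.
Qed.

Lemma conj_phom_dom s : dom conj_phom s.
Proof. by have [a [b [b0 ->]]] := fraction_repr s; case: (conj_phom_frac a b0). Qed.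

Lemma conj_phomK s : conj_phom (conj_phom s) = s.
Proof.
have [a [b [b0 ->]]] := fraction_repr s.
have b0' : conj_mpoly b != 0.
  by apply: contra_neq b0 => e; rewrite -(conj_mpolyK b) e rmorph0.
by rewrite (conj_phom_frac a b0).2 (conj_phom_frac _ b0').2 !conj_mpolyK.
Qed.

Lemma conj_phom_scalar c : conj_phom (scalar k n c) = scalar k n (sigma c).
Proof.
have e := (frac_phom_tofrac (@tofrac S \o conj_mpoly) c%:MP).2.
exact: etrans e (congr1 (@tofrac S) (conj_mpolyC c)).
Qed.

Lemma conj_phom_coord i j : conj_phom (hcoord k i / hcoord k j) = hcoord k i / hcoord k j.
Proof.
have x0 : ('X_j : S) != 0 by rewrite -(@tofrac_eq0 S); exact: (hcoord0 k j).
by rewrite (conj_phom_frac _ x0).2 !conj_mpolyX.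
Qed.

Lemma conj_defined (x : point P) : exists j, forall l,
  dom conj_phom (hcoord k l / hcoord k j) /\
  lring x (conj_phom (hcoord k l / hcoord k j)).
Proof.
have [j hj] := point_chart x; exists j => l; rewrite conj_phom_coord.
by split; [exact: conj_phom_dom | apply: hj; exact: gen_algX].
Qed.

Lemma conj_scalar_regular c (x : point P) : lring x (conj_phom (scalar k n c)).
Proof. by rewrite conj_phom_scalar; exact: pspace_scalar. Qed.

Definition pspace_conj : hom (atlas_scheme P) (atlas_scheme P) :=
  @proj_hom k (fld P) (scalar k n) n (@hcoord k n) (@hcoord0 k n) P conj_phom
    (fun c => conj_phom_dom _) conj_scalar_regular conj_defined.

Lemma pspace_conj_follows : @follows P P conj_phom pspace_conj.
Proof. exact: proj_hom_follows. Qed.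

Lemma pspace_conj_semilinear : @lies_over k k sigma (pspace k n) (pspace k n) pspace_conj.
Proof. exact: (follows_lies_over pspace_conj_follows conj_phom_scalar). Qed.

Lemma pspace_conjK : hom_eq (hcomp pspace_conj pspace_conj) (hid (atlas_scheme P)).
Proof.
apply: (@follows_eq P P (id_phom _)); last exact: follows_hid.
apply: (follows_comp pspace_conj_follows pspace_conj_follows) => s _ _; split=> //.
exact/esym/conj_phomK.
Qed.

Lemma pspace_conj_coords (x : point P) i e : (forall j, sigma (e j) = e j) ->
  coords_at x i e -> coords_at (pspace_conj x) i e.
Proof.
move=> se [hx cx]; have d := follows_dominates x pspace_conj_follows.
have hi : in_chart (M := P) i (pspace_conj x).
  apply: (dominates_chart d).
  apply: (@proj_regular k (fld P) (scalar k n) n (@hcoord k n) P conj_phom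
    (fun c => conj_phom_dom _) conj_scalar_regular x i).
  move=> l; rewrite conj_phom_coord; split; first exact: conj_phom_dom.
  by apply: hx; exact: gen_algX.
split=> // j; have [xs ns] := cx j.
have ys : lring (pspace_conj x) (hcoord k j / hcoord k i - scalar k n (e j)).
  apply: (subringB (lring_subring (pspace_conj x))); last exact: pspace_scalar.
  by apply: hi; exact: gen_algX.
split=> //; rewrite -(dominates_unitE d ys) appB; try exact: conj_phom_dom.
by rewrite conj_phom_coord conj_phom_scalar se.
Qed.

End PspaceConj.

(** * The Belyi map *)

Section GMap.
Variable C : numClosedFieldType.
Notation K := {fraction {poly C}}.
Notation z := (zz C).
Notation cst := (cst C).
Notation GG := (GG C).
Notation gg := (gg C).
Notation cf := (@cf C).
Notation XM := (XM C).
Notation X := (X C).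
Notation glue := (glue C).
Notation P := (pspace_model C 1).
Notation S := {mpoly C[2]}.

Definition o0 : 'I_2 := ord0.
Definition o1 : 'I_2 := @Ordinal 2 1 isT.

Lemma ord2P (i : 'I_2) : i = o0 \/ i = o1.
Proof. by case: i => [[|[|m]]] hm //; [left|right]; exact: val_inj. Qed.

Definition gcoord (i : 'I_2) : K := if i == o0 then gg else 1.

Lemma gcoord0 i : gcoord i != 0.
Proof.
by rewrite /gcoord; case: ifP => _; [exact: gg0 | exact: oner_neq0].
Qed.

Definition geval : {rmorphism S -> K} := mmap cst gcoord.

Lemma gevalC c : geval c%:MP = cst c. Proof. by rewrite /= mmapC. Qed.
Lemma gevalX i : geval 'X_i = gcoord i. Proof. by rewrite /= mmapX mmap1U. Qed.

Definition gphom : phom (fld P) K := frac_phom geval.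

Lemma gphom_scalar c : dom gphom (scalar C 1 c) /\ gphom (scalar C 1 c) = cst c.
Proof.
by have [d e] := frac_phom_tofrac geval c%:MP; split=> //; exact: etrans e (gevalC c).
Qed.

Lemma gphom_coord i j : dom gphom (hcoord C j / hcoord C i) /\
  gphom (hcoord C j / hcoord C i) = gcoord j / gcoord i.
Proof.
have x0 : geval 'X_i != 0 by rewrite gevalX gcoord0.
by have [d e] := frac_phom_frac 'X_j x0; split=> //; rewrite [LHS]e !gevalX.
Qed.

Lemma torus_gg x : in_chart (M := XM) i1 x -> lring x gg.
Proof. by move=> h; have := lring_cf i0 h; rewrite [cf i1]/(1 : K) divr1. Qed.

Lemma gphom_torus x j : in_chart (M := XM) i1 x ->
  dom gphom (hcoord C j / hcoord C o1) /\ lring x (gphom (hcoord C j / hcoord C o1)).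
Proof.
move=> h; have [d ->] := gphom_coord o1 j; split=> //; rewrite /gcoord /= divr1.
by case: eqP => _; [exact: torus_gg | exact: (subring1 (lring_subring x))].
Qed.

Lemma gphom_glue j :
  dom gphom (hcoord C j / hcoord C o0) /\ lring glue (gphom (hcoord C j / hcoord C o0)).
Proof.
have [d ->] := gphom_coord o0 j; split=> //; rewrite /gcoord /=.
have [_|_] := eqVneq j o0.
  by rewrite divff ?gg0 //; exact: (subring1 (lring_subring glue)).
by apply: (glue_chart0 (C := C)); exact: (gen_algX cst cf i0 i1).
Qed.

Lemma gmap_defined (x : point XM) : exists j, forall l,
  dom gphom (hcoord C l / hcoord C j) /\ lring x (gphom (hcoord C l / hcoord C j)).
Proof.
have [h|/off_torus ->] := pselect (in_chart (M := XM) i1 x).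
  by exists o1 => l; exact: gphom_torus.
by exists o0 => l; exact: gphom_glue.
Qed.

Lemma gphom_scalar_regular c (x : point XM) : lring x (gphom (scalar C 1 c)).
Proof. by rewrite (gphom_scalar c).2; exact: lring_cst. Qed.

Definition gmap : hom (atlas_scheme XM) (atlas_scheme P) :=
  @proj_hom C (fld P) (scalar C 1) 1 (@hcoord C 1) (@hcoord0 C 1) XM gphom
    (fun c => (gphom_scalar c).1) gphom_scalar_regular gmap_defined.

Lemma gmap_follows : @follows XM P gphom gmap.
Proof. exact: proj_hom_follows. Qed.

Let dm x := follows_dominates x gmap_follows.

Lemma gmap_over : @over_base C X (pspace C 1) gmap.
Proof. exact: (follows_lies_over gmap_follows (fun c => (gphom_scalar c).2)). Qed.

Lemma gmap_chart (x : point XM) i : (forall j, lring x (gcoord j / gcoord i)) ->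
  in_chart (M := P) i (gmap x).
Proof.
move=> h; apply: (dominates_chart (dm x)).
apply: (@proj_regular C (fld P) (scalar C 1) 1 (@hcoord C 1) XM gphom
  (fun c => (gphom_scalar c).1) gphom_scalar_regular x i) => l.
by have [d ->] := gphom_coord i l.
Qed.

Lemma gmap_coords (x : point XM) i e : (forall j, small (lring x) (gcoord j / gcoord i - cst (e j))) ->
  coords_at (gmap x) i e.
Proof.
move=> h; have hi : in_chart (M := P) i (gmap x).
  apply: gmap_chart => j; rewrite -(subrK (cst (e j)) (_ / _)).
  by apply: (subringD (lring_subring x)); [case: (h j) | exact: lring_cst].
split=> // j; have [d e1] := gphom_coord i j; have [d' e2] := gphom_scalar (e j).
have ys : lring (gmap x) (hcoord C j / hcoord C i - scalar C 1 (e j)).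
  apply: (subringB (lring_subring (gmap x))); last exact: pspace_scalar.
  by apply: hi; exact: gen_algX.
split=> //; rewrite -(dominates_unitE (dm x) ys) appB // e1 e2.
by case: (h j).
Qed.

Lemma small_eq0 (O : set K) a : is_local O -> a = 0 -> small O a.
Proof. by move=> lO ->; exact: small0. Qed.

Lemma gmap_value (x : point XM) c : in_chart (M := XM) i1 x -> small (lring x) (gg - cst c) ->
  coords_at (gmap x) o1 (fun j => if j == o0 then c else 1).
Proof.
move=> h s; apply: gmap_coords => j; rewrite [gcoord o1]/(1 : K) divr1 /gcoord.
case: ifP => // _; apply: small_eq0; first exact: (lring_local x).
by rewrite rmorph1 subrr.
Qed.

(** ** Values and derivatives at the points of the torus *)

Section Torus.
Variable a : C.
Hypothesis a0 : a != 0.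
Notation Ta := (torus_pt a0).
Notation ata := (ata a).

Lemma torus_pt_multiple t : gen_alg cst cf i1 t -> small (lring Ta) ((z - cst a) * t).
Proof.
move=> At; rewrite mulrC; apply: (smallM (lring_local Ta)); last exact: torus_pt_small.
exact: (torus_pt_chart a0 At).
Qed.

(** The value of [t] at [a] is the derivative of [gg] there, and vanishes only
    if [a^24 = 1]. *)
Lemma gg_derivative : exists2 t, gen_alg cst cf i1 t &
  gg = cst (- 4^-1 * (a ^+ 12 + (a ^+ 12)^-1 - 2)) + (z - cst a) * t /\
  ata t = - 4^-1 * (12%:R * a ^+ 11 * (1 - (a ^+ 24)^-1)).
Proof.
have sA := @chart_subring XM i1.
pose p : {poly C} := \sum_(i < 12) 'X^(11 - i) * a%:P ^+ i.
have ep : (z - cst a) * tofrac p = z ^+ 12 - cst a ^+ 12.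
  rewrite -[z]/(tofrac 'X) -[cst a]/(tofrac a%:P) -tofracB -tofracM.
  by rewrite -subrXX tofracB !tofracXn.
have vp : p.[a] = 12%:R * a ^+ 11.
  rewrite /p horner_sum (eq_bigr (fun=> a ^+ 11)).
    by rewrite sumr_const card_ord mulr_natl.
  move=> i _; rewrite hornerM hornerXn horner_exp hornerC -exprD subnK //.
  by rewrite -ltnS ltn_ord.
exists (cst (- 4^-1) * (tofrac p * (1 - (cst a ^+ 12)^-1 * (z^-1) ^+ 12))).
  apply: gen_algM; first exact: gen_algC; apply: gen_algM; first exact: chart1_poly.
  apply: (subringB sA); first exact: (subring1 sA).
  rewrite -(rmorphXn cst) -(fmorphV cst); apply: gen_algM; first exact: gen_algC.
  by apply: (subringX sA); exact: chart1_zV.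
have k0 : cst a != 0 by rewrite fmorph_eq0.
split.
  have h (L : fieldType) (v b q r : L) : v != 0 -> b != 0 ->
      (v - b) * q = v ^+ 12 - b ^+ 12 ->
      r * (v ^+ 12 + (v ^+ 12)^-1 - 2) = r * (b ^+ 12 + (b ^+ 12)^-1 - 2) +
      (v - b) * (r * (q * (1 - (b ^+ 12)^-1 * (v^-1) ^+ 12))).
    move=> v0 b0 e.
    have -> : (v - b) * (r * (q * (1 - (b ^+ 12)^-1 * (v^-1) ^+ 12))) =
      r * ((v - b) * q) * (1 - (b ^+ 12)^-1 * (v^-1) ^+ 12) by ring.
    by rewrite e; field; rewrite v0 b0.
  rewrite /gg GGE (h _ _ _ _ _ (zz0 C) k0 ep).
  by rewrite (rmorphM cst) (rmorphB cst) (rmorphD cst) (fmorphV cst) (rmorphXn cst)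
    (rmorph_nat cst).
have dp := (ata_poly a p).1; have d1 := subring1 (dom_subring ata).
have dzi : dom ata (z^-1) := ata_chart1 a0 (chart1_zV C).
have dXi : dom ata ((z^-1) ^+ 12) := subringX (dom_subring ata) 12 dzi.
have dc c : dom ata (cst c) by case: (ata_poly a c%:P).
have vX : ata ((z^-1) ^+ 12) = (a ^+ 12)^-1.
  have [dz ez] := ata_poly a 'X.
  have ez' : ata (z ^+ 12) = a ^+ 12.
    by rewrite -[z ^+ 12](tofracXn 12 'X) (ata_poly a _).2 hornerXn.
  have dz12 : dom ata (z ^+ 12) := subringX (dom_subring ata) 12 dz.
  by rewrite exprVn app_inv ?ez' // expf_neq0.
rewrite -(rmorphXn cst) -(fmorphV cst).
have dcX : dom ata (cst (a ^+ 12)^-1 * z^-1 ^+ 12) := subringM (dom_subring ata) (dc _) dXi.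
have d1cX : dom ata (1 - cst (a ^+ 12)^-1 * z^-1 ^+ 12) := subringB (dom_subring ata) d1 dcX.
have dpq := subringM (dom_subring ata) dp d1cX.
rewrite appM // ata_cst appM // appB // app1 appM // ata_cst vX (ata_poly a p).2 vp.
by rewrite -invfM -exprD.
Qed.

End Torus.
End GMap.

(** * Finite extensions *)

Section SimpleExtension.
Variables (F E : fieldType) (j : {rmorphism F -> E}) (z : E) (m : {poly F}).
Hypotheses (m0 : m != 0) (mz : root (map_poly j m) z).

Let ev (p : {poly F}) : E := (map_poly j p).[z].

Lemma ev_algebraic p : algebraicOver j (ev p).
Proof.
elim/poly_ind: p => [|p c IH]; first by rewrite /ev rmorph0 horner0; exact: algebraic0.
rewrite /ev rmorphD rmorphM /= map_polyX map_polyC hornerD hornerM hornerX hornerC.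
apply: algebraic_add; last exact: algebraic_id.
by apply: algebraic_mul => //; exists m.
Qed.

(** The inverse of an algebraic element is read off from a polynomial relation
    with nonzero constant term. *)
Lemma ev_inverse q : exists r, (ev q)^-1 = ev r.
Proof.
have [y0|y0] := eqVneq (ev q) 0.
  by exists 0; rewrite y0 invr0 /ev rmorph0 horner0.
have [u u0 uy] := ev_algebraic q; move: u0 uy.
elim/poly_ind: u => [|u c IH u0]; first by rewrite eqxx.
have [c0|c0] := eqVneq c 0.
  move: u0; rewrite c0 addr0 => u0; rewrite rmorphM /= map_polyX rootM => /orP[|].
    by apply: IH; move: u0; rewrite mulf_eq0 negb_or => /andP[].
  by rewrite /root hornerX (negbTE y0).
rewrite rmorphD rmorphM /= map_polyX map_polyC /root hornerD hornerM hornerX hornerC.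
move=> /eqP e; exists (- c^-1 *: (u \Po q)).
rewrite /ev linearZ /= map_comp_poly hornerZ horner_comp -/(ev q).
have k0 : j c != 0 by rewrite fmorph_eq0.
apply: (mulIf y0); rewrite mulVf // -mulrA.
have -> : (map_poly j u).[ev q] * ev q = - j c by apply/eqP; rewrite -addr_eq0 e.
by rewrite rmorphN fmorphV mulrNN mulVf.
Qed.

Lemma simple_extension p q : exists2 t : {poly F}, (size t < size m)%N & ev p / ev q = ev t.
Proof.
have [r er] := ev_inverse q; exists ((p * r) %% m); first by rewrite ltn_modp.
have -> : ev p / ev q = ev (p * r) by rewrite er /ev rmorphM hornerM.
rewrite {1}/ev [in LHS](divp_eq (p * r) m) rmorphD rmorphM hornerD hornerM.
by rewrite (rootP mz) mulr0 add0r.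
Qed.

End SimpleExtension.

(** As [w] is a linear function of [z^12 + z^-12], the element [z] is a root of
    a polynomial of degree 24 with coefficients in [w]. *)
Lemma palindromic_extension (F E : fieldType) (j : {rmorphism F -> E}) (w : F) (z : E) :
  z != 0 -> (4 : E) != 0 -> j w = - 4^-1 * (z ^+ 12 + (z ^+ 12)^-1 - 2) ->
  exists n, forall p q : {poly F}, exists2 t : {poly F}, (size t < n)%N &
    (map_poly j p).[z] / (map_poly j q).[z] = (map_poly j t).[z].
Proof.
move=> z0 n4 e; pose m : {poly F} := 'X^24 + (4 * w - 2)%:P * 'X^12 + 1.
exists (size m) => p q; apply: simple_extension.
  apply/eqP => /(congr1 (horner^~ 0)); rewrite /m !hornerE !expr0n /= mulr0 !add0r.
  by move/eqP; rewrite oner_eq0.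
rewrite /root /m !(rmorphD (map_poly j)) (rmorphM (map_poly j)) rmorph1 /=.
rewrite !map_polyXn map_polyC !hornerE /= (rmorphB j) (rmorphM j) !(rmorph_nat j) e.
apply/eqP.
have [z12 -> ->] : [/\ z ^+ 12 != 0, z ^+ 24 = z ^+ 12 * z ^+ 12 &
    forall a : E, a * z * z * z * z * z * z * z * z * z * z * z * z = a * z ^+ 12].
  by split=> [||a]; rewrite ?expf_neq0 -?exprD // !exprS !mulrA mulr1.
by move: (z ^+ 12) z12 => v v0; field; rewrite v0 n4.
Qed.

(** * Ramification *)

Section Ramification.
Variable C : numClosedFieldType.
Notation K := {fraction {poly C}}.
Notation z := (zz C).
Notation cst := (cst C).
Notation GG := (GG C).
Notation gg := (gg C).
Notation cf := (@cf C).
Notation XM := (XM C).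
Notation X := (X C).
Notation glue := (glue C).
Notation P := (pspace_model C 1).
Notation S := {mpoly C[2]}.
Notation gmap := (gmap C).
Notation gphom := (gphom C).
Notation gen := (generic XM).

Let dm x := follows_dominates x (gmap_follows C).

Lemma gg_not_cst a : gg != cst a.
Proof.
apply/eqP => e; have [r Or er] := @cf_small C i1 isT.
have [_ z0] := at0_zM Or; move: z0; rewrite -er.
have -> : cf i1 / cf i0 = cst a^-1 by rewrite -[cf i0]/gg e fmorphV -[cf i1]/(1 : K) div1r.
rewrite at0_cst => /eqP; rewrite invr_eq0 => /eqP a0.
by have := gg0 C; rewrite e a0 rmorph0 eqxx.
Qed.

Definition at_gg : {rmorphism K -> K} := subst idfun gg_not_cst.

Let y0 := gmap gen.

Lemma y0_chart : in_chart (M := P) o1 y0.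
Proof. by apply: gmap_chart => j; exact: generic_full. Qed.

(** The residue field of the image of the generic point is the field of
    rational functions of [gg]. *)
Lemma at_gg_lift f : exists2 q, lring y0 q & gphom q = at_gg f.
Proof.
pose u : fld P := hcoord C o0 / hcoord C o1.
have yu : lring y0 u by apply: y0_chart; exact: gen_algX.
have eu : gphom u = gg by rewrite (gphom_coord C o1 o0).2 /gcoord /= divr1.
have sy := lring_subring y0; have dd := dominates_dom (dm gen).
have polyn p : exists2 q, lring y0 q & gphom q = at_gg (tofrac p).
  elim/poly_ind: p => [|p c [q yq eq]].
    exists 0; first exact: (subring0 sy).
    by rewrite app0 tofrac0 (rmorph0 at_gg).
  have yc := pspace_scalar y0 c; have yqu := subringM sy yq yu.
  exists (q * u + scalar C 1 c); first exact: (subringD sy).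
  rewrite appD; [|exact: dd|exact: dd]; rewrite appM; [|exact: dd|exact: dd].
  rewrite eq eu (gphom_scalar c).2 tofracD tofracM (rmorphD at_gg) (rmorphM at_gg).
  by rewrite (subst_zz idfun gg_not_cst) (subst_cst idfun gg_not_cst).
have [a [b [b0 ->]]] := fraction_repr f.
have [qa ya ea] := polyn a; have [qb yb eb] := polyn b.
have nb : gphom qb != 0 by rewrite eb fmorph_eq0 tofrac_eq0.
have [_ _ yb'] : unit_in (lring y0) qb.
  apply: (dominates_unit (dm gen) yb); apply/(generic_unit (M := XM)).
  by split=> //; exact: generic_full.
exists (qa / qb); first exact: (subringM sy).
rewrite appM; [|exact: dd|exact: dd]; rewrite app_inv //; last exact: dd.
by rewrite ea eb (rmorphM at_gg) (fmorphV at_gg).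
Qed.

Lemma poly_at_gg p : (map_poly at_gg (map_poly cst p)).[z] = tofrac p.
Proof.
rewrite tofrac_poly -map_poly_comp /= (@horner_coef_wide _ (size p)).
  apply: eq_bigr => i _; rewrite coef_map_id0; last exact: (rmorph0 (at_gg \o cst)).
  by congr (_ * _); exact: (subst_cst idfun gg_not_cst).
exact: size_poly.
Qed.

Lemma generic_finite : exists n, forall s : K, exists2 q : nat -> fld P,
  (forall i, lring y0 (q i)) & s = \sum_(i < n) gphom (q i) * z ^+ i.
Proof.
have n4 : (4 : K) != 0.
  by have := four0 C; rewrite -(fmorph_eq0 cst) (rmorph_nat cst).
have e : at_gg z = - 4^-1 * (z ^+ 12 + (z ^+ 12)^-1 - 2).
  rewrite [LHS](subst_zz idfun gg_not_cst) /gg GGE (rmorphN cst) (fmorphV cst).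
  by rewrite (rmorph_nat cst).
have [n hn] := palindromic_extension (zz0 C) n4 e.
exists n => s; have [a [b [_ ->]]] := fraction_repr s.
have [t st] := hn (map_poly cst a) (map_poly cst b).
rewrite !poly_at_gg => ->.
have lift i : exists q, lring y0 q /\ gphom q = at_gg t`_i.
  by have [q yq eq] := at_gg_lift t`_i; exists q.
have [q hq] := boolp.choice lift.
exists q => [i|]; first by case: (hq i).
rewrite (@horner_coef_wide _ n).
  apply: eq_bigr => i _; rewrite (hq i).2 coef_map_id0 //; exact: (rmorph0 at_gg).
by rewrite (leq_trans (size_poly _ _)) // ltnW.
Qed.

Lemma value_sum (M : atlas) (U : opens (point M)) (n : nat) (s : 'I_n -> section U) :
  value (\sum_i s i) = \sum_i value (s i).
Proof. exact: (big_morph (@value M U) (@valueD M U) (@value0 M U)). Qed.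

Lemma regular_nbhd (M : atlas) (y : point M) (q : nat -> fld M) (n : nat) :
  (forall i, lring y (q i)) -> exists W : opens (point M),
    W y /\ forall x i, W x -> (i < n)%N -> lring x (q i).
Proof.
move=> yq; elim: n => [|n [W [Wy hW]]]; first by exists (whole (point M)).
exists (Opens (openI (oset_open W) (@open_regular M (q n)))); split=> //.
  by split=> //; exact: yq.
by move=> x i [Wx xn]; rewrite ltnS leq_eqVlt => /orP[/eqP->//|]; exact: hW.
Qed.

(** The local ring is the function field, so its maximal ideal is zero; and the
    function field is spanned by powers of [z] over the rational functions of
    [gg], by [generic_finite]. *)
Lemma unramified_generic : unramified_at gmap gen.
Proof.
split.
  move=> U s [Ug nu].
  have s0 : s = 0.
    apply: value_eq => _; apply/eqP; apply: contrapT => /negP v0; apply: nu.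
    by apply/(inv_atP (M := XM)) => //; apply/(generic_unit (M := XM)); split=> //;
      exact: generic_full.
  exists U, (whole (point P)), (@subset_refl _ _), (@subsetT _ _), 0%N.
  exists (fun i => 0), (fun i => 0); split=> // [[]//|].
  by rewrite big_ord0 s0 rmorph0.
have [n hn] := generic_finite.
have gc : in_chart (M := XM) i1 gen by exact: generic_chart.
pose U0 : opens (point XM) := chart_open (M := XM) i1.
have rz (i : 'I_n) x : U0 x -> lring x (z ^+ i).
  by move=> h; apply: (subringX (lring_subring x)); case: (torus_z h).
exists U0, n, (fun i : 'I_n => to_sec (rz i)); split=> // U s Ug.
have [q yq es] := hn (value (s : section U)).
have [W [Wy hW]] := regular_nbhd n yq.
pose V : opens (point XM) :=
  Opens (openI (openI (oset_open (hpre gmap W)) (oset_open U)) (oset_open U0)).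
have h0 : V `<=` U0 by move=> x [].
have hU : V `<=` U by move=> x [[]].
have hw : V `<=` hpre gmap W by move=> x [[]].
have Vg : V gen by [].
exists V, W, h0, hU, hw, (fun i : 'I_n => to_sec (fun y (Wy : W y) => hW y i Wy (ltn_ord i))).
apply/(vanishes_atP (M := XM)) => //; rewrite valueB value_sum (value_rres _ _ Vg) es.
rewrite -sumrB big1 => [[]|i _]; first by rewrite eqxx.
rewrite valueM !(value_rres _ _ Vg) (value_to_sec _ (gc : U0 gen)).
by rewrite ((gmap_follows C).2 _ _ _ Wy) (value_to_sec _ Wy) subrr.
Qed.

Definition gval (a : C) : C := - 4^-1 * (a ^+ 12 + (a ^+ 12)^-1 - 2).

Lemma torus_pt_value (a : C) (a0 : a != 0) : small (lring (torus_pt a0)) (gg - cst (gval a)).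
Proof.
have [t At [e _]] := gg_derivative a0.
by rewrite e addrAC subrr add0r; exact: torus_pt_multiple.
Qed.

Lemma torus_pt_coords (a : C) (a0 : a != 0) :
  coords_at (gmap (torus_pt a0)) o1 (fun j => if j == o0 then gval a else 1).
Proof. by apply: gmap_value; [exact: torus_pt_chart | exact: torus_pt_value]. Qed.

(** The function [gg - gg(a)] is the product of the parameter [z - a] by a
    function whose value at [a] is the derivative, hence a unit. *)
Lemma unramified_torus_pt (a : C) (a0 : a != 0) : a ^+ 24 != 1 ->
  unramified_at gmap (torus_pt a0).
Proof.
move=> a1; have [t At [eg et]] := gg_derivative a0; set x := torus_pt a0.
have lx := lring_local x; have sx := lx.1; have hx : in_chart (M := XM) i1 x := torus_pt_chart a0.
have wy : chart_open (M := P) o1 (gmap x) by case: (torus_pt_coords a0).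
have ut : unit_in (lring x) t.
  apply/torus_pt_unit; rewrite // et mulf_neq0 //.
    by rewrite oppr_eq0 invr_eq0; exact: four0.
  rewrite mulf_neq0 //; last by rewrite subr_eq0 eq_sym invr_eq1.
  by rewrite mulf_neq0 ?expf_neq0 // pnatr_eq0.
split.
  move=> U s [Ux nu]; have xs := value_in (s : section U) Ux.
  have [u [v [Au Av v0 es]]] := torus_pt_frac xs; have uv := (torus_pt_unit a0 Av).2 v0.
  have u0 : ata a u = 0.
    apply/eqP; apply: contrapT => /negP u0; apply: nu; apply/(inv_atP (M := XM)) => //.
    rewrite es; apply: (unit_inM sx); first exact/torus_pt_unit.
    exact: unit_in_inv.
  have [u' Au' eu] := ata_div a0 Au; rewrite u0 rmorph0 add0r in eu.
  pose A := u' / (v * t).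
  have xA : lring x A.
    apply: (subringM sx); first exact: hx.
    by case: (unit_inM sx uv ut).
  pose W : opens (point P) := chart_open (M := P) o1.
  pose tc : sec (W : opens (pspace C 1)) := coord C o1 o0 - const (W : opens (pspace C 1)) (gval a).
  have vtc : value (tc : section W) = hcoord C o0 / hcoord C o1 - scalar C 1 (gval a).
    by rewrite valueB value_coord (value_const _ wy).
  pose V : opens (point XM) := Opens (openI (openI (oset_open (hpre gmap W)) (oset_open U))
    (oset_open (regular_open (N := XM) A))).
  have hU : V `<=` U by move=> y [[]].
  have hw : V `<=` hpre gmap W by move=> y [[]].
  have rA y : V y -> lring y A by case.
  have Vx : V x by [].
  exists V, W, hU, hw, 1%N, (fun=> to_sec rA), (fun=> tc); split=> //.
    move=> _; apply/(vanishes_atP (M := P)) => //; rewrite vtc.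
    by case: (torus_pt_coords a0) => _ /(_ o0)[].
  rewrite big_ord1; apply: value_eq => Vg; rewrite valueM !(value_rres _ _ Vg).
  rewrite (value_to_sec _ Vg) ((gmap_follows C).2 _ _ _ wy) vtc.
  have [d1 e1] := gphom_coord C o1 o0; have [d2 e2] := gphom_scalar (gval a).
  rewrite appB // e1 e2 /gcoord /= divr1 eg addrAC subrr add0r es eu.
  have h (L : fieldType) (p q r w : L) : q != 0 -> r != 0 ->
    w * p / q = p / (q * r) * (w * r) by move=> q0 r0; field; rewrite q0 r0.
  by apply: h; [case: uv | case: ut].
exists (whole (point XM)), 1%N, (fun=> 1); split=> // U s Ux.
have [c sc] := torus_pt_residue (value_in (s : section U) Ux).
exists U, (whole (point P)), (@subsetT _ _), (@subset_refl _ _), (@subsetT _ _).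
exists (fun=> const (whole (point P) : opens (pspace C 1)) c).
apply/(vanishes_atP (M := XM)) => //; rewrite big_ord1 rmorph1 mulr1 valueB.
rewrite !(value_rres _ _ Ux) ((gmap_follows C).2 _ _ _ (I : whole (point P) (gmap x))).
rewrite (value_const _ (I : whole (point P) (gmap x))).
by rewrite [gphom _](gphom_scalar c).2.
Qed.

End Ramification.

(** * The marked map *)

Section MarkedMap.
Variable C : numClosedFieldType.
Notation K := {fraction {poly C}}.
Notation z := (zz C).
Notation cst := (cst C).
Notation gg := (gg C).
Notation cf := (@cf C).
Notation XM := (XM C).
Notation X := (X C).
Notation glue := (glue C).
Notation P := (pspace_model C 1).
Notation P1 := (pspace C 1).
Notation S := {mpoly C[2]}.
Notation gmap := (gmap C).
Notation gphom := (gphom C).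

(** If no [z - a] vanishes at [x], every nonzero polynomial is invertible
    there, being a product of linear factors. *)
Lemma torus_point x : in_chart (M := XM) i1 x ->
  (exists (a : C) (a0 : a != 0), x = torus_pt a0) \/ x = generic XM.
Proof.
move=> hx; have [[a sa]|n] := pselect (exists a, small (lring x) (z - cst a)).
  left; have a0 : a != 0.
    apply/eqP => a0; case: sa => _; apply; rewrite a0 rmorph0 subr0; exact: torus_z.
  by exists a, a0; exact: torus_pt_uniq.
right; have gc : in_chart (M := XM) i1 (generic XM) by exact: generic_chart.
apply: (point_eq_chart hx gc) => s As; split=> [[s0 _ _]|[s0 _ _]].
  by apply/(generic_unit (M := XM)); split=> //; exact: generic_full.
have [p [m es]] := chart1_laurent As.
have p0 : p != 0.
  by apply: contra_neq s0; rewrite es => ->; rewrite tofrac0 mul0r.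
have [rs _ hrs] := root_point p0.
rewrite es; apply: (unit_inM (lring_subring x)).
  by apply: contrapT => /(hrs x hx)[r _ sr]; apply: n; exists r.
by apply: unit_in_inv; apply: (unit_inX (lring_subring x)); exact: torus_z.
Qed.

Lemma coords_at_vanish (y : point P) i e c j : coords_at y i e -> e j = c ->
  @vanishes_at P1 (chart_open (M := P) i)
    (coord C i j - const (chart_open (M := P) i : opens P1) c) y.
Proof.
move=> [hy /(_ j)[_ nu]] ec; have Uy : chart_open (M := P) i y by [].
apply/(vanishes_atP (M := P)) => //.
by rewrite valueB value_coord (value_const _ Uy) -ec.
Qed.

Definition zeta : C := 12.-root (- 1).
Lemma zeta12 : zeta ^+ 12 = - 1. Proof. exact: rootCK. Qed.
Lemma zeta0 : zeta != 0.
Proof. by apply/eqP => e; have /eqP := zeta12; rewrite e expr0n eq_sym oppr_eq0 oner_eq0. Qed.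

Definition p0 : point P := gmap (torus_pt (oner_neq0 C)).
Definition p1 : point P := gmap (torus_pt zeta0).
Definition poo : point P := gmap glue.

Lemma gval0 (a : C) : a ^+ 12 = 1 -> gval a = 0.
Proof. by rewrite /gval => ->; rewrite invr1 -[1 + 1]/(2 : C) subrr mulr0. Qed.

Lemma gval1 (a : C) : a ^+ 12 = - 1 -> gval a = 1.
Proof.
have n4 : (4 : C) != 0 by rewrite pnatr_eq0.
by rewrite /gval => ->; rewrite invrN1; field.
Qed.

Lemma p0_coords : coords_at p0 o1 (fun j => if j == o0 then 0 else 1).
Proof. by have := torus_pt_coords (oner_neq0 C); rewrite gval0 ?expr1n. Qed.

Lemma p1_coords : coords_at p1 o1 (fun=> 1).
Proof.
have [h c] := torus_pt_coords zeta0; split=> // j.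
by have := c j; rewrite (gval1 zeta12) if_same.
Qed.

(** The point [1 : 1] lies in both charts, so its coordinates have to be read
    in both. *)
Lemma p1_coords_oo : coords_at p1 o0 (fun=> 1).
Proof.
have := torus_pt_value zeta0; rewrite (gval1 zeta12) rmorph1 => s1.
set x := torus_pt zeta0; have lx := lring_local x.
have ug : unit_in (lring x) gg.
  rewrite -(subrK 1 gg) addrC; apply: (unit_inD lx); last by case: s1.
    exact: (unit_in1 lx.1).
  by case: s1.
have [g0 _ gi] := ug.
apply: gmap_coords => j; rewrite rmorph1 [gcoord C o0]/gg /gcoord; case: ifP => _.
  by rewrite divff // subrr; exact: (small0 lx).
have -> : 1 / gg - 1 = - gg^-1 * (gg - 1).
  by rewrite mulrBr mulr1 mulNr mulVf // div1r opprK addrC.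
by apply: (smallM lx) => //; exact: (subringN lx.1).
Qed.

Lemma poo_coords : coords_at poo o0 (fun j => if j == o0 then 1 else 0).
Proof.
have lx := lring_local glue; apply: gmap_coords => j; rewrite [gcoord C o0]/gg /gcoord.
case: ifP => _; first by rewrite rmorph1 divff ?gg0 // subrr; exact: (small0 lx).
have [r Or er] := @cf_small C i1 isT; have [_ r0] := at0_zM Or.
rewrite rmorph0 subr0; have A : gen_alg cst cf i0 (1 / gg) by exact: (gen_algX cst cf i0 i1).
split; first by apply: (glue_chart0 (C := C)).
by rewrite (glue_unit A) -[1 / gg]/(cf i1 / gg) er r0 eqxx.
Qed.

Lemma line_marked : @marked_line C P1 p0 p1 poo.
Proof.
exists _, (coord C (n := 1)); split; first exact: pspaceP.
- split; first by exists o1; rewrite /= oner_neq0.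
  move=> i; have [->|->] := ord2P i; first by rewrite eqxx.
  by move=> _ j; apply: (coords_at_vanish p0_coords); rewrite /= divr1.
- split; first by exists o1; rewrite oner_neq0.
  move=> i _ j; have [->|->] := ord2P i; rewrite divr1.
    exact: (coords_at_vanish p1_coords_oo).
  exact: (coords_at_vanish p1_coords).
- split; first by exists o0; rewrite /= oner_neq0.
  move=> i; have [->|->] := ord2P i; last by rewrite eqxx.
  by move=> _ j; apply: (coords_at_vanish poo_coords); rewrite /= divr1.
Qed.

Definition belyi : pointed_map C := @PointedMap C X P1 gmap glue p0 p1 poo.

Lemma poo_neq_p0 : poo <> p0.
Proof.
move=> e; have [h c] := poo_coords; have [h' c'] := p0_coords.
have [_] := c o1; rewrite /= rmorph0 subr0; apply.
by apply: (@trans_unit P o0 o1) => //; rewrite e.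
Qed.

Lemma belyi_marked : marked_map belyi.
Proof.
split; [split; [exact: X_curve | exact: glue_rational] | exact: line_marked
       | exact: gmap_over |].
move=> [y h]; apply: poo_neq_p0.
exact: (etrans (h glue) (esym (h (torus_pt (oner_neq0 C))))).
Qed.

Lemma belyi_unramified : unramified_outside_01oo belyi.
Proof.
move=> x n0 n1 noo; have [hx|/off_torus e] := pselect (in_chart (M := XM) i1 x); last first.
  by case: noo; rewrite e.
have [[a [a0 e]]|->] := torus_point hx; last exact: unramified_generic.
rewrite e in n0 n1 *; apply: unramified_torus_pt; apply/eqP => a24.
have /orP[/eqP a12|/eqP a12] : (a ^+ 12 == 1) || (a ^+ 12 == - 1).
  by rewrite -sqrf_eq1 -exprM a24.
- apply: n0; apply: (coords_at_inj (torus_pt_coords a0)).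
  by rewrite (gval0 a12); exact: p0_coords.
- apply: n1; apply: (coords_at_inj (torus_pt_coords a0)); have [h c] := p1_coords.
  by split=> // j; rewrite (gval1 a12) if_same; exact: c.
Qed.

End MarkedMap.

(** * The conjugate marked map *)

Section ConjugateMap.
Variable C : numClosedFieldType.
Notation K := {fraction {poly C}}.
Notation gg := (gg C).
Notation XM := (XM C).
Notation X := (X C).
Notation glue := (glue C).
Notation P := (pspace_model C 1).
Notation P1 := (pspace C 1).
Notation S := {mpoly C[2]}.
Notation gmap := (gmap C).
Notation gphom := (gphom C).
Notation phi := (@pspace_conj C 1 (conj C) (@conjCK C)).
Notation cmp := (conj_mpoly 1 (conj C)).
Notation af := (alpha_field (ci2 C)).

Lemma alpha_geval a : geval C (cmp a) = af (geval C a).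
Proof.
apply: (rmorph_mpoly_eq (u := geval C \o cmp) (v := af \o geval C)) => [c|i].
  apply: (etrans (congr1 (geval C) (conj_mpolyC 1 (conj C) c))).
  apply: (etrans (gevalC _)); apply/esym.
  exact: (etrans (congr1 af (gevalC c)) (alpha_cst (ci2 C) c)).
apply: (etrans (congr1 (geval C) (conj_mpolyX (conj C) i))).
rewrite -[RHS]/(af (geval C 'X_i)) !gevalX /gcoord; case: ifP => _.
  by rewrite alpha_gg.
by rewrite rmorph1.
Qed.

(** Both composites have the same effect on functions because [alpha] fixes
    [gg]. *)
Lemma conj_gmap : hom_eq (hcomp phi gmap) (hcomp gmap (alpha (ci2 C))).
Proof.
apply: (@follows_eq XM P (frac_phom (geval C \o cmp))).
  apply: (@follows_comp XM P P _ _ _ _ _ (@pspace_conj_follows C 1 (conj C) (@conjCK C))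
    (gmap_follows C)) => s _ ds.
  have [a [b [b0 es]]] := ds.
  have b1 : b != 0 by apply: contra_neq b0 => ->; rewrite rmorph0.
  have b2 : (geval C \o cmp) (cmp b) != 0 by rewrite /= (conj_mpolyK (@conjCK C)).
  have -> : s = tofrac (cmp a) / tofrac (cmp b).
    by rewrite -(conj_phomK (@conjCK C) s) es (conj_phom_frac (@conjCK C) _ b1).2.
  have [d ->] := frac_phom_frac (cmp a) b2; split=> //.
  have b1' : cmp b != 0.
    by apply: contra_neq b1 => e; rewrite -(conj_mpolyK (@conjCK C) b) e rmorph0.
  rewrite (conj_phom_frac (@conjCK C) _ b1').2 !(conj_mpolyK (@conjCK C)).
  by rewrite (frac_phom_frac a b0).2 /= !(conj_mpolyK (@conjCK C)).
apply: (follows_comp (gmap_follows C) (alpha_follows (ci2 C))) => s [a [b [b0 ->]]] _.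
have b2 : (geval C \o cmp) b != 0 by rewrite [_ b]alpha_geval fmorph_eq0.
have [d ->] := frac_phom_frac a b2; split=> //.
have e := (frac_phom_frac a b0).2.
rewrite -[RHS]/(af (gphom (tofrac a / tofrac b))) [gphom _]e (fmorph_div af).
by rewrite -!alpha_geval.
Qed.

Definition belyi_conj : pointed_map C :=
  @PointedMap C (twist (conj C) X) (twist (conj C) P1) gmap glue (p0 C) (p1 C) (poo C).

Lemma belyi_conj_base_ext : marked_map_base_ext (conj C) (belyi C) belyi_conj.
Proof.
exists (hid X), (hid P1); split=> //.
- by split; apply: twist_base_extension; exact: conjCK.
- split.
    by move=> V a; rewrite !const_twist (@gmap_over C V).
  apply: (hom_eq_trans (hcomp_idl _)); exact: (hom_eq_sym (hcomp_idr _)).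
Qed.

Lemma P1_conj_iso : @isomorphism C (twist (conj C) P1) P1 (phi : hom (twist (conj C) P1) P1).
Proof.
split.
  by move=> V a; rewrite (@pspace_conj_semilinear C 1 (conj C) (@conjCK C)) const_twist.
exists (phi : hom P1 (twist (conj C) P1)); split.
  by move=> V a; rewrite const_twist (@pspace_conj_semilinear C 1 (conj C) (@conjCK C)) /= conjCK.
by split; exact: pspace_conjK.
Qed.

Lemma belyi_conj_iso : marked_map_iso belyi_conj (belyi C).
Proof.
have fixed (y : point P) i e : (forall j, (e j : C)^* = e j) -> coords_at y i e -> phi y = y.
  move=> ee cy; apply: (coords_at_inj _ cy).
  exact: (pspace_conj_coords (@conjCK C)).
exists (alpha (ci2 C)), phi; split.
- by split; [exact: X_conj_iso | exact: P1_conj_iso].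
- exact: conj_gmap.
- exact: alpha_glue.
- split.
  + by apply: (fixed _ _ _ _ (p0_coords C)) => j; case: ifP; rewrite ?rmorph0 ?rmorph1.
  + by apply: (fixed _ _ _ _ (p1_coords C)) => j; rewrite rmorph1.
  + by apply: (fixed _ _ _ _ (poo_coords C)) => j; case: ifP; rewrite ?rmorph0 ?rmorph1.
Qed.

End ConjugateMap.

(** * Descent *)

Section Descent.
Variable R : realType.
Local Notation C := (R[i] : numClosedFieldType).

Lemma fixed_by_conj (G : set {rmorphism R[i] -> R[i]}) :
  (forall sigma, G sigma -> in_Gal sigma) -> G (conj C) ->
  fixed_subfield G = range (real_complex R).
Proof.
move=> sub Gc; apply/seteqP; split=> [w /(_ _ Gc)|_ [x _ <-] sigma /sub[_]]; last exact.
case: w => a b /= [e]; exists a => //; congr (_ +i* _)%C.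
apply/eqP; rewrite eq_sym -[b == 0](mulrn_eq0 b 2) mulr2n.
by rewrite -{1}e addNr.
Qed.

Lemma conj_in_Gal : in_Gal (conj C).
Proof.
split; first by exists (conj C); exact: (@conjCK C).
by move=> x; rewrite [LHS]conjc_real.
Qed.

(** This covers the marked curve and the marked map, since a form of the map
    contains one of its source. *)
Lemma not_over_reals (X0 : kscheme R) (Y : kscheme C) (pi : hom Y X0)
  (psi : hom Y (X C)) (y : Y) : base_extension (real_complex R) pi ->
  @isomorphism C Y (X C) psi -> rational_point (pi y) -> psi y = glue C -> False.
Proof.
move=> be is_psi rx ey.
have ry : rational_point y.
  have [_ [psi' [o' [e _]]]] := is_psi.
  rewrite -(e.1 y : psi' (psi y) = y) ey.
  by apply: (rational_semilinear (sigma := id) _ o'); last exact: glue_rational.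
have cr a : conj C (real_complex R a) = real_complex R a by rewrite [LHS]conjc_real.
have [H [lH HH HP]] := descent_involution (@conjCK C) cr be is_psi rx ry.
by apply: (no_involution lH HH); rewrite -ey.
Qed.

End Descent.

Theorem theoremB (R : realType) :
  (exists X : pointed_scheme R[i],
     [/\ marked_curve X, projective X,
         field_of_moduli_curve X = range (real_complex R) &
         ~ marked_curve_descends X]) /\
  (exists F : pointed_map R[i],
     [/\ marked_map F, projective (mm_src F) /\ unramified_outside_01oo F,
         field_of_moduli_map F = range (real_complex R) &
         ~ marked_map_descends F]).
Proof.
split.
  exists (XP R[i]); split.
  - exact: XP_marked.
  - exact: proj_model_projective.
  - apply: fixed_by_conj => [sigma []//|]; split; first exact: conj_in_Gal.
    by exists (XP_conj R[i]); split; [exact: XP_conj_base_ext | exact: XP_conj_iso].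
  - move=> [X0 [[_ rx] [Y [[pi [be e]] [psi [is_psi ey]]]]]].
    by apply: (not_over_reals be is_psi (y := mc_pt Y)) => //; rewrite e.
exists (belyi R[i]); split.
- exact: belyi_marked.
- by split; [exact: proj_model_projective | exact: belyi_unramified].
- apply: fixed_by_conj => [sigma []//|]; split; first exact: conj_in_Gal.
  by exists (belyi_conj R[i]); split; [exact: belyi_conj_base_ext | exact: belyi_conj_iso].
- move=> [F0 [[[_ rx] _ _ _] [F [[pi [rho [[be _] _ e _]]] [psi [phi [[is_psi _] _ ey _]]]]]]].
  by apply: (not_over_reals be is_psi (y := mm_pt F)) => //; rewrite e.
Qed.
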